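(* Let $n\ge1$ and let $\mathcal{SP}_n$ be the set of strict partitions of length at most $n$. (1) The series $P^{\mathbb L}_\lambda(x_1,\ldots,x_n)$, $\lambda\in\mathcal{SP}_n$, form a formal $\mathbb L$-basis of $\Gamma^{\mathbb L}(\mathbf x_n)$: every element of $\Gamma^{\mathbb L}(\mathbf x_n)$ can be written uniquely as a (possibly infinite, formally convergent) sum $\sum_{\lambda\in\mathcal{SP}_n}c_\lambda P^{\mathbb L}_\lambda(x_1,\ldots,x_n)$ with $c_\lambda\in\mathbb L$. (2) Likewise the series $Q^{\mathbb L}_\lambda(x_1,\ldots,x_n)$, $\lambda\in\mathcal{SP}_n$, form a formal $\mathbb L$-basis of $\Gamma^{\mathbb L}_+(\mathbf x_n)$.
   Context: Let $\mathbb L$ be the Lazard ring and $F(u,v)=\sum_{i,j}a_{i,j}u^iv^j$ the universal formal group law; $u+_Fv:=F(u,v)$, $\bar u$ the formal inverse ($u+_F\bar u=0$). For $k\ge1$, $[t]^k=t^k$ and $[[t]]^k=(t+_Ft)t^{k-1}$, with $[t]^0=[[t]]^0=1$. For a strict partition $\lambda=(\lambda_1>\cdots>\lambda_r>0)$ with $r\le n$, $P^{\mathbb L}_\lambda(x_1,\ldots,x_n)=\frac1{(n-r)!}\sum_{w\in S_n}w\big[\prod_{i=1}^r x_i^{\lambda_i}\prod_{i=1}^r\prod_{j=i+1}^n\frac{x_i+_Fx_j}{x_i+_F\bar x_j}\big]$ and $Q^{\mathbb L}_\lambda(x_1,\ldots,x_n)$ is defined identically with $\prod_i[[x_i]]^{\lambda_i}$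 in place of $\prod_ix_i^{\lambda_i}$. A formal power series $f(x_1,\ldots,x_n)$ over $\mathbb L$ is $\mathbb L$-supersymmetric if it is symmetric and $f(t,\bar t,x_3,\ldots,x_n)$ is independent of $t$; $\Gamma^{\mathbb L}(\mathbf x_n)$ is the set of such series, and $\Gamma^{\mathbb L}_+(\mathbf x_n)\subset\Gamma^{\mathbb L}(\mathbf x_n)$ consists of those $f$ with $f(t,x_2,\ldots,x_n)-f(0,x_2,\ldots,x_n)$ divisible by $t+_Ft$. *)

(* Defs.v *)
From HB Require Import structures.
From mathcomp Require Import all_boot all_order all_algebra all_fingroup.
Unset Implicit Arguments. Unset Printing Implicit Defensive.
Import GRing.Theory.
Local Open Scope ring_scope.

Definition mon (n : nat) := {ffun 'I_n -> nat}.
Definition mps (R : Type) (n : nat) := mon n -> R.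

Definition mdeg n (m : mon n) : nat := (\sum_(i < n) m i)%N.
Definition low n d (a : {ffun 'I_n -> 'I_d}) : mon n := [ffun i => nat_of_ord (a i)].
Definition msub n (m a : mon n) : mon n := [ffun i => (m i - a i)%N].
Definition mzero n : mon n := [ffun _ => 0%N].

Section PowerSeries.
Variable R : comNzRingType.

Definition peq n (f g : mps R n) : Prop := forall m, f m = g m.
Definition pzero n : mps R n := fun _ => 0.
Definition pone n : mps R n := fun m => (m == mzero n)%:R.
Definition padd n (f g : mps R n) : mps R n := fun m => f m + g m.
Definition pscale n (c : R) (f : mps R n) : mps R n := fun m => c * f m.

Definition pmul n (f g : mps R n) : mps R n := fun m =>
  \sum_(a : {ffun 'I_n -> 'I_(mdeg _ m).+1} | [forall i, (a i <= m i)%N])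
     f (low _ _ a) * g (msub _ m (low _ _ a)).

Definition ppow n (f : mps R n) (k : nat) : mps R n := iter k (pmul n f) (pone n).

Definition xv n (k : nat) : mps R n :=
  fun m => (m == [ffun j : 'I_n => nat_of_bool (val j == k)])%:R.

(* substitution f(g_0,...,g_{k-1}); meaningful when all g_i have zero constant term
   (only then is it used below): monomials of total degree > mdeg m cannot contribute *)
Definition pcomp k n (f : mps R k) (g : 'I_k -> mps R n) : mps R n := fun m =>
  \sum_(a : {ffun 'I_k -> 'I_(mdeg _ m).+1})
     f (low _ _ a) * (\big[pmul n/pone n]_(i < k) ppow n (g i) (a i)) m.

Definition fgl_add n (F : mps R 2) (g h : mps R n) : mps R n :=
  pcomp 2 n F (fun i : 'I_2 => if val i == 0%N then g else h).

Definition is_fgl (F : mps R 2) : Prop :=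
  [/\ peq 1 (fgl_add 1 F (xv 1 0) (pzero 1)) (xv 1 0),
      peq 1 (fgl_add 1 F (pzero 1) (xv 1 0)) (xv 1 0),
      peq 2 (fgl_add 2 F (xv 2 1) (xv 2 0)) F &
      peq 3 (fgl_add 3 F (fgl_add 3 F (xv 3 0) (xv 3 1)) (xv 3 2))
          (fgl_add 3 F (xv 3 0) (fgl_add 3 F (xv 3 1) (xv 3 2)))].

Definition fgl_bar n (ib : mps R 1) (g : mps R n) : mps R n :=
  pcomp 1 n ib (fun _ : 'I_1 => g).

Definition is_formal_inverse (F : mps R 2) (ib : mps R 1) : Prop :=
  ib (mzero 1) = 0 /\ peq 1 (fgl_add 1 F (xv 1 0) ib) (pzero 1).

End PowerSeries.

Definition lazard_univ (L : comNzRingType) (F : mps L 2) : Prop :=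
  is_fgl L F /\
  forall (R : comNzRingType) (G : mps R 2), is_fgl R G ->
    exists phi : {rmorphism L -> R},
      (forall m, phi (F m) = G m) /\
      (forall psi : {rmorphism L -> R}, (forall m, psi (F m) = G m) ->
         forall x, psi x = phi x).

Definition strict_part (n : nat) (l : seq nat) : bool :=
  [&& (size l <= n)%N, sorted (fun a b : nat => (b < a)%N) l & all (fun a => (0 < a)%N) l].

Section Gamma.
Variables (L : comNzRingType) (F : mps L 2) (ib : mps L 1) (n : nat).

Local Notation X := (xv L n).
Local Notation oplus := (fgl_add L n F).
Local Notation bar := (fgl_bar L n ib).

(* w[f] = f(x_{w(0)},...,x_{w(n-1)}) *)
Definition act (w : 'S_n) (f : mps L n) : mps L n := fun m => f [ffun i => m (w i)].

Definition symmetric (f : mps L n) : Prop := forall (w : 'S_n) m, act w f m = f m.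

(* the series (t, \bar t, x_3, ..., x_n) substituted into f; t is placed at x_1 *)
Definition susy_subst : 'I_n -> mps L n :=
  fun i => if val i == 1%N then bar (X 0) else X (val i).

(* L-supersymmetric: f(t, \bar t, x_3, ..., x_n) independent of t (vacuous if n = 1) *)
Definition supersym (f : mps L n) : Prop :=
  symmetric f /\
  ((1 < n)%N -> forall (m : mon n) (i : 'I_n), val i = 0%N -> (0 < m i)%N ->
      pcomp L n n f susy_subst m = 0).

Definition at_zero (f : mps L n) : mps L n := fun m =>
  if [exists i : 'I_n, (val i == 0%N) && (0 < m i)%N] then 0 else f m.

Definition GammaL (f : mps L n) : Prop := supersym f.

Definition GammaLplus (f : mps L n) : Prop :=
  supersym f /\
  exists g : mps L n, forall m, f m - at_zero f m = pmul L n (oplus (X 0) (X 0)) g m.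

Definition brk1 (g : mps L n) (k : nat) : mps L n := ppow L n g k.
Definition brk2 (g : mps L n) (k : nat) : mps L n :=
  if k is k'.+1 then pmul L n (oplus g g) (ppow L n g k') else pone L n.

Definition lead_mon (br : mps L n -> nat -> mps L n) (l : seq nat) : mps L n :=
  \big[pmul L n/pone L n]_(i < size l) br (X i) (nth 0%N l i).

Definition HL_num (l : seq nat) : mps L n :=
  \big[pmul L n/pone L n]_(i < size l)
     \big[pmul L n/pone L n]_(j < n | (i < j)%N) oplus (X i) (X j).

(* Delta = prod_{a <> b} (x_a +_F \bar x_b)  (a symmetric common denominator) *)
Definition HL_Delta : mps L n :=
  \big[pmul L n/pone L n]_(a < n)
     \big[pmul L n/pone L n]_(b < n | a != b) oplus (X a) (bar (X b)).

(* Delta divided by the denominator prod_{i <= r} prod_{j > i} (x_i +_F \bar x_j) *)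
Definition HL_cofactor (l : seq nat) : mps L n :=
  \big[pmul L n/pone L n]_(a < n)
     \big[pmul L n/pone L n]_(b < n | (a != b) && ~~ ((a < size l) && (a < b))%N)
        oplus (X a) (bar (X b)).

(* f = 1/(n-r)! sum_w w[ br(x)^lambda prod (x_i +_F x_j)/(x_i +_F \bar x_j) ],
   stated after multiplying by the symmetric series Delta *)
Definition HL_def (br : mps L n -> nat -> mps L n) (l : seq nat) (f : mps L n) : Prop :=
  forall m,
    ((n - size l)`!)%N%:R * pmul L n f HL_Delta m =
    (\big[padd L n/pzero L n]_(w : 'S_n)
        act w (pmul L n (lead_mon br l) (pmul L n (HL_num l) (HL_cofactor l)))) m.

Definition P_def := HL_def brk1.
Definition Q_def := HL_def brk2.

Definition expands (P : seq nat -> mps L n) (c : seq nat -> L) (f : mps L n) : Prop :=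
  forall m, exists s : seq (seq nat),
    [/\ uniq s, all (strict_part n) s,
        (forall l, strict_part n l -> l \notin s -> c l * P l m = 0) &
        f m = \sum_(l <- s) c l * P l m].

Definition formal_basis (S : mps L n -> Prop) (P : seq nat -> mps L n) : Prop :=
  (forall l, strict_part n l -> S (P l)) /\
  forall f, S f -> exists c, expands P c f /\
     forall c', expands P c' f -> forall l, strict_part n l -> c' l = c l.

End Gamma.

(* Main.v *)
(** Order the monomials by degree and then lexicographically. The leading term of P_l is x^l, that of Q_l is
    2^r x^l with r the length of l. The leading monomial of a supersymmetric series is a strict partition: in
    lowest degree the substitution (t, bar t) is (t, -t), and of the monomials sent to t^(2k) only the one with
    exponents (k, k) can be leading or later. In Gamma_+ the leading coefficient is moreover divisible by 2^r,
    because the series x_i ⊕ x_i are pairwise coprime. Expansions follow by successive elimination.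

    The sum over S_n is divisible by Delta because each pair of factors (x_a ⊕ bar x_b)(x_b ⊕ bar x_a) divides it
    and distinct pairs are coprime. Under x_2 = bar x_1 a summand either vanishes or its factors involving x_1 and
    x_2 cancel against those of Delta; modulo x_1 ⊕ x_1 the factors involving x_1 do.

    The Lazard ring enters through two properties only: it has no torsion, and a_11 is regular modulo 2. Both hold
    since it is a retract of a polynomial ring over the integers, to which F lifts degree by degree: the
    obstructions are symmetric 2-cocycles, and by Lazard's comparison lemma these are multiples of
    ((x + y)^n - x^n - y^n) / d. *)

Require Import Defs.
From HB Require Import structures.
From mathcomp Require Import all_boot all_order all_algebra all_fingroup.
From mathcomp Require Import boolp.
From mathcomp Require Import zify ring.
From mathcomp Require finmap.
From mathcomp.multinomials Require monalg.

Set Implicit Arguments.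
Unset Strict Implicit.
Unset Printing Implicit Defensive.
Import GRing.Theory Defs.
Local Open Scope ring_scope.

Arguments mdeg {n} m.
Arguments low {n d} a.
Arguments msub {n} m a.
Arguments mzero {n}.
(** * Power series *)

(** The coprimality of the series x_i ⊕ x_i is the point where the ring matters. For the additive
    law over the integers and n = 2 the claim on Q fails: 2 x_1 x_2 (x_1 + x_2) lies in Gamma_+ but
    is half of Q_(2,1). The universal law escapes because x_i ⊕ x_i = x_i (2 + a_11 x_i + ...) with
    a_11 regular modulo 2. This is why the lift of F to the polynomial ring has to be controlled in
    degree 2. The ring has one variable for each element of L, and the lift is made to have as its
    coefficient a_11 the variable attached to a_11 itself. Multiplication by a variable is visibly
    injective modulo 2, and the retraction carries this back to L. An arbitrary preimage of a_11
    would give torsion-freeness only. No fractions are formed anywhere. Denominators are cleared by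
    Delta, whose leading coefficient is 1 or -1, and coprimality of p and q always means that q is a
    non-zero-divisor modulo p, so that no factoriality of power series rings enters. *)

Section Monomials.
Variable n : nat.
Implicit Types a b m : mon n.

Definition madd a b : mon n := [ffun i => (a i + b i)%N].
Definition mle a b := [forall i, (a i <= b i)%N].
Definition munit (k : nat) : mon n := [ffun j : 'I_n => nat_of_bool (val j == k)].

Lemma mleP a b : reflect (forall i, (a i <= b i)%N) (mle a b).
Proof. exact: forallP. Qed.

Lemma maddC a b : madd a b = madd b a.
Proof. by apply/ffunP => i; rewrite !ffunE addnC. Qed.

Lemma maddA a b m : madd a (madd b m) = madd (madd a b) m.
Proof. by apply/ffunP => i; rewrite !ffunE addnA. Qed.

Lemma madd0 a : madd a mzero = a.
Proof. by apply/ffunP => i; rewrite !ffunE addn0. Qed.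

Lemma maddK a b : msub (madd a b) a = b.
Proof. by apply/ffunP => i; rewrite !ffunE addKn. Qed.

Lemma msubK a m : mle a m -> madd a (msub m a) = m.
Proof. by move=> /mleP h; apply/ffunP => i; rewrite !ffunE subnKC. Qed.

Lemma mle_addr a b : mle a (madd a b).
Proof. by apply/mleP => i; rewrite ffunE leq_addr. Qed.

Lemma mdegD a b : mdeg (madd a b) = (mdeg a + mdeg b)%N.
Proof. by rewrite /mdeg -big_split; apply: eq_bigr => i _; rewrite ffunE. Qed.

Lemma mdeg0 : mdeg (@mzero n) = 0%N.
Proof. by rewrite /mdeg big1 // => i _; rewrite ffunE. Qed.

Lemma mdeg_eq0 m : (mdeg m == 0%N) = (m == mzero).
Proof.
apply/eqP/eqP => [h|->]; last exact: mdeg0.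
apply/ffunP => i; rewrite ffunE; apply/eqP; rewrite -leqn0 -h /mdeg.
by rewrite (bigD1 i) //= leq_addr.
Qed.

Lemma leq_mdeg m i : (m i <= mdeg m)%N.
Proof. by rewrite /mdeg (bigD1 i) //= leq_addr. Qed.

Lemma mdeg_le a m : mle a m -> (mdeg a <= mdeg m)%N.
Proof. by move/mleP=> h; apply: leq_sum => i _. Qed.

Lemma mdeg_sub m a : (mdeg (msub m a) <= mdeg m)%N.
Proof. by apply: leq_sum => i _; rewrite ffunE leq_subr. Qed.

Lemma mdeg_unit (i : 'I_n) : mdeg (munit i) = 1%N.
Proof.
rewrite /mdeg (bigD1 i) //= big1 ?ffunE ?eqxx // => j.
by rewrite ffunE val_eqE => /negbTE ->.
Qed.

Lemma mdeg1P m : mdeg m = 1%N -> exists i : 'I_n, m = munit i.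
Proof.
move=> h; have [i hi|h0] := pickP (fun i => 0 < m i)%N; last first.
  suff : mdeg m = 0%N by rewrite h.
  by rewrite /mdeg big1 // => i _; apply/eqP; rewrite -leqn0 leqNgt h0.
exists i; have le : mle (munit i) m.
  by apply/mleP=> j; rewrite ffunE val_eqE; case: eqP => [->|].
rewrite -(msubK le); suff /eqP -> : msub m (munit i) == mzero by rewrite madd0.
by rewrite -mdeg_eq0 -(eqn_add2l (mdeg (munit i))) -mdegD msubK // h mdeg_unit.
Qed.

Definition box d (m : mon n) : {ffun 'I_n -> 'I_d.+1} := [ffun i => inord (m i)].

Lemma lowK d m : (forall i, m i <= d)%N -> low (box d m) = m.
Proof. by move=> h; apply/ffunP => i; rewrite !ffunE inordK // ltnS. Qed.

Lemma low_inj d : injective (@low n d).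
Proof.
move=> a b /ffunP h; apply/ffunP => i; apply: val_inj.
by have := h i; rewrite !ffunE.
Qed.

Lemma low_le d (a : {ffun 'I_n -> 'I_d.+1}) i : (low a i <= d)%N.
Proof. by rewrite ffunE -ltnS. Qed.

End Monomials.
Arguments munit {n} k.

(* Instances keyed on [mps], so that the power series operations of the definitions become ring operations. *)
HB.instance Definition _ (R : comNzRingType) (n : nat) :=
  Choice.copy (mps R n) (mon n -> R).

Section PsZmod.
Variables (R : comNzRingType) (n : nat).
Local Notation S := (mps R n).
Implicit Types f g : S.

Lemma psP f g : (forall m, f m = g m) -> f = g.
Proof. by move=> h; apply: funext. Qed.

Definition popp f : S := fun m => - f m.

Fact paddA : associative (padd R n).
Proof. by move=> f g h; apply: psP => m; rewrite /padd addrA. Qed.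
Fact paddC : commutative (padd R n).
Proof. by move=> f g; apply: psP => m; rewrite /padd addrC. Qed.
Fact padd0 : left_id (pzero R n) (padd R n).
Proof. by move=> f; apply: psP => m; rewrite /padd add0r. Qed.
Fact paddN : left_inverse (pzero R n) popp (padd R n).
Proof. by move=> f; apply: psP => m; rewrite /padd addNr. Qed.

HB.instance Definition _ := GRing.isZmodule.Build (mps R n) paddA paddC padd0 paddN.

Lemma addpE f g m : (f + g) m = f m + g m. Proof. by []. Qed.
Lemma oppE f m : (- f) m = - f m. Proof. by []. Qed.
Lemma subE f g m : (f - g) m = f m - g m. Proof. by []. Qed.
Lemma zeroE m : (0 : S) m = 0. Proof. by []. Qed.
Lemma sumE I (r : seq I) (P : pred I) (F : I -> S) m :
  (\sum_(i <- r | P i) F i) m = \sum_(i <- r | P i) F i m.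
Proof. by elim/big_rec2: _ => // i x y _ <-. Qed.

Fact pscaleA a b f : pscale R n a (pscale R n b f) = pscale R n (a * b) f.
Proof. by apply: psP => m; rewrite /pscale mulrA. Qed.
Fact pscale1 : left_id 1 (pscale R n).
Proof. by move=> f; apply: psP => m; rewrite /pscale mul1r. Qed.
Fact pscaleDr : right_distributive (pscale R n) +%R.
Proof. by move=> a f g; apply: psP => m; rewrite /pscale mulrDr. Qed.
Fact pscaleDl f : {morph (fun c => pscale R n c f) : a b / a + b}.
Proof. by move=> a b; apply: psP => m; rewrite /pscale mulrDl. Qed.

HB.instance Definition _ :=
  GRing.Zmodule_isLmodule.Build R (mps R n) pscaleA pscale1 pscaleDr pscaleDl.

Lemma scaleE (c : R) f m : (c *: f) m = c * f m. Proof. by []. Qed.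

Definition mono (a : mon n) : S := fun m => (m == a)%:R.
Definition eqd N f g := forall m, (mdeg m <= N)%N -> f m = g m.

Lemma eqd_refl N f : eqd N f f. Proof. by []. Qed.
Lemma eqd_refl' N f g : f = g -> eqd N f g. Proof. by move=> ->. Qed.
Lemma eqd_sym N f g : eqd N f g -> eqd N g f.
Proof. by move=> h m /h ->. Qed.
Lemma eqd_trans N f g h : eqd N f g -> eqd N g h -> eqd N f h.
Proof. by move=> h1 h2 m hm; rewrite h1 ?h2. Qed.
Lemma eqd_le N N' f g : (N' <= N)%N -> eqd N f g -> eqd N' f g.
Proof. by move=> le h m hm; rewrite h // (leq_trans hm). Qed.
Lemma eqdP f g : (forall N, eqd N f g) -> f = g.
Proof. by move=> h; apply: psP => m; apply: (h (mdeg m)). Qed.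
Lemma eqdD N f g f' g' : eqd N f f' -> eqd N g g' -> eqd N (f + g) (f' + g').
Proof. by move=> h1 h2 m hm; rewrite !addpE h1 ?h2. Qed.
Lemma eqdN N f f' : eqd N f f' -> eqd N (- f) (- f').
Proof. by move=> h1 m hm; rewrite !oppE h1. Qed.
Lemma eqdB N f g f' g' : eqd N f f' -> eqd N g g' -> eqd N (f - g) (f' - g').
Proof. by move=> h1 h2; apply: eqdD => //; apply: eqdN. Qed.
Lemma eqdZ N c f f' : eqd N f f' -> eqd N (c *: f) (c *: f').
Proof. by move=> h m hm; rewrite !scaleE h. Qed.
Definition pol N f : S :=
  \sum_(a : {ffun 'I_n -> 'I_N.+1}) f (low a) *: mono (low a).

Lemma polE N f (m : mon n) : (forall i, m i <= N)%N -> pol N f m = f m.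
Proof.
move=> h; rewrite /pol sumE (bigD1 (box N m)) //= scaleE /mono lowK // eqxx mulr1.
rewrite big1 ?addr0 // => a na; rewrite scaleE /mono.
case: eqP => [e|]; rewrite ?mulr0 //; case/eqP: na; apply: low_inj.
by rewrite lowK // e.
Qed.

Lemma eqd_pol N f : eqd N f (pol N f).
Proof. by move=> m hm; rewrite polE // => i; apply: leq_trans hm; apply: leq_mdeg. Qed.

End PsZmod.
Arguments mono {R n} a.

Section LinExt.
Variables (R : comNzRingType) (n k : nat).

(** Linearity together with compatibility with truncation in every degree, which is continuity with
    the identity as modulus. It passes to compositions. *)
Definition cont_lin (Phi : mps R n -> mps R k) : Prop :=
  [/\ forall f g, Phi (f + g) = Phi f + Phi g,
      forall c f, Phi (c *: f) = c *: Phi f &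
      forall N f g, eqd N f g -> eqd N (Phi f) (Phi g)].

Lemma cont_lin0 Phi : cont_lin Phi -> Phi 0 = 0.
Proof. by case=> _ h _; rewrite -(scale0r (0 : mps R n)) h scale0r. Qed.

Lemma cont_lin_sum Phi : cont_lin Phi -> forall I (r : seq I) (P : pred I) (F : I -> mps R n),
  Phi (\sum_(i <- r | P i) F i) = \sum_(i <- r | P i) Phi (F i).
Proof. by move=> h I r P F; apply: big_morph; [case: h | exact: cont_lin0]. Qed.

(** Up to any degree a series is a finite combination of monomials, so truncation-compatible linear
    maps are determined by monomials. The ring axioms and the rules of substitution are all reduced
    to monomials in this way. *)
Lemma lin_ext Phi Psi : cont_lin Phi -> cont_lin Psi ->
  (forall a, Phi (mono a) = Psi (mono a)) -> forall f, Phi f = Psi f.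
Proof.
move=> h1 h2 e f; apply: eqdP => N.
apply: eqd_trans (_ : eqd N (Phi (pol N f)) _).
  by case: h1 => _ _; apply; apply: eqd_pol.
apply: eqd_trans (_ : eqd N (Psi (pol N f)) _); last first.
  by case: h2 => _ _; apply; apply: eqd_sym; apply: eqd_pol.
suff -> : Phi (pol N f) = Psi (pol N f) by [].
rewrite /pol !cont_lin_sum //; apply: eq_bigr => a _.
by case: (h1) => _ -> _; case: (h2) => _ -> _; rewrite e.
Qed.

End LinExt.

Section PsRing.
Variables (R : comNzRingType) (n : nat).
Local Notation S := (mps R n).
Implicit Types f g : S.
Local Notation mul := (pmul R n).

Lemma pmulDl f g h : mul (f + g) h = mul f h + mul g h.
Proof.
by apply: psP => m; rewrite addpE -big_split; apply: eq_bigr => a _; rewrite addpE mulrDl.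
Qed.
Lemma pmulDr f g h : mul h (f + g) = mul h f + mul h g.
Proof.
by apply: psP => m; rewrite addpE -big_split; apply: eq_bigr => a _; rewrite addpE mulrDr.
Qed.
Lemma pmulZl c f h : mul (c *: f) h = c *: mul f h.
Proof.
by apply: psP => m; rewrite scaleE mulr_sumr; apply: eq_bigr => a _; rewrite scaleE mulrA.
Qed.
Lemma pmulZr c f h : mul h (c *: f) = c *: mul h f.
Proof.
by apply: psP => m; rewrite scaleE mulr_sumr; apply: eq_bigr => a _; rewrite scaleE mulrCA.
Qed.

Lemma eqd_pmul N f f' g g' : eqd N f f' -> eqd N g g' -> eqd N (mul f g) (mul f' g').
Proof.
move=> h1 h2 m hm; apply: eq_bigr => a ha.
have le : mle (low a) m by apply/mleP => i; rewrite ffunE; apply: (forallP ha).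
rewrite h1 ?h2 //; apply: leq_trans hm; last exact: mdeg_le.
exact: mdeg_sub.
Qed.

Lemma cont_pmull f : cont_lin (mul f).
Proof. by split=> [g h|c g|N g h e]; rewrite ?pmulDr ?pmulZr //; apply: eqd_pmul. Qed.

Lemma cont_pmulr f : cont_lin (mul^~ f).
Proof. by split=> [g h|c g|N g h e]; rewrite ?pmulDl ?pmulZl //; apply: eqd_pmul. Qed.

Lemma mono_pmul a f m : mul (mono a) f m = if mle a m then f (msub m a) else 0.
Proof.
rewrite /pmul; case: ifP => [/mleP le|nle]; last first.
  rewrite big1 // => b /forallP hb; rewrite /mono; case: eqP; rewrite ?mul0r // => e.
  by case/mleP: nle => i; rewrite -e ffunE.
have le' i : (a i <= mdeg m)%N by apply: leq_trans (leq_mdeg m i).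
rewrite (bigD1 (box (mdeg m) a)) /=; last first.
  by apply/forallP => i; have := le i; rewrite -{1}(lowK le') ffunE.
rewrite lowK // /mono eqxx mul1r big1 ?addr0 // => b /andP[_ nb].
case: eqP => [e|]; rewrite ?mul0r //; case/eqP: nb; apply: low_inj.
by rewrite lowK.
Qed.

Lemma mono_pmulM a b : mul (mono a) (mono b) = mono (madd a b) :> S.
Proof.
apply: psP => m; rewrite mono_pmul /mono; case: ifP => [le|nle].
  congr (_%:R); congr nat_of_bool; apply/eqP/eqP => [<-|->]; first by rewrite msubK.
  by rewrite maddK.
by case: eqP => // e; move: nle; rewrite e mle_addr.
Qed.

Lemma cont_comp k l (P1 : mps R k -> mps R l) (P2 : S -> mps R k) :
  cont_lin P1 -> cont_lin P2 -> cont_lin (fun f => P1 (P2 f)).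
Proof.
move=> [h1 h2 h3] [k1 k2 k3]; split=> [f g|c f|N f g h].
- by rewrite k1 h1.
- by rewrite k2 h2.
- by apply/h3/k3.
Qed.

Fact pmulC : commutative mul.
Proof.
move=> f g; apply: (lin_ext (cont_pmulr g) (cont_pmull g)) f => a.
apply: (lin_ext (cont_pmull _) (cont_pmulr _)) g => b.
by rewrite !mono_pmulM maddC.
Qed.

Fact pmulA : associative mul.
Proof.
move=> f g h.
apply: (lin_ext (cont_pmulr (mul g h)) (cont_comp (cont_pmulr h) (cont_pmulr g))) f => a.
apply: (lin_ext (cont_comp (cont_pmull _) (cont_pmulr h))
                (cont_comp (cont_pmulr h) (cont_pmull _))) g => b.
apply: (lin_ext (cont_comp (cont_pmull _) (cont_pmull _)) (cont_pmull _)) h => c.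
by rewrite !mono_pmulM maddA.
Qed.

Lemma pone_mono : pone R n = mono mzero. Proof. by []. Qed.

Fact pmul1 : left_id (pone R n) mul.
Proof.
move=> f; apply: psP => m; rewrite pone_mono mono_pmul.
have -> : mle mzero m by apply/mleP => i; rewrite ffunE.
by congr f; apply/ffunP => i; rewrite !ffunE subn0.
Qed.

Fact pone_neq0 : pone R n != 0.
Proof.
apply/eqP => /(congr1 (fun f : S => f mzero)) /eqP; rewrite /pone eqxx zeroE.
by rewrite oner_eq0.
Qed.

Fact pmulD : left_distributive mul +%R.
Proof. by move=> f g h; rewrite pmulDl. Qed.

HB.instance Definition _ :=
  GRing.Zmodule_isComNzRing.Build (mps R n) pmulA pmulC pmul1 pmulD pone_neq0.

Lemma pmulE f g : mul f g = f * g. Proof. by []. Qed.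
Lemma ppowE f k : ppow R n f k = f ^+ k.
Proof. by elim: k => [|k IH] //=; rewrite exprS -IH. Qed.
Lemma oneE m : (1 : S) m = (m == mzero)%:R. Proof. by []. Qed.

Lemma scale_mull c f g : (c *: f) * g = c *: (f * g). Proof. exact: pmulZl. Qed.
Lemma scale_mulr c f g : f * (c *: g) = c *: (f * g). Proof. exact: pmulZr. Qed.
Lemma monoM a b : mono a * mono b = mono (madd a b) :> S. Proof. exact: mono_pmulM. Qed.
Lemma mono_mulE a f m : (mono a * f) m = if mle a m then f (msub m a) else 0.
Proof. exact: mono_pmul. Qed.
Lemma mono0 : mono mzero = 1 :> S. Proof. by []. Qed.
Lemma eqdM N f f' g g' : eqd N f f' -> eqd N g g' -> eqd N (f * g) (f' * g').
Proof. exact: eqd_pmul. Qed.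
Lemma mulE f g m : (f * g) m =
  \sum_(a : {ffun 'I_n -> 'I_(mdeg m).+1} | mle (low a) m) f (low a) * g (msub m (low a)).
Proof.
by apply: eq_bigl => a; apply: eq_forallb => i; rewrite ffunE.
Qed.

Lemma natmulE f k m : (f *+ k) m = f m *+ k.
Proof. by elim: k => [|k IH]; rewrite ?mulr0n // !mulrS addpE IH. Qed.

Lemma xv_mono k : xv R n k = mono (munit k). Proof. by []. Qed.

Lemma mono_prod (m : mon n) : mono m = \prod_(i < n) xv R n i ^+ m i :> S.
Proof.
pose part k : mon n := [ffun i : 'I_n => if (i < k)%N then m i else 0%N].
have H k : (k <= n)%N -> mono (part k) = \prod_(i < n | (i < k)%N) xv R n i ^+ m i :> S.
  elim: k => [|k IH] hk.
    by rewrite big_pred0 // -mono0; congr mono; apply/ffunP => i; rewrite !ffunE.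
  rewrite (bigD1 (Ordinal hk)) //=.
  have -> : \prod_(i < n | (i < k.+1)%N && (i != Ordinal hk)) xv R n i ^+ m i
     = \prod_(i < n | (i < k)%N) xv R n i ^+ m i.
    by apply: eq_bigl => i; rewrite -val_eqE /= ltnS [(_ < k)%N]ltn_neqAle andbC.
  rewrite -IH 1?ltnW //.
  have -> j : xv R n k ^+ j = mono [ffun i : 'I_n => if val i == k then j else 0%N].
    elim: j => [|j IHj].
      by rewrite expr0 -mono0; congr mono; apply/ffunP=> i; rewrite !ffunE if_same.
    rewrite exprS IHj xv_mono monoM; congr mono; apply/ffunP => i; rewrite !ffunE.
    by case: eqP.
  rewrite monoM; congr mono; apply/ffunP => i; rewrite !ffunE ltnS.
  case: eqP => [e|/eqP ne].
    have -> : i = Ordinal hk by apply: val_inj.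
    by rewrite /= leqnn ltnn addn0.
  by rewrite add0n ltn_neqAle ne.
have := H n (leqnn n); rewrite [X in _ = X](eq_bigl xpredT); last by move=> i; rewrite ltn_ord.
by move<-; congr mono; apply/ffunP => i; rewrite ffunE ltn_ord.
Qed.

End PsRing.

Section Order1.
Variables (R : comNzRingType) (n : nat).
Local Notation S := (mps R n).
Implicit Types f g : S.

Definition ordge d f := forall m, (mdeg m < d)%N -> f m = 0.

Lemma ordge_zero d : ordge d 0. Proof. by []. Qed.
Lemma ordge_le d d' f : (d' <= d)%N -> ordge d f -> ordge d' f.
Proof. by move=> le h m hm; apply: h; apply: leq_trans le. Qed.
Lemma ordgeD d f g : ordge d f -> ordge d g -> ordge d (f + g).
Proof. by move=> h1 h2 m hm; rewrite addpE h1 ?h2 ?addr0. Qed.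
Lemma ordgeN d f : ordge d f -> ordge d (- f).
Proof. by move=> h m hm; rewrite oppE h ?oppr0. Qed.
Lemma ordgeB d f g : ordge d f -> ordge d g -> ordge d (f - g).
Proof. by move=> h1 h2; apply: ordgeD => //; apply: ordgeN. Qed.
Lemma ordgeZ d c f : ordge d f -> ordge d (c *: f).
Proof. by move=> h m hm; rewrite scaleE h ?mulr0. Qed.
Lemma ordgeM d e f g : ordge d f -> ordge e g -> ordge (d + e) (f * g).
Proof.
move=> h1 h2 m hm; rewrite mulE big1 // => a le.
have [lt|ge] := ltnP (mdeg (low a)) d; first by rewrite h1 ?mul0r.
rewrite h2 ?mulr0 //; have := congr1 mdeg (msubK le); rewrite mdegD; move: hm ge.
by move: (mdeg m) (mdeg (low a)) (mdeg (msub m (low a))) => *; lia.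
Qed.
Lemma ordgeMl d f g : ordge d f -> ordge d (f * g).
Proof. by move=> h; rewrite -[d]addn0; apply: ordgeM. Qed.
Lemma ordgeMr d f g : ordge d g -> ordge d (f * g).
Proof. by rewrite mulrC; apply: ordgeMl. Qed.
Lemma ordgeX f k : ordge 1 f -> ordge k (f ^+ k).
Proof. by move=> h; elim: k => [|k IH] //; rewrite exprS -add1n; apply: ordgeM. Qed.
Lemma ordge_prodX k (g : 'I_k -> S) (a : mon k) :
  (forall i, ordge 1 (g i)) -> ordge (mdeg a) (\prod_(i < k) g i ^+ a i).
Proof.
move=> h; rewrite /mdeg.
elim/big_rec2: _ => // i x y _ hx; apply: ordgeM => //; exact: ordgeX.
Qed.
Lemma ordge_mono a : ordge (mdeg a) (mono a : S).
Proof. by move=> m hm; rewrite /mono; case: eqP => // e; rewrite e ltnn in hm. Qed.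
Lemma ordge_xv (i : 'I_n) : ordge 1 (xv R n i).
Proof. by have := @ordge_mono (munit i); rewrite mdeg_unit. Qed.
Lemma ordge1P f : ordge 1 f <-> f mzero = 0.
Proof.
split=> [|h m]; first by apply; rewrite mdeg0.
by rewrite ltnS leqn0 mdeg_eq0 => /eqP ->.
Qed.
Lemma eqd_ordge d f g : eqd d f g <-> ordge d.+1 (f - g).
Proof.
split=> h m hm; first by rewrite subE h ?subrr.
by apply/eqP; rewrite -subr_eq0 -subE h.
Qed.
Lemma eqd_ordge0 d f : eqd d f 0 <-> ordge d.+1 f.
Proof. by rewrite eqd_ordge subr0. Qed.
End Order1.

(** * Substitution *)

Section Map.
Variables (R T : comNzRingType) (phi : {rmorphism R -> T}).

Definition mapps n (f : mps R n) : mps T n := fun m => phi (f m).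

Lemma mappsD n (f g : mps R n) : mapps (f + g) = mapps f + mapps g.
Proof. by apply: psP => m; rewrite /mapps !addpE rmorphD. Qed.
Lemma mappsB n (f g : mps R n) : mapps (f - g) = mapps f - mapps g.
Proof. by apply: psP => m; rewrite /mapps !subE rmorphB. Qed.
Lemma mappsZ n c (f : mps R n) : mapps (c *: f) = phi c *: mapps f.
Proof. by apply: psP => m; rewrite /mapps !scaleE rmorphM. Qed.
Lemma mappsM n (f g : mps R n) : mapps (f * g) = mapps f * mapps g.
Proof.
apply: psP => m; rewrite /mapps !mulE rmorph_sum; apply: eq_bigr => a _.
by rewrite rmorphM.
Qed.
Lemma mapps_mono n (a : mon n) : mapps (mono a) = mono a.
Proof. by apply: psP => m; rewrite /mapps /mono rmorph_nat. Qed.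
Lemma mapps1 n : mapps (1 : mps R n) = 1.
Proof. exact: mapps_mono. Qed.
Lemma mappsX n (f : mps R n) k : mapps (f ^+ k) = mapps f ^+ k.
Proof. by elim: k => [|k IH]; rewrite ?mapps1 // !exprS mappsM IH. Qed.
Lemma mapps_prod n I (r : seq I) (P : pred I) (F : I -> mps R n) :
  mapps (\prod_(i <- r | P i) F i) = \prod_(i <- r | P i) mapps (F i).
Proof. by apply: big_morph; [exact: mappsM | exact: mapps1]. Qed.

Lemma mapps_pcomp k n (f : mps R k) (g : 'I_k -> mps R n) :
  mapps (pcomp R k n f g) = pcomp T k n (mapps f) (fun i => mapps (g i)).
Proof.
apply: psP => m; rewrite {1}/mapps /pcomp rmorph_sum; apply: eq_bigr => a _.
rewrite rmorphM; congr (_ * _); rewrite -[phi _]/(mapps _ m); congr (_ m).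
rewrite [LHS]mapps_prod.
by apply: eq_bigr => i _; rewrite !ppowE mappsX.
Qed.

Lemma mapps_fgl_add n (F : mps R 2) (g h : mps R n) :
  mapps (fgl_add R n F g h) = fgl_add T n (mapps F) (mapps g) (mapps h).
Proof.
rewrite /fgl_add mapps_pcomp; congr pcomp.
by apply: funext => i; case: ifP.
Qed.

End Map.

Section Comp.
Variables (R : comNzRingType) (k n : nat).
Implicit Types (f : mps R k) (g : 'I_k -> mps R n).
Local Notation comp := (pcomp R k n).

Definition subst_monom g (a : mon k) := \prod_(i < k) g i ^+ a i.

Lemma pcompE f g m :
  comp f g m = \sum_(a : {ffun 'I_k -> 'I_(mdeg m).+1}) f (low a) * subst_monom g (low a) m.
Proof.
apply: eq_bigr => a _; congr (_ * _ m); apply: eq_bigr => i _.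
by rewrite ppowE ffunE.
Qed.

Lemma subst_monomD g a b : subst_monom g (madd a b) = subst_monom g a * subst_monom g b.
Proof. by rewrite /subst_monom -big_split; apply: eq_bigr => i _; rewrite ffunE exprD. Qed.

Variable g : 'I_k -> mps R n.
Hypothesis hg : forall i, ordge 1 (g i).

Lemma ordge_subst_monom a : ordge (mdeg a) (subst_monom g a).
Proof. exact: ordge_prodX. Qed.

(** Since the arguments have no constant term, a monomial of degree d is sent to a series of order
    at least d; high degrees of [f] cannot influence low degrees of the result. *)
Lemma cont_pcomp : cont_lin (comp^~ g).
Proof.
split=> [f h|c f|N f h e].
- apply: psP => m; rewrite addpE !pcompE -big_split; apply: eq_bigr => a _.
  by rewrite addpE mulrDl.
- apply: psP => m; rewrite scaleE !pcompE mulr_sumr; apply: eq_bigr => a _.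
  by rewrite scaleE mulrA.
- move=> m hm; rewrite !pcompE; apply: eq_bigr => a _.
  have [le|lt] := leqP (mdeg (low a)) N; first by rewrite e.
  by rewrite ordge_subst_monom ?mulr0 // (leq_ltn_trans hm).
Qed.

Lemma pcomp_mono a : comp (mono a) g = subst_monom g a.
Proof.
apply: psP => m; rewrite pcompE.
have [/forallP le|] := boolP [forall i, (a i <= mdeg m)%N].
  rewrite (bigD1 (box (mdeg m) a)) //= lowK // /mono eqxx mul1r big1 ?addr0 // => b nb.
  case: eqP => [e|]; rewrite ?mul0r //; case/eqP: nb; apply: low_inj.
  by rewrite lowK.
(* A monomial outside the box summed over in [pcomp] is lost there, but its image has order above
   the degree of [m], so both sides are 0. *)
rewrite negb_forall => /existsP[i]; rewrite -ltnNge => hi.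
rewrite big1 => [|b _].
  by rewrite ordge_subst_monom // (leq_trans hi) // leq_mdeg.
rewrite /mono; case: eqP => [e|]; rewrite ?mul0r //.
by move: hi; rewrite -e ltnNge low_le.
Qed.

Lemma pcomp1 : comp 1 g = 1.
Proof. by rewrite -mono0 pcomp_mono /subst_monom big1 // => i _; rewrite ffunE. Qed.

Lemma pcompM f h : comp (f * h) g = comp f g * comp h g.
Proof.
apply: (lin_ext (cont_comp cont_pcomp (cont_pmulr h))
                (cont_comp (cont_pmulr (comp h g)) cont_pcomp)) f => a.
apply: (lin_ext (cont_comp cont_pcomp (cont_pmull (mono a)))
                (cont_comp (cont_pmull (comp (mono a) g)) cont_pcomp)) h => b.
by rewrite mono_pmulM !pcomp_mono subst_monomD.
Qed.

Lemma pcompD f h : comp (f + h) g = comp f g + comp h g.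
Proof. by case: cont_pcomp. Qed.
Lemma pcompZ c f : comp (c *: f) g = c *: comp f g.
Proof. by case: cont_pcomp. Qed.
Lemma pcomp_eqdl N f f' : eqd N f f' -> eqd N (comp f g) (comp f' g).
Proof. by case: cont_pcomp => _ _ h; apply: h. Qed.
Lemma pcomp0 : comp 0 g = 0. Proof. exact: (cont_lin0 cont_pcomp). Qed.
Lemma pcompN f : comp (- f) g = - comp f g.
Proof. by apply/eqP; rewrite -addr_eq0 -pcompD addNr pcomp0. Qed.
Lemma pcompB f h : comp (f - h) g = comp f g - comp h g.
Proof. by rewrite pcompD pcompN. Qed.
Lemma pcompX f e : comp (f ^+ e) g = comp f g ^+ e.
Proof. by elim: e => [|e IH]; rewrite ?pcomp1 // !exprS pcompM IH. Qed.
Lemma pcompMn f e : comp (f *+ e) g = comp f g *+ e.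
Proof. by elim: e => [|e IH]; rewrite ?mulr0n ?pcomp0 // !mulrS pcompD IH. Qed.
Lemma pcomp_prod I (r : seq I) (P : pred I) (F : I -> mps R k) :
  comp (\prod_(i <- r | P i) F i) g = \prod_(i <- r | P i) comp (F i) g.
Proof. exact: (big_morph (comp^~ g) pcompM pcomp1). Qed.
Lemma pcomp_sum I (r : seq I) (P : pred I) (F : I -> mps R k) :
  comp (\sum_(i <- r | P i) F i) g = \sum_(i <- r | P i) comp (F i) g.
Proof. exact: (big_morph (comp^~ g) pcompD pcomp0). Qed.

Lemma pcomp_xv (i : 'I_k) : comp (xv R k i) g = g i.
Proof.
rewrite xv_mono pcomp_mono /subst_monom (bigD1 i) //= ffunE eqxx expr1 big1 ?mulr1 // => j.
by rewrite ffunE val_eqE => /negbTE ->.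
Qed.

Lemma ordge_pcomp d f : ordge d f -> ordge d (comp f g).
Proof.
move=> h m hm; rewrite pcompE big1 // => a _.
have [le|lt] := leqP d (mdeg (low a)); last by rewrite h ?mul0r.
by rewrite ordge_subst_monom ?mulr0 // (leq_trans hm).
Qed.

Lemma pcomp_mzero f : comp f g mzero = f mzero.
Proof.
have e0 : eqd 0 f (f mzero *: (1 : mps R k)).
  by move=> m; rewrite leqn0 mdeg_eq0 => /eqP ->; rewrite scaleE oneE eqxx mulr1.
have := pcomp_eqdl e0 (m := mzero); rewrite mdeg0 => -> //.
by rewrite pcompZ pcomp1 scaleE oneE eqxx mulr1.
Qed.

End Comp.

Section Comp2.
Variable R : comNzRingType.

Lemma eq_pcomp k n (f : mps R k) (g h : 'I_k -> mps R n) :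
  (forall i, g i = h i) -> pcomp R k n f g = pcomp R k n f h.
Proof. by move=> e; congr pcomp; apply: funext. Qed.

Lemma pcompA k l n (f : mps R k) (g : 'I_k -> mps R l) (h : 'I_l -> mps R n) :
  (forall i, ordge 1 (g i)) -> (forall i, ordge 1 (h i)) ->
  pcomp R l n (pcomp R k l f g) h = pcomp R k n f (fun i => pcomp R l n (g i) h).
Proof.
move=> hg hh.
have hgh i : ordge 1 (pcomp R l n (g i) h) by apply: ordge_pcomp.
apply: (lin_ext (cont_comp (cont_pcomp hh) (cont_pcomp hg)) (cont_pcomp hgh)) f => a.
rewrite !pcomp_mono // pcomp_prod //; apply: eq_bigr => i _; exact: pcompX.
Qed.

Lemma pcomp_id n (f : mps R n) : pcomp R n n f (fun i => xv R n i) = f.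
Proof.
have hx i : ordge 1 (xv R n (i : 'I_n)) by apply: ordge_xv.
apply: (lin_ext (cont_pcomp hx) (Psi := id)) => // a.
by rewrite pcomp_mono // /subst_monom -mono_prod.
Qed.

(* Each monomial occurring in f is a product of at least e series, and changing one factor in degrees > d
   changes the product only in degrees > d + e - 1. *)
Lemma pcomp_eqd k n d e (f : mps R k) (g h : 'I_k -> mps R n) :
  ordge e f -> (forall i, ordge 1 (g i)) -> (forall i, ordge 1 (h i)) ->
  (forall i, eqd d (g i) (h i)) ->
  eqd (d + e).-1 (pcomp R k n f g) (pcomp R k n f h).
Proof.
move=> hf hg hh hgh.
suff H a : (e <= mdeg a)%N -> ordge (d + e) (subst_monom g a - subst_monom h a).
  move=> m hm; rewrite !pcompE; apply: eq_bigr => a _.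
  have [le|lt] := leqP e (mdeg (low a)); last by rewrite hf ?mul0r.
  have [e0|pos] := posnP (d + e)%N; last first.
    congr (_ * _); apply/eqP; rewrite -subr_eq0 -subE H //.
    by move: hm; move: (mdeg m) => *; lia.
  have em : m = mzero.
    by apply/eqP; rewrite -mdeg_eq0 -leqn0 (leq_trans hm) // e0.
  congr (_ * _); move: (low a) le => b _; rewrite em -!pcomp_mono // !pcomp_mzero //.
move=> le; have le' : (d + e <= d + mdeg a)%N by rewrite leq_add2l.
apply: ordge_le le' _; rewrite /subst_monom /mdeg.
suff [] : [/\ ordge (\sum_(i < k) a i) (\prod_(i < k) g i ^+ a i),
  ordge (\sum_(i < k) a i) (\prod_(i < k) h i ^+ a i) &
  ordge (d + \sum_(i < k) a i) (\prod_(i < k) g i ^+ a i - \prod_(i < k) h i ^+ a i)] by [].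
elim/big_rec3: _ => [|i p q s _ [h1 h2 h3]].
  by split=> //; rewrite subrr.
have hX j : [/\ ordge j (g i ^+ j), ordge j (h i ^+ j) & ordge (d + j) (g i ^+ j - h i ^+ j)].
  elim: j => [|j [k1 k2 k3]]; first by split=> //; rewrite !expr0 subrr.
  split; try exact: ordgeX.
  have -> : g i ^+ j.+1 - h i ^+ j.+1 = (g i - h i) * g i ^+ j + h i * (g i ^+ j - h i ^+ j).
    by rewrite !exprS; ring.
  apply: ordgeD.
    rewrite addnS -addSn; apply: ordgeM => //.
    exact: (proj1 (eqd_ordge _ _ _) (hgh i)).
  by rewrite addnS -add1n; apply: ordgeM.
have [k1 k2 k3] := hX (a i).
split; try exact: ordgeM.
set A := g i ^+ _; set B := h i ^+ _.
have -> : A * q - B * p = (A - B) * q + B * (q - p) by ring.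
apply: ordgeD; first by rewrite addnA; apply: ordgeM.
by rewrite addnCA; apply: ordgeM.
Qed.

End Comp2.

(** * Leading terms *)

Section MonomialOrder.
Variable n : nat.
Implicit Types a b c m : mon n.

(* Low degree first; within one degree the lexicographically largest exponent first: a monomial order of type omega. *)
Definition mlt a b :=
  (mdeg a < mdeg b)%N ||
  ((mdeg a == mdeg b) &&
   [exists i : 'I_n, (b i < a i)%N && [forall j : 'I_n, (j < i)%N ==> (a j == b j)]]).

Lemma mltP a b : reflect
  ((mdeg a < mdeg b)%N \/
   (mdeg a = mdeg b /\ exists i : 'I_n, (b i < a i)%N /\ forall j : 'I_n, (j < i)%N -> a j = b j))
  (mlt a b).
Proof.
apply: (iffP orP) => [[|/andP[/eqP e /existsP[i /andP[h /forallP hj]]]]|[|[e [i [h hj]]]]].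
- by left.
- right; split=> //; exists i; split=> // j hlt; apply/eqP.
  by have := hj j; rewrite hlt.
- by left.
- right; rewrite e eqxx /=; apply/existsP; exists i; rewrite h /=.
  by apply/forallP => j; apply/implyP => /hj ->.
Qed.

Lemma mlt_irr a : ~~ mlt a a.
Proof.
by apply/mltP => -[|[_ [i [h _]]]]; [rewrite ltnn | move: h; rewrite ltnn].
Qed.

Lemma mlt_trans a b c : mlt a b -> mlt b c -> mlt a c.
Proof.
move=> /mltP[h1|[e1 [i [h1 k1]]]] /mltP[h2|[e2 [j [h2 k2]]]]; apply/mltP.
- by left; apply: ltn_trans h2.
- by left; rewrite -e2.
- by left; rewrite e1.
right; split; first by rewrite e1.
case: (ltngtP i j) => [lt|lt|e].
- exists i; split; first by rewrite -k2.
  by move=> l hl; rewrite k1 // k2 // (ltn_trans hl).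
- exists j; split; first by rewrite k1.
  by move=> l hl; rewrite k1 ?k2 // (ltn_trans hl).
- have e' : i = j by apply: val_inj.
  subst j; exists i; split; first by apply: ltn_trans h1.
  by move=> l hl; rewrite k1 ?k2.
Qed.

Lemma mlt_total a b : [|| a == b, mlt a b | mlt b a].
Proof.
case: (ltngtP (mdeg a) (mdeg b)) => h.
- by rewrite /mlt h orbT.
- by rewrite /mlt [X in _ || (_ || X)]orbC h !orbT.
have [->|ne] := eqVneq a b; rewrite //=.
have [i hi] : exists i, a i != b i.
  apply/existsP; rewrite -negb_forall; apply: contra ne => /forallP e.
  by apply/eqP/ffunP => i; apply/eqP.
case: (@arg_minnP _ i (fun i => a i != b i) val hi) => j hj hmin.
have hlt (l : 'I_n) : (l < j)%N -> a l = b l.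
  by move=> hl; apply/eqP; apply: contraTT hl => /hmin; rewrite -leqNgt.
apply/orP; case: (ltngtP (a j) (b j)) hj => // hj _.
  by right; apply/mltP; right; split=> //; exists j; split=> // l /hlt.
by left; apply/mltP; right; split=> //; exists j.
Qed.

Lemma mlt_neq a b : mlt a b -> a != b.
Proof. by move=> h; apply: contraTneq h => ->; apply: mlt_irr. Qed.

Lemma mlt_asym a b : mlt a b -> ~~ mlt b a.
Proof.
by move=> h; apply/negP => /(mlt_trans h); apply/negP; apply: mlt_irr.
Qed.

Lemma mlt_add2l c a b : mlt (madd c a) (madd c b) = mlt a b.
Proof.
rewrite /mlt !mdegD ltn_add2l eqn_add2l; congr (_ || (_ && _)).
apply: eq_existsb => i; rewrite !ffunE ltn_add2l; congr (_ && _).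
by apply: eq_forallb => j; rewrite !ffunE eqn_add2l.
Qed.

Lemma mlt_deg a b : mlt a b -> (mdeg a <= mdeg b)%N.
Proof. by case/mltP => [/ltnW|[->]]. Qed.

Definition below m : seq (mon n) :=
  [seq low u | u in [pred u : {ffun 'I_n -> 'I_(mdeg m).+1} | mlt (low u) m]].

Lemma below_uniq m : uniq (below m).
Proof. by rewrite map_inj_uniq ?enum_uniq //; apply: low_inj. Qed.

Lemma mem_below m a : (a \in below m) = mlt a m.
Proof.
apply/mapP/idP => [[b]|h]; first by rewrite mem_enum => hb ->.
have e : low (box (mdeg m) a) = a.
  by apply: lowK => i; apply: leq_trans (leq_mdeg a i) (mlt_deg h).
by exists (box (mdeg m) a); rewrite ?mem_enum ?inE e.
Qed.

(** Only finitely many monomials precede a given one, as they have no larger degree. Counting them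
    turns the order into one on natural numbers, along which induction and the later elimination
    run. *)
Definition rank m := size (below m).

Lemma rank_lt a b : mlt a b -> (rank a < rank b)%N.
Proof.
move=> h; suff : (size (a :: below a) <= size (below b))%N by [].
apply: uniq_leq_size; first by rewrite /= below_uniq mem_below mlt_irr.
move=> c; rewrite inE mem_below => /orP[/eqP ->|hc]; first by rewrite mem_below.
by rewrite mem_below (mlt_trans hc).
Qed.

Lemma rank_ltE a b : (rank a < rank b)%N = mlt a b.
Proof.
apply/idP/idP => [h|]; last exact: rank_lt.
case/or3P: (mlt_total a b) => [/eqP e|//|/rank_lt h']; first by rewrite e ltnn in h.
by move: (ltn_trans h h'); rewrite ltnn.
Qed.

Lemma rank_inj : injective rank.
Proof.
move=> a b e; case/or3P: (mlt_total a b) => [/eqP //|/rank_lt|/rank_lt]; by rewrite e ltnn.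
Qed.

Lemma mlt_ind (P : mon n -> Prop) :
  (forall m, (forall a, mlt a m -> P a) -> P m) -> forall m, P m.
Proof.
move=> h m; move: {2}(rank m).+1 (ltnSn (rank m)) => N.
elim: N m => // N IH m hm; apply: h => a /rank_lt ha; apply: IH.
exact: leq_trans ha _.
Qed.

Lemma mlt_unit (i j : 'I_n) : (i < j)%N -> mlt (munit i) (munit j).
Proof.
move=> h; apply/mltP; right; rewrite !mdeg_unit; split=> //; exists i.
rewrite !ffunE eqxx (ltn_eqF h); split=> // l hl.
by rewrite !ffunE (ltn_eqF hl) (ltn_eqF (ltn_trans hl h)).
Qed.

Lemma mlt_unitP (i : 'I_n) a :
  mlt a (munit i) -> a = mzero \/ exists2 j : 'I_n, a = munit j & (j < i)%N.
Proof.
move=> h; have := mlt_deg h; rewrite mdeg_unit leq_eqVlt ltnS leqn0 mdeg_eq0.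
case/orP => /eqP e; last by left.
right; have [j ej] := mdeg1P e; exists j => //; move: h; rewrite ej.
case: (ltngtP i j) => // [/mlt_unit /mlt_asym /negP //|/val_inj ->].
by rewrite (negbTE (mlt_irr _)).
Qed.

Lemma mlt0 a : ~~ mlt a mzero.
Proof.
apply/negP => h; have := mlt_deg h; rewrite mdeg0 leqn0 mdeg_eq0 => /eqP e.
by move: h; rewrite e (negbTE (mlt_irr _)).
Qed.

End MonomialOrder.

Section Ideals.
Variable R : comNzRingType.

(** Ideals are predicates, so that the zero ideal and principal ideals share the same lemmas on
    leading coefficients and no quotient ring has to be formed. *)
Definition ideal (I : R -> Prop) := [/\ I 0, forall x y, I x -> I y -> I (x + y) & forall x y, I y -> I (x * y)].
Definition regular (x : R) := forall y, x * y = 0 -> y = 0.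
Definition divides (p x : R) := exists q, x = p * q.
(** A non-zero-divisor modulo [p]: the form of coprimality used throughout. *)
Definition reg_mod (p y : R) := forall x, divides p (y * x) -> divides p x.

Lemma ideal0 : ideal (fun x => x = 0).
Proof. by split=> // [x y -> ->|x y ->]; rewrite ?addr0 ?mulr0. Qed.

Lemma ideal_div p : ideal (divides p).
Proof.
split; first by exists 0; rewrite mulr0.
- by move=> x y [a ->] [b ->]; exists (a + b); rewrite mulrDr.
- by move=> x y [a ->]; exists (x * a); rewrite mulrCA.
Qed.

Lemma ideal_sum I J (r : seq J) (P : pred J) (F : J -> R) : ideal I ->
  (forall i, P i -> I (F i)) -> I (\sum_(i <- r | P i) F i).
Proof. by case=> h0 hD hM h; elim/big_ind: _. Qed.

Lemma ideal_opp I x : ideal I -> I x -> I (- x).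
Proof. by case=> h0 hD hM h; rewrite -mulN1r; apply: hM. Qed.

Lemma divides_mull p x y : divides p x -> divides p (x * y).
Proof. by move=> [q ->]; exists (q * y); rewrite mulrA. Qed.
Lemma divides_mulr p x y : divides p y -> divides p (x * y).
Proof. by rewrite mulrC; apply: divides_mull. Qed.
Lemma dividesD p x y : divides p x -> divides p y -> divides p (x + y).
Proof. by case: (ideal_div p) => _ h _; apply: h. Qed.
Lemma dividesB p x y : divides p x -> divides p y -> divides p (x - y).
Proof. by move=> h1 h2; apply: dividesD => //; apply: ideal_opp (ideal_div p) _. Qed.
Lemma divides_refl p : divides p p. Proof. by exists 1; rewrite mulr1. Qed.

Lemma regularI x y z : regular x -> x * y = x * z -> y = z.
Proof. by move=> h /eqP; rewrite -subr_eq0 -mulrBr => /eqP /h /eqP; rewrite subr_eq0 => /eqP. Qed.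
Lemma regularM x y : regular x -> regular y -> regular (x * y).
Proof. by move=> h1 h2 z; rewrite -mulrA => /h1 /h2. Qed.
Lemma regular1 : regular 1. Proof. by move=> y; rewrite mul1r. Qed.
Lemma regular_prod J (r : seq J) (P : pred J) (F : J -> R) :
  (forall i, P i -> regular (F i)) -> regular (\prod_(i <- r | P i) F i).
Proof. by move=> h; elim/big_ind: _ => //; [exact: regular1 | exact: regularM]. Qed.
Lemma regularN1 : regular (-1).
Proof. by move=> y; rewrite mulN1r => /eqP; rewrite oppr_eq0 => /eqP. Qed.
Lemma regularN x : regular x -> regular (- x).
Proof. by move=> h; rewrite -mulN1r; apply: regularM => //; apply: regularN1. Qed.

Lemma reg_modM p x y : reg_mod p x -> reg_mod p y -> reg_mod p (x * y).
Proof. by move=> h1 h2 z; rewrite -mulrA => /h1 /h2. Qed.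
Lemma reg_mod_prod p J (r : seq J) (P : pred J) (F : J -> R) :
  (forall i, P i -> reg_mod p (F i)) -> reg_mod p (\prod_(i <- r | P i) F i).
Proof. by move=> h; elim/big_ind: _ => //; [move=> x; rewrite mul1r | exact: reg_modM]. Qed.

Lemma reg_mod_mul p q x : regular p -> reg_mod p x -> reg_mod q x -> reg_mod (p * q) x.
Proof.
move=> rp hp hq y [k e]; have [|y1 e1] := hp y; first by exists (q * k); rewrite e mulrA.
have [|y2 e2] := hq y1.
  by exists k; apply: (regularI rp); rewrite mulrCA -e1 e mulrA.
by exists y2; rewrite e1 e2 mulrA.
Qed.

(** One factor is added at a time: the cofactor of the product of the others is divisible by [q i],
    because each of the others is regular modulo [q i]. *)
Lemma divides_prod (J : eqType) (r : seq J) (q : J -> R) x : uniq r ->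
  (forall i, i \in r -> divides (q i) x) ->
  (forall i j, i \in r -> j \in r -> i != j -> reg_mod (q i) (q j)) ->
  divides (\prod_(i <- r) q i) x.
Proof.
elim: r => [|i r IH] /=; first by exists x; rewrite big_nil mul1r.
move=> /andP[ni ur] hd hc; rewrite big_cons.
have [y e] : divides (\prod_(i <- r) q i) x.
  apply: IH => // [j hj|j k hj hk]; first by apply: hd; rewrite inE hj orbT.
  by apply: hc; rewrite inE ?hj ?hk orbT.
have [z ez] : divides (q i) y; last by exists z; rewrite e ez; ring.
have : divides (q i) ((\prod_(i <- r) q i) * y) by rewrite -e; apply: hd; rewrite inE eqxx.
rewrite big_seq; apply: reg_mod_prod => j hj; apply: hc; rewrite ?inE ?eqxx ?hj ?orbT //.
by apply: contraNneq ni => ->.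
Qed.

End Ideals.

Section Leading.
Variables (R : comNzRingType) (n : nat).
Local Notation S := (mps R n).
Implicit Types (f g p h y : S) (m x : mon n).

(** The coefficient [c] may be 0, in which case [f] merely starts later than [m]. This lets leading
    terms be summed without case distinctions. *)
Definition lead f m (c : R) := f m = c /\ forall x, mlt x m -> f x = 0.

(** In any other factorization of the monomial [madd m m'] one factor precedes [m] or [m'], as the
    order is compatible with addition. With [I] zero this computes leading terms, with [I] principal
    it tests divisibility. *)
Lemma mul_at (I : R -> Prop) f g m m' : ideal I ->
  (forall x, mlt x m -> I (f x)) -> (forall x, mlt x m' -> I (g x)) ->
  I ((f * g) (madd m m') - f m * g m').
Proof.
move=> hI hf hg; rewrite mulE (bigD1 (box (mdeg (madd m m')) m)) /=; last first.
  by rewrite lowK ?mle_addr // => i; apply: leq_trans (leq_mdeg _ i); rewrite ffunE leq_addr.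
rewrite lowK; last by move=> i; apply: leq_trans (leq_mdeg _ i); rewrite ffunE leq_addr.
rewrite maddK addrAC subrr add0r; apply: ideal_sum => // a /andP[le ne].
case: (hI) => _ _ hM.
case/or3P: (mlt_total (low a) m) => [/eqP e|/hf h|h]; last 1 first.
- move: (low a) le h => b le h.
  by apply/hM/hg; rewrite -(mlt_add2l b) msubK // ![madd _ m']maddC mlt_add2l.
- case/eqP: ne; apply: low_inj; rewrite e lowK // => i.
  by apply: leq_trans (leq_mdeg _ i); rewrite ffunE leq_addr.
- by rewrite mulrC; apply: hM.
Qed.

Lemma mul_below (I : R -> Prop) f g m m' x : ideal I ->
  (forall x, mlt x m -> I (f x)) -> (forall x, mlt x m' -> I (g x)) ->
  mlt x (madd m m') -> I ((f * g) x).
Proof.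
move=> hI hf hg hx; rewrite mulE; apply: ideal_sum => // a le.
case: (hI) => _ _ hM; move: (low a) le => b le.
case/or3P: (mlt_total b m) => [e|/hf h|h].
- by apply/hM/hg; rewrite -(mlt_add2l b) msubK // (eqP e).
- by rewrite mulrC; apply: hM.
- apply/hM/hg; rewrite -(mlt_add2l b) msubK //; apply: mlt_trans hx _.
  by rewrite ![madd _ m']maddC mlt_add2l.
Qed.

Lemma lead_mul f g m m' c c' : lead f m c -> lead g m' c' -> lead (f * g) (madd m m') (c * c').
Proof.
move=> [<- hf] [<- hg]; split; last first.
  by move=> x; apply: (mul_below (ideal0 R) hf hg).
by apply/eqP; rewrite -subr_eq0; apply/eqP; apply: (mul_at (ideal0 R) hf hg).
Qed.

Lemma lead1 : lead 1 mzero 1.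
Proof. by split=> [|x]; [rewrite oneE eqxx | move/negP: (@mlt0 n x)]. Qed.

Lemma lead_prod J (r : seq J) (P : pred J) (F : J -> S) (m : J -> mon n) (c : J -> R) :
  (forall i, P i -> lead (F i) (m i) (c i)) ->
  lead (\prod_(i <- r | P i) F i) (\big[@madd n/mzero]_(i <- r | P i) m i) (\prod_(i <- r | P i) c i).
Proof.
move=> h; elim/big_rec3: _ => [|i x y z Pi hx]; first exact: lead1.
by apply: lead_mul => //; apply: h.
Qed.

(** A form of Gauss's lemma: by induction along the order, the coefficient of [p * h] at [madd m x]
    is [p m * h x] modulo [I]. *)
Lemma reg_coef_ideal (I : R -> Prop) p h m : ideal I ->
  (forall x, mlt x m -> I (p x)) -> (forall c, I (p m * c) -> I c) ->
  (forall x, I ((p * h) x)) -> forall x, I (h x).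
Proof.
move=> hI hp hr hph; elim/mlt_ind => x IH; apply: hr.
have := mul_at hI hp IH => hd; case: (hI) => _ hD _.
have := hD _ _ (hph (madd m x)) (ideal_opp hI hd).
by rewrite opprB addrC subrK.
Qed.

Lemma lead_regular p m c : lead p m c -> regular c -> regular p.
Proof.
move=> [e hp] hc y hy; rewrite -e in hc.
apply: psP => x; apply: (reg_coef_ideal (h := y) (ideal0 R) hp hc) => z.
by rewrite hy.
Qed.

(** By induction, the first possible coefficient of [f] reappears in the product multiplied by the
    regular [c']. *)
Lemma below_cancel f g m m' c' : lead g m' c' -> regular c' ->
  (forall x, mlt x (madd m m') -> (f * g) x = 0) -> forall x, mlt x m -> f x = 0.
Proof.
move=> lg rc lfg x; elim/mlt_ind: x => x IH hx; apply: rc; rewrite mulrC.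
have lx : lead f x (f x) by split=> // y hy; apply: IH => //; apply: mlt_trans hx.
have [<- _] := lead_mul lx lg; apply: lfg.
by rewrite ![madd _ m']maddC mlt_add2l.
Qed.

Lemma lead_cancel f g m m' c c' : lead g m' c' -> regular c' ->
  lead (f * g) (madd m m') (c * c') -> lead f m c.
Proof.
move=> lg rc [e lfg]; have hb := below_cancel lg rc lfg.
split=> //; have lm : lead f m (f m) by [].
have [e' _] := lead_mul lm lg; apply: (regularI rc).
by rewrite mulrC -e' e mulrC.
Qed.

Lemma dvd_ideal (k : R) f : (forall x, divides k (f x)) -> exists g, f = k *: g.
Proof.
move=> h; exists (fun x => proj1_sig (cid (h x))); apply: psP => x.
by rewrite scaleE; case: cid.
Qed.

Lemma lead_linear f (i : 'I_n) : f mzero = 0 ->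
  (forall j : 'I_n, (j < i)%N -> f (munit j) = 0) -> lead f (munit i) (f (munit i)).
Proof.
move=> h0 h; split=> // x /mlt_unitP[-> //|[j -> hj]]; exact: h.
Qed.

End Leading.

(** * Symmetric 2-cocycles *)

Section Cocycle.

(** The [c i] are the coefficients of x^i y^(n-i) in a form f of degree n. Modulo [I], f vanishes on
    the axes and is symmetric, and the last condition is the coefficient of x^i y^j z^k in f(x, y) +
    f(x + y, z) - f(y, z) - f(x, y + z). *)
Definition cocycle (A : zmodType) (I : A -> Prop) (n : nat) (c : nat -> A) :=
  [/\ I (c 0%N), I (c n), forall i, (i <= n)%N -> I (c i - c (n - i)%N) &
      forall i j k, (0 < i)%N -> (0 < j)%N -> (0 < k)%N -> (i + j + k = n)%N ->
        I (c (i + j)%N *+ 'C(i + j, i) - c i *+ 'C(j + k, j))].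

Section ModP.
Variable p : nat.
Hypothesis p_pr : prime p.
Local Notation Fp := 'F_p.
Local Notation sol := (cocycle (fun x : Fp => x = 0)).

Lemma Fp_nat_eq0 k : (k%:R == 0 :> Fp) = (p %| k)%N.
Proof. by rewrite -(dvdn_pcharf (pchar_Fp p_pr)). Qed.

(** For j + 1 < p the binomial C(n, j + 1) is divisible by p, so by Pascal's rule C(n - 1, j) and
    C(n - 1, j + 1) are opposite modulo p, starting from 1. *)
Lemma bin_pred_Ndvd n j : (0 < n)%N -> (p %| n)%N -> (j < p)%N -> ~~ (p %| 'C(n.-1, j))%N.
Proof.
case: n => // n _ hn.
elim: j => [|j IH] hj /=; first by rewrite bin0 dvdn1 neq_ltn prime_gt1 ?orbT.
have hd : (p %| 'C(n.+1, j.+1))%N.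
  have : (p %| j.+1 * 'C(n.+1, j.+1))%N by rewrite -mul_bin_diag dvdn_mulr.
  by rewrite Euclid_dvdM // gtnNdvd.
apply: contra (IH (ltnW hj)) => h; move: hd; rewrite binS dvdn_addr //.
Qed.

(** Vandermonde's convolution with p (a + 1) = p + p a: modulo p only the terms with index 0 and p
    survive. *)
Lemma Lucas_mul a b : 'C(p * a, p * b)%:R = 'C(a, b)%:R :> Fp.
Proof.
have p0 := prime_gt0 p_pr.
elim: a b => [|a IH] [|b]; rewrite ?muln0 ?bin0 //.
  by rewrite !bin_small // muln_gt0 p0.
rewrite binS natrD -!IH mulnS -binomial.Vandermonde natr_sum.
have hb : (p <= p * b.+1)%N by rewrite mulnS leq_addr.
rewrite (bigD1 ord0) //= bin0 mul1n subn0.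
have hp : (p < (p * b.+1).+1)%N by rewrite ltnS.
rewrite (bigD1 (Ordinal hp)) /=; last by rewrite -val_eqE /= -lt0n.
rewrite binn mul1n [X in (X - p)%N]mulnS addKn big1 ?addr0 // => i /andP[n0 np].
apply/eqP; rewrite Fp_nat_eq0.
have np' : (i : nat) != p by apply: contraNneq np => e; apply/eqP/val_inj.
have n0' : (i : nat) != 0%N by apply: contraNneq n0 => e; apply/eqP/val_inj.
have [lt|ge] := ltnP i p; last by rewrite bin_small ?mul0n ?dvdn0 // ltn_neqAle ge eq_sym np'.
by apply: dvdn_mulr; apply: prime_dvd_bin; rewrite // lt0n n0'.
Qed.

(** The cocycle relation for i = 1 determines [c j.+1] from [c 1] whenever j + 1 is invertible. *)
Lemma sol_step n c j : sol n c -> (0 < j)%N -> (j.+1 < n)%N ->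
  j.+1%:R * c j.+1 = 'C(n.-1, j)%:R * c 1%N.
Proof.
move=> [_ _ _ h] j0 jn.
have k0 : (0 < n - j.+1)%N by rewrite subn_gt0.
have e : (1 + j + (n - j.+1) = n)%N by lia.
have /eqP := h 1%N j _ isT j0 k0 e.
rewrite subr_eq0 add1n bin1 -[c j.+1 *+ _]mulr_natl -[c 1%N *+ _]mulr_natl => /eqP ->; congr (_%:R * _); congr 'C(_, _).
lia.
Qed.

Lemma sol_c1 n c i : sol n c -> c 1%N = 0 -> (0 < i < n)%N -> ~~ (p %| i)%N -> c i = 0.
Proof.
move=> s c1 /andP[i0 ilt] hp; case: i i0 ilt hp => // [[|i]] // _ ilt hp.
have := sol_step s (isT : 0 < i.+1)%N ilt.
rewrite c1 mulr0 => /eqP; rewrite mulf_eq0 Fp_nat_eq0 (negbTE hp) => /eqP //.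
Qed.

(** The solutions modulo p form a space of dimension at most 1, and the coordinate [s] detects them.
    If p does not divide n, or n = p, then s = 1: [sol_step] reaches the indices prime to p and
    symmetry the others. Otherwise [c 1] vanishes, only multiples of p can carry nonzero entries,
    and by Lucas these form a solution in degree n / p. *)
Lemma sol_uniq n : (1 < n)%N -> exists2 s, (0 < s < n)%N &
  forall c, sol n c -> c s = 0 -> forall i, (i <= n)%N -> c i = 0.
Proof.
have p0 := prime_gt0 p_pr; have p1 := prime_gt1 p_pr.
elim/ltn_ind: n => n IH n1.
have [/andP[pn /eqP nep]|hn] := boolP ((p %| n)%N && (n != p)); last first.
  exists 1%N => // c hs c1 i; case: (hs) => c0 cn csym _ hi.
  have [->|i0] := posnP i; first by [].
  move: hi; rewrite leq_eqVlt => /predU1P[-> //|hi].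
  have [pi|npi] := boolP (p %| i)%N; last by apply: (sol_c1 hs); rewrite ?i0.
  have /eqP := csym i (ltnW hi); rewrite subr_eq0 => /eqP ->.
  apply: (sol_c1 hs) => //; first by rewrite subn_gt0 hi /= ltn_subrL i0 (ltn_trans i0).
  apply: contra hn => pni; have -> : (p %| n)%N by rewrite -(subnK (ltnW hi)) dvdn_addr.
  rewrite /=; apply: contraTneq pi => <-.
  by rewrite gtnNdvd.
case/dvdnP: (pn) => n' en; rewrite mulnC in en.
have n'1 : (1 < n')%N by case: n' en => [|[|//]] en; [rewrite en muln0 in n1 | case: nep; rewrite en muln1].
have [|s /andP[s0 sn] hs] := IH n' _ n'1; first by rewrite en ltn_Pmull // ltnW.
exists (p * s)%N; first by rewrite muln_gt0 p0 s0 en ltn_pmul2l.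
move=> c hc cs; case: (hc) => c0 cn csym crel.
(* [sol_step] at j = p - 1: the factor p on the left is 0, the binomial on the right is
   invertible. *)
have c1 : c 1%N = 0.
  have hpn : (p.-1.+1 < n)%N by rewrite prednK // en -{1}[p]muln1 ltn_pmul2l.
  have := sol_step hc _ hpn; rewrite prednK // -subn1 subn_gt0 => /(_ p1) /esym /eqP.
  rewrite (pcharf0 (pchar_Fp p_pr)) mul0r mulf_eq0 Fp_nat_eq0.
  rewrite (negbTE (bin_pred_Ndvd _ _ _)) ?(ltnW n1) // ?subn1 ?prednK // => /eqP //.
move=> i hi.
have [/dvdnP[i' ei]|npi] := boolP (p %| i)%N; last first.
  apply: (sol_c1 hc) => //; rewrite lt0n; apply/andP; split.
    by apply: contraNneq npi => ->.
  by rewrite ltn_neqAle hi andbT; apply: contraNneq npi => ->.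
rewrite ei mulnC; apply: (hs (fun i => c (p * i)%N)) => //; last first.
  by move: hi; rewrite ei en mulnC leq_pmul2l.
split; rewrite ?muln0 -?en //.
  by move=> k hk; rewrite mulnBr -en; apply: csym; rewrite en leq_pmul2l.
move=> x y z x0 y0 z0 e.
have := crel (p * x)%N (p * y)%N (p * z)%N; rewrite !muln_gt0 p0 x0 y0 z0 -!mulnDr e.
move=> /(_ isT isT isT (esym en)) /eqP; rewrite subr_eq0 => /eqP e'.
apply/eqP; rewrite subr_eq0; move: e'.
by rewrite -![c _ *+ _]mulr_natl !Lucas_mul => ->.
Qed.

End ModP.

(** In Smith normal form, injectivity modulo every prime forces each diagonal entry to be a unit, so
    the diagonal matrix can be inverted on the left over the integers. *)
Lemma int_left_inverse q r (B : 'M[int]_(q, r)) :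
  (forall p, prime p -> forall u : 'cV['F_p]_r, map_mx intr B *m u = 0 -> u = 0) ->
  exists K : 'M[int]_(r, q), K *m B = 1%:M.
Proof.
move=> hB; have [L uL [Rm uR [d _ eB]]] := int_Smith_normal_form B.
set D : 'M[int]_(q, r) := \matrix_(i, j) _ in eB.
(* If column j of the diagonal matrix vanished modulo p, the inverse of [Rm] would carry the j-th
   unit vector to a nonzero element of the kernel of [B]. *)
have key (j : 'I_r) p : prime p -> ~ (forall i, (D i j)%:~R = 0 :> 'F_p).
  move=> pp hz; pose f : {rmorphism int -> 'F_p} := intr.
  have hu : map_mx f B *m (map_mx f (invmx Rm) *m delta_mx j (0 : 'I_1)) = 0.
    rewrite mulmxA -map_mxM eB mulmxK // map_mxM -mulmxA.
    have -> : map_mx f D *m delta_mx j (0 : 'I_1) = 0.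
      apply/matrixP => i k; rewrite !mxE (bigD1 j) //= big1 => [|l nl].
        have hz' : f (D i j) = 0 by exact: hz.
        by rewrite [map_mx f D i j]mxE hz' mul0r addr0.
      by rewrite !mxE (negbTE nl) mulr0.
    by rewrite mulmx0.
  have /(congr1 (fun u => map_mx f Rm *m u)) := hB p pp _ hu.
  rewrite mulmxA -map_mxM mulmxV // map_mx1 mul1mx mulmx0 => /matrixP /(_ j 0) /eqP.
  by rewrite !mxE !eqxx oner_eq0.
have hj (j : 'I_r) : (j < q)%N /\ d`_j * d`_j = 1.
  have jq : (j < q)%N.
    rewrite ltnNge; apply/negP => le; apply: (key j 2%N) => // i.
    by rewrite mxE ltn_eqF ?mulr0n ?rmorph0 // (leq_trans (ltn_ord i)).
  split=> //.
  pose dj := d`_j; rewrite -/dj.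
  have h p : prime p -> ~~ (p %| absz dj)%N.
    move=> pp; apply/negP => hp; apply: (key j p pp) => i; rewrite mxE -/dj.
    case: eqP => e; last by rewrite mulr0n.
    by rewrite mulr1n e -/dj; apply/eqP; rewrite -(dvdz_pcharf (pchar_Fp pp)).
  have : absz dj = 1%N.
    case: (ltngtP (absz dj) 1%N) => // hd; last by have := h _ (pdiv_prime hd); rewrite pdiv_dvd.
    by have := h 2%N isT; move: hd; rewrite ltnS leqn0 => /eqP ->.
  by move: (dj) => [[|[|k]]|[|k]].
exists (invmx Rm *m (\matrix_(j, i) (d`_j *+ (i == j :> nat))) *m invmx L).
rewrite eB !mulmxA mulmxKV // -[_ *m D]mulmxA.
have -> : \matrix_(j, i) (d`_j *+ (i == j :> nat)) *m D = 1%:M :> 'M[int]_r.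
  apply/matrixP => j l; rewrite !mxE.
  have [jq ej] := hj j.
  rewrite (bigD1 (Ordinal jq)) //= big1 ?addr0 => [|i ni].
    by rewrite !mxE /= eqxx mulr1n mulrnAr val_eqE ej.
  by rewrite !mxE; move: ni; rewrite -val_eqE /= => /negbTE ->; rewrite mul0r.
by rewrite mulmx1 mulVmx.
Qed.

Lemma Bezout_big (a : nat -> nat) k : exists m : nat -> int,
  \sum_(i < k) m i * (a i)%:Z = (\big[gcdn/0%N]_(i < k) a i)%:Z.
Proof.
elim: k => [|k [m IH]]; first by exists (fun=> 0); rewrite !big_ord0.
have [u [v e]] := Bezoutz (\big[gcdn/0%N]_(i < k) a i)%:Z (a k)%:Z.
exists (fun i => if i == k then v else u * m i).
rewrite big_ord_recr /= eqxx big_ord_recr /= -[RHS]e; congr (_ + _).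
rewrite -IH mulr_sumr; apply: eq_bigr => i _.
by rewrite ltn_eqF // mulrA.
Qed.

Lemma bin_trinomial i j k :
  'C(i + j + k, i + j) * 'C(i + j, i) = 'C(i + j + k, i) * 'C(j + k, j) :> nat.
Proof.
have f0 m : (0 < m`!)%N by rewrite fact_gt0.
apply/eqP; rewrite -(eqn_pmul2r (f0 i)) -(eqn_pmul2r (f0 j)) -(eqn_pmul2r (f0 k)); apply/eqP.
have e1 := bin_fact (leq_addr k (i + j)); rewrite addKn in e1.
have e2 := bin_fact (leq_addr j i); rewrite addKn in e2.
have e3 := bin_fact (leq_addr (j + k) i); rewrite addKn addnA in e3.
have e4 := bin_fact (leq_addr k j); rewrite addKn in e4.
transitivity ((i + j + k)`!).
  by rewrite -e1 -e2 !mulnA; lia.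
by rewrite -e3 -e4 !mulnA; lia.
Qed.

(** The binomials C(n, i) satisfy the relations, both products being multinomial coefficients; the
    common factor [d] is then cancelled. *)
Lemma cocycle_rat n d (c : nat -> nat) : (0 < d)%N ->
  c 0%N = 0%N -> c n = 0%N -> (forall i, (0 < i < n)%N -> d * c i = 'C(n, i))%N ->
  (forall i, (i <= n)%N -> c i = c (n - i)%N) /\
  forall i j k, (0 < i)%N -> (0 < j)%N -> (0 < k)%N -> (i + j + k = n)%N ->
    ('C(i + j, i) * c (i + j) = 'C(j + k, j) * c i)%N.
Proof.
move=> d0 c0 cn dc; split=> [i hi|i j k i0 j0 k0 e].
  have [->|i0] := posnP i; first by rewrite subn0 c0 cn.
  move: hi; rewrite leq_eqVlt => /predU1P[->|hi]; first by rewrite subnn c0 cn.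
  apply/eqP; rewrite -(eqn_pmul2l d0) !dc ?i0 // ?bin_sub ?(ltnW hi) //.
  by rewrite subn_gt0 hi /= ltn_subrL i0 (ltn_trans i0).
apply/eqP; rewrite -(eqn_pmul2l d0) mulnCA [X in _ == X]mulnCA !dc; try lia.
by have /eqP := bin_trinomial i j k; rewrite e mulnC [X in _ == X]mulnC.
Qed.

(* Lazard's comparison lemma for symmetric 2-cocycles, with coefficients in an arbitrary abelian group A/I.
   Its universal form says that an integer matrix has a left inverse, which can be checked modulo each prime. *)
Lemma cocycle_comparison n : (1 < n)%N -> exists (d : nat) (c : nat -> nat),
  [/\ (0 < d)%N, c 0%N = 0%N, c n = 0%N &
      forall i, (0 < i < n)%N -> (d * c i = 'C(n, i))%N] /\
  forall (A : zmodType) (I : A -> Prop),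
    I 0 -> (forall x y, I x -> I y -> I (x - y)) ->
    forall g : nat -> A, cocycle I n g ->
    exists e : A, forall i, (i <= n)%N -> I (g i - e *+ c i).
Proof.
move=> n1.
pose a i := if (0 < i < n)%N then 'C(n, i) else 0%N.
pose d := (\big[gcdn/0]_(i < n.+1) a i)%N.
have dvd_a i : (i <= n)%N -> (d %| a i)%N.
  by rewrite -ltnS => hi; apply: (biggcdn_inf (Ordinal hi)).
have d0 : (0 < d)%N.
  rewrite lt0n; apply/eqP => d0; have := dvd_a 1%N (ltnW n1).
  by rewrite d0 dvd0n /a n1 bin1; case: (n) n1.
pose c i := (a i %/ d)%N.
have c0 : c 0%N = 0%N by rewrite /c /a div0n.
have cn : c n = 0%N by rewrite /c /a ltnn andbF div0n.
have dc i : (0 < i < n)%N -> (d * c i = 'C(n, i))%N.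
  move=> h; rewrite mulnC divnK; first by rewrite /a h.
  by apply: dvd_a; case/andP: h => _ /ltnW.
exists d, c; split=> //.
have [csym crel] := cocycle_rat d0 c0 cn dc.
(* Bezout coefficients of the gcd [d]: they define a functional [m0] whose value on the standard
   cocycle [c] is 1. *)
have [m0 em0] := Bezout_big a n.+1.
have em : \sum_(i < n.+1) m0 i * (c i)%:Z = 1.
  apply: (@mulIf _ d%:Z); first by move: d0; case: (d).
  rewrite mul1r mulr_suml -[RHS]em0; apply: eq_bigr => i _.
  rewrite -mulrA; congr (_ * _).
  have hi : (i <= n)%N by rewrite -ltnS.
  rewrite -[in RHS](divnK (dvd_a i hi)) PoszM.
  by [].
(* One row for each cocycle equation, in four kinds, and a fifth kind for the functional [m0]. The
   last one removes the multiples of [c] from the kernel, so that [B] becomes injective modulo every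
   prime. *)
pose T : finType := ('I_5 * 'I_n.+1 * 'I_n.+1)%type.
pose row (t : T) (l : nat) : int := let: (q, i, j) := t in
  match val q with
  | 0%N => (l == 0%N)%:R
  | 1%N => (l == n)%:R
  | 2%N => (l == i)%:R - (l == n - i)%N%:R
  | 3%N => if [&& (0 < i), (0 < j) & (i + j < n)]%N
           then (l == i + j)%N%:R * ('C(i + j, i))%:Z - (l == i :> nat)%:R * ('C(n - i, j))%:Z else 0
  | _ => m0 l
  end.
pose B : 'M[int]_(#|T|, n.+1) := \matrix_(t, l) row (enum_val t) l.
have pick (A : zmodType) (g : nat -> A) (i : nat) : (i <= n)%N ->
    \sum_(l < n.+1) g l *~ ((l : nat) == i)%:R = g i.
  move=> hi; rewrite (bigD1 (Ordinal (hi : (i < n.+1)%N))) //= eqxx mulr1z.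
  by rewrite big1 ?addr0 // => l; rewrite -val_eqE /= => /negbTE ->; rewrite mulr0z.
have rowE (A : zmodType) (g : nat -> A) (I : A -> Prop) : I 0 -> cocycle I n g ->
    I (\sum_(l < n.+1) g l *~ m0 l) -> forall t, I (\sum_(l < n.+1) g l *~ row t l).
  move=> I0 [g0 gn gs gr] gm [[q i] j]; rewrite /row.
  have hin : (i <= n)%N by rewrite -ltnS.
  case: q => [[|[|[|[|[|//]]]]] ?] /=.
  - by rewrite (pick _ g 0%N).
  - by rewrite (pick _ g n).
  - under eq_bigr do rewrite mulrzBr.
    by rewrite sumrB !pick ?leq_subr //; apply: gs.
  - have [/and3P[i0 j0 ij]|_] := boolP [&& (0 < i), (0 < j) & (i + j < n)]%N; last first.
      by rewrite big1 // => l _; rewrite mulr0z.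
    under eq_bigr do rewrite mulrzBr !mulrzA.
    rewrite sumrB -!mulrz_suml !pick ?(ltnW ij) //.
    have e : (n - i = j + (n - (i + j)))%N by lia.
    by rewrite e; apply: gr => //; lia.
  - exact: gm.
have rowF p (pp : prime p) (u : nat -> 'F_p) :
  (forall t, \sum_(l < n.+1) u l *~ row t l = 0) -> forall i, (i <= n)%N -> u i = 0.
  move=> hu.
  have r q (hq : (q < 5)%N) (i j : nat) (hi : (i < n.+1)%N) (hj : (j < n.+1)%N) :=
    hu (Ordinal hq, Ordinal hi, Ordinal hj).
  have su : cocycle (fun x : 'F_p => x = 0) n u.
    split.
    - by have := r 0%N isT 0%N 0%N isT isT; rewrite /= pick.
    - by have := r 1%N isT 0%N 0%N isT isT; rewrite /= pick.
    - move=> i hi; have := r 2%N isT i 0%N hi isT; rewrite /=.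
      under eq_bigr do rewrite mulrzBr.
      by rewrite sumrB !pick ?leq_subr.
    - move=> i j k i0 j0 k0 e.
      have hi : (i < n.+1)%N by lia.
      have hj : (j < n.+1)%N by lia.
      have := r 3%N isT i j hi hj; rewrite /= i0 j0.
      have -> : (i + j < n)%N by lia.
      have -> : (n - i = j + k)%N by lia.
      rewrite /=; under eq_bigr do rewrite mulrzBr !mulrzA.
      by rewrite sumrB -!mulrz_suml !pick //; lia.
  have mu : \sum_(l < n.+1) u l *~ m0 l = 0 := r 4%N isT 0%N 0%N isT isT.
  have [s /andP[s0 sn] hs] := sol_uniq pp n1.
  have em1 : \sum_(l < n.+1) (c l)%:R * (m0 l)%:~R = 1 :> 'F_p.
    rewrite -[RHS]/(1%:~R) -em rmorph_sum; apply: eq_bigr => l _.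
    by rewrite rmorphM /= mulrC.
  (* A combination of the solutions [c] and [u] that vanishes at [s], hence everywhere by
     [sol_uniq]. Applying [m0], which is 1 on [c] and 0 on [u], gives [u s = 0]. *)
  pose v i := u s * (c i)%:R - (c s)%:R * u i.
  have v0 i : (i <= n)%N -> v i = 0.
    case: su => u0 un us ur; apply: hs; last by rewrite /v mulrC subrr.
    split; rewrite /v ?u0 ?un ?c0 ?cn ?mulr0 ?subrr //.
      move=> k hk; rewrite -csym //; have /eqP := us k hk; rewrite subr_eq0 => /eqP ->.
      by rewrite subrr.
    move=> x y z x0 y0 z0 e; have /eqP := ur x y z x0 y0 z0 e.
    rewrite subr_eq0 => /eqP eu; have ec := crel x y z x0 y0 z0 e.
    have e1 : (c (x + y)%N)%:R *+ 'C(x + y, x) = (c x)%:R *+ 'C(y + z, y) :> 'F_p.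
      by rewrite -!mulrnA mulnC ec mulnC.
    by rewrite !mulrnBl -!mulrnAr eu e1 subrr.
  have us0 : u s = 0.
    have : \sum_(l < n.+1) v l * (m0 l)%:~R = 0.
      by rewrite big1 // => l _; rewrite v0 ?mul0r // -ltnS.
    under eq_bigr do rewrite mulrBl -!mulrA.
    rewrite sumrB -!mulr_sumr em1 mulr1.
    have -> : \sum_(l < n.+1) u l * (m0 l)%:~R = 0.
      by rewrite -[RHS]mu; apply: eq_bigr => l _; rewrite mulrzr.
    by rewrite mulr0 subr0.
  exact: hs.
have [K eK] : exists K : 'M[int]_(n.+1, #|T|), K *m B = 1%:M.
  apply: int_left_inverse => p pp u hu.
  apply/matrixP => i k; rewrite [k]ord1 [RHS]mxE.
  rewrite -[i in LHS]inord_val; apply: (rowF p pp (fun l => u (inord l) 0)); last by rewrite -ltnS.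
  move=> t; have /matrixP /(_ (enum_rank t) 0) := hu; rewrite !mxE => e; rewrite -[RHS]e.
  apply: eq_bigr => l _.
  by rewrite !mxE enum_rankK inord_val mulrC mulrzr.
move=> A I I0 IB g gc.
have IN x : I x -> I (- x) by move=> hx; rewrite -sub0r; apply: IB.
have ID x y : I x -> I y -> I (x + y) by move=> hx hy; rewrite -[y]opprK; apply/IB/IN.
have IM x k : I x -> I (x *+ k) by move=> hx; elim: k => [|k IH]; rewrite ?mulr0n // mulrS; apply: ID.
have IZ x (k : int) : I x -> I (x *~ k).
  by move=> hx; case: k => k; rewrite /intmul; [apply: IM | apply/IN/IM].
(* With [e] the value of [m0] on [g], all rows of [B] send [h = g - e c] into [I]. The left inverse
   [K] writes each [h i] as an integer combination of these values. *)
pose e := \sum_(l < n.+1) g l *~ m0 l; exists e.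
pose h i := g i - e *+ c i.
have hc : cocycle I n h.
  case: gc => g0 gn gs gr; split; rewrite /h ?c0 ?cn ?mulr0n ?subr0 //.
    move=> i hi; rewrite -csym // opprB addrA addrNK; exact: gs.
  move=> i j k i0 j0 k0 ek; rewrite !mulrnBl -!mulrnA.
  rewrite ![(c _ * _)%N]mulnC (crel i j k) // opprB addrA addrNK; exact: gr.
have hm : \sum_(l < n.+1) h l *~ m0 l = 0.
  under eq_bigr do rewrite mulrzBl.
  rewrite sumrB -/e; apply/eqP; rewrite subr_eq0; apply/eqP.
  rewrite -[LHS]mulr1z -em mulrz_sumr; apply: eq_bigr => l _.
  by rewrite mulrC mulrzA.
have hrow := rowE A h I I0 hc _.
move=> i hi; rewrite -/(h i).
have -> : h i = \sum_(t < #|T|) (\sum_(l < n.+1) h l *~ row (enum_val t) l) *~ K (inord i) t.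
  under eq_bigr do rewrite mulrz_suml.
  rewrite exchange_big /= -[LHS](pick A h i hi); apply: eq_bigr => l _.
  under eq_bigr do rewrite -mulrzA.
  rewrite -mulrz_sumr; congr (_ *~ _).
  have /matrixP /(_ (inord i) l) := eK; rewrite !mxE.
  rewrite -val_eqE /= inordK // eq_sym => <-; apply: eq_bigr => t _.
  by rewrite !mxE mulrC.
elim/big_ind: _ => // t _; apply: IZ; apply: hrow.
by rewrite hm.
Qed.

End Cocycle.

(** * Setting one variable to zero *)

Section ZeroAt.
Variables (R : comNzRingType) (n : nat).
Local Notation S := (mps R n).
Local Notation X := (xv R n).
Implicit Types (f g : S) (a b : 'I_n).

Lemma lead_xv a : lead (X a) (munit a) 1.
Proof.
split; first by rewrite xv_mono /mono eqxx.
by move=> x /mlt_neq; rewrite xv_mono /mono => /negbTE ->.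
Qed.

Lemma regular_xv a : regular (X a).
Proof. exact: lead_regular (lead_xv a) (@regular1 R). Qed.

Definition zero_at a f : S := fun m => if (0 < m a)%N then 0 else f m.

Lemma cont_zero_at a : cont_lin (zero_at a).
Proof.
split=> [f g|c f|N f g h].
- by apply: psP => m; rewrite /zero_at !addpE; case: ifP; rewrite ?addr0.
- by apply: psP => m; rewrite /zero_at !scaleE; case: ifP; rewrite ?mulr0.
- by move=> m hm; rewrite /zero_at h.
Qed.

Definition sub0 a : 'I_n -> S := fun i => if i == a then 0 else X i.

Lemma ordge_sub0 a i : ordge 1 (sub0 a i).
Proof. by rewrite /sub0; case: eqP => _; [exact: ordge_zero | exact: ordge_xv]. Qed.

(** Defined on coefficients, [zero_at] is the substitution x_a = 0 and so inherits the properties of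
    a ring morphism. *)
Lemma zero_atE a f : zero_at a f = pcomp R n n f (sub0 a).
Proof.
move: f; apply: lin_ext; [exact: cont_zero_at | exact: cont_pcomp (ordge_sub0 a) |].
move=> m; rewrite (pcomp_mono (ordge_sub0 a)) /subst_monom; apply: psP => x.
rewrite /zero_at /sub0 (bigD1 a) //= eqxx.
have [m0|mpos] := posnP (m a).
  have -> : \prod_(i < n | i != a) (if i == a then 0 else X i) ^+ m i = mono m.
    rewrite mono_prod [RHS](bigD1 a) //= m0 expr0 mul1r.
    by apply: eq_bigr => i /negbTE ->.
  rewrite m0 expr0 mul1r; case: ifP => // xa.
  by rewrite /mono; case: eqP => // e; rewrite e m0 in xa.
rewrite expr0n gtn_eqF // mul0r zeroE; case: ifP => // xa.
by rewrite /mono; case: eqP => // e; rewrite e mpos in xa.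
Qed.

Lemma zero_atD a f g : zero_at a (f + g) = zero_at a f + zero_at a g.
Proof. by rewrite !zero_atE (pcompD (ordge_sub0 a)). Qed.
Lemma zero_atB a f g : zero_at a (f - g) = zero_at a f - zero_at a g.
Proof. by rewrite !zero_atE (pcompB (ordge_sub0 a)). Qed.
Lemma zero_atM a f g : zero_at a (f * g) = zero_at a f * zero_at a g.
Proof. by rewrite !zero_atE (pcompM (ordge_sub0 a)). Qed.
Lemma zero_at0 a : zero_at a 0 = 0.
Proof. by rewrite zero_atE (pcomp0 (ordge_sub0 a)). Qed.
Lemma zero_at1 a : zero_at a 1 = 1.
Proof. by rewrite zero_atE (pcomp1 (ordge_sub0 a)). Qed.
Lemma zero_at_prod a I (r : seq I) (P : pred I) (F : I -> S) :
  zero_at a (\prod_(i <- r | P i) F i) = \prod_(i <- r | P i) zero_at a (F i).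
Proof. exact: (big_morph (zero_at a) (zero_atM a) (zero_at1 a)). Qed.
Lemma zero_at_sum a I (r : seq I) (P : pred I) (F : I -> S) :
  zero_at a (\sum_(i <- r | P i) F i) = \sum_(i <- r | P i) zero_at a (F i).
Proof. exact: (big_morph (zero_at a) (zero_atD a) (zero_at0 a)). Qed.
Lemma zero_at_xv a b : zero_at a (X b) = if b == a then 0 else X b.
Proof. by rewrite zero_atE (pcomp_xv (ordge_sub0 a)). Qed.
Definition shift_at a f : S := fun m => f (madd (munit a) m).

Lemma shift_atE a f : f = zero_at a f + X a * shift_at a f.
Proof.
apply: psP => m; rewrite addpE xv_mono mono_mulE /zero_at /shift_at.
have -> : mle (munit a) m = (0 < m a)%N.
  apply/mleP/idP => [/(_ a)|h i]; first by rewrite ffunE eqxx.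
  by rewrite ffunE val_eqE; case: eqP => [->|].
case: ifP => h; last by rewrite addr0.
rewrite add0r msubK //; apply/mleP => i.
by rewrite ffunE val_eqE; case: eqP => [->|].
Qed.

Lemma zero_at_div a f : zero_at a f = 0 -> f = X a * shift_at a f.
Proof. by move=> h; rewrite {1}[f](shift_atE a) h add0r. Qed.

End ZeroAt.

Section FglAdd.
Variables (R : comNzRingType) (F : mps R 2).
Local Notation "g ⊕ h" := (fgl_add R _ F g h) (at level 50, left associativity).
Definition pairf n (g h : mps R n) : 'I_2 -> mps R n := fun i => if val i == 0%N then g else h.

Lemma ordge_pairf n (g h : mps R n) i : ordge 1 g -> ordge 1 h -> ordge 1 (pairf g h i).
Proof. by rewrite /pairf; case: ifP. Qed.

Lemma fgl_addE n (g h : mps R n) : g ⊕ h = pcomp R 2 n F (pairf g h).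
Proof. by []. Qed.

Lemma pcomp_fgl_add k n (g h : mps R k) (s : 'I_k -> mps R n) :
  ordge 1 g -> ordge 1 h -> (forall i, ordge 1 (s i)) ->
  pcomp R k n (g ⊕ h) s = pcomp R k n g s ⊕ pcomp R k n h s.
Proof.
move=> hg hh hs; rewrite !fgl_addE pcompA // => [|i]; last exact: ordge_pairf.
by apply: eq_pcomp => i; rewrite /pairf; case: ifP.
Qed.

Lemma fgl_add_xv : xv R 2 0 ⊕ xv R 2 1 = F.
Proof.
rewrite -[RHS]pcomp_id; apply: eq_pcomp => i.
by case: i => [[|[|]]].
Qed.

Variable K : mps R 2.
Hypothesis FK : F = xv R 2 0 + xv R 2 1 + xv R 2 0 * xv R 2 1 * K.

Definition fgl_tail n (g h : mps R n) := pcomp R 2 n K (pairf g h).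

Lemma fgl_addK n (g h : mps R n) : ordge 1 g -> ordge 1 h -> g ⊕ h = g + h + g * h * fgl_tail g h.
Proof.
move=> hg hh; have hp i := ordge_pairf i hg hh.
rewrite fgl_addE {1}FK !(pcompD hp) !(pcompM hp).
by rewrite (pcomp_xv hp ord0) (pcomp_xv hp ord_max).
Qed.

Lemma ordge_fgl_add n (g h : mps R n) : ordge 1 g -> ordge 1 h -> ordge 1 (g ⊕ h).
Proof.
move=> hg hh; rewrite fgl_addK //; apply: ordgeD; first exact: ordgeD.
by do 2!apply: ordgeMl.
Qed.

Lemma fgl_addg0 n (g : mps R n) : ordge 1 g -> g ⊕ 0 = g.
Proof. by move=> hg; rewrite fgl_addK ?mulr0 ?mul0r ?addr0 //; apply: ordge_zero. Qed.
Lemma fgl_add0g n (g : mps R n) : ordge 1 g -> 0 ⊕ g = g.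
Proof. by move=> hg; rewrite fgl_addK ?mul0r ?addr0 ?add0r //; apply: ordge_zero. Qed.

Lemma fgl_add_lin n (g h : mps R n) i : ordge 1 g -> ordge 1 h ->
  (g ⊕ h) (munit (i : 'I_n)) = g (munit i) + h (munit i).
Proof.
move=> hg hh; rewrite fgl_addK // !addpE.
suff -> : (g * h * fgl_tail g h) (munit i) = 0 by rewrite addr0.
by apply: (ordgeMl (d := 2)); [apply: (ordgeM (d := 1) (e := 1)) | rewrite mdeg_unit].
Qed.

End FglAdd.

Lemma xv0_subst (R : comNzRingType) n (g : mps R n) : ordge 1 g -> pcomp R 1 n (xv R 1 0) (fun=> g) = g.
Proof. by move=> hg; rewrite (pcomp_xv (g := fun=> g) _ ord0). Qed.

(** From F(X, 0) = X the difference F - X is divisible by Y; the quotient is 1 at X = 0 because F(0,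
    Y) = Y, so subtracting 1 leaves a multiple of X. *)
Lemma fgl_form (R : comNzRingType) (F : mps R 2) : is_fgl R F ->
  exists K, F = xv R 2 0 + xv R 2 1 + xv R 2 0 * xv R 2 1 * K.
Proof.
case=> h1 h2 _ _.
have e1 : fgl_add R 1 F (xv R 1 0) 0 = xv R 1 0 by apply: psP.
have e2 : fgl_add R 1 F 0 (xv R 1 0) = xv R 1 0 by apply: psP.
have o1 : ordge 1 (xv R 1 0) := @ordge_xv R 1 ord0.
pose a0 : 'I_2 := ord0; pose a1 : 'I_2 := ord_max.
have o2 (i : 'I_2) : ordge 1 (xv R 2 i) by apply: ordge_xv.
have z1 : zero_at a1 F = xv R 2 0.
  have hs (i : 'I_1) : ordge 1 ((fun=> xv R 2 0) i) by exact: (o2 a0).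
  have := congr1 (fun f => pcomp R 1 2 f (fun=> xv R 2 0)) e1.
  rewrite (pcomp_fgl_add F o1 _ hs) ?(pcomp0 hs) ?xv0_subst //; try exact: ordge_zero; try exact: (o2 a0).
  move=> e; rewrite -[RHS]e zero_atE; apply: eq_pcomp => i.
  by case: i => [[|[|]]].
have z0 : zero_at a0 F = xv R 2 1.
  have hs (i : 'I_1) : ordge 1 ((fun=> xv R 2 1) i) by exact: (o2 a1).
  have := congr1 (fun f => pcomp R 1 2 f (fun=> xv R 2 1)) e2.
  rewrite (pcomp_fgl_add F _ o1 hs) ?(pcomp0 hs) ?xv0_subst //; try exact: ordge_zero; try exact: (o2 a1).
  move=> e; rewrite -[RHS]e zero_atE; apply: eq_pcomp => i.
  by case: i => [[|[|]]].
have eF := shift_atE a1 F; rewrite z1 in eF; set G := shift_at a1 F in eF.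
have zG : zero_at a0 G = 1.
  apply: (regularI (@regular_xv R 2 a1)); rewrite mulr1 -[RHS]z0 {1}eF.
  by rewrite zero_atD zero_atM !(@zero_at_xv R 2 a0 a0) (@zero_at_xv R 2 a0 a1) /= add0r.
exists (shift_at a0 G); rewrite {1}eF {1}(shift_atE a0 G) zG /=.
by rewrite mulrDr mulr1 addrA mulrCA -mulrA.
Qed.

(** * Buds and logarithms *)

Section TwoThree.
Variable R : comNzRingType.

Definition mk2 (i j : nat) : mon 2 := [ffun k : 'I_2 => if val k == 0%N then i else j].
Definition mk3 (i j k : nat) : mon 3 :=
  [ffun l : 'I_3 => if val l == 0%N then i else if val l == 1%N then j else k].

Lemma mk2E (m : mon 2) : m = mk2 (m ord0) (m ord_max).
Proof.
apply/ffunP => k; rewrite ffunE; case: k => [[|[|]]] //= h; congr (m _); exact: val_inj.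
Qed.

Lemma mdeg_mk2 i j : mdeg (mk2 i j) = (i + j)%N.
Proof. by rewrite /mdeg !big_ord_recl big_ord0 !ffunE /= addn0. Qed.

Lemma mdeg_mk3 i j k : mdeg (mk3 i j k) = (i + j + k)%N.
Proof. by rewrite /mdeg !big_ord_recl big_ord0 !ffunE /= addn0 addnA. Qed.

Lemma mk2_eq i j i' j' : (mk2 i j == mk2 i' j') = (i == i') && (j == j').
Proof.
apply/eqP/andP => [/ffunP h|[/eqP -> /eqP ->]] //.
by have := h ord0; have := h ord_max; rewrite !ffunE /= => -> ->.
Qed.

Lemma mk3_eq i j k i' j' k' : (mk3 i j k == mk3 i' j' k') = [&& i == i', j == j' & k == k'].
Proof.
apply/eqP/and3P => [/ffunP h|[/eqP -> /eqP -> /eqP ->]] //.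
have := h ord0; have := h (lift ord0 ord0); have := h ord_max.
by rewrite !ffunE /= => -> -> ->.
Qed.

Local Notation X := (xv R 2 0).
Local Notation Y := (xv R 2 1).
Local Notation x := (xv R 3 0).
Local Notation y := (xv R 3 1).
Local Notation z := (xv R 3 2).

Lemma ordX : ordge 1 X. Proof. exact: (@ordge_xv R 2 ord0). Qed.
Lemma ordY : ordge 1 Y. Proof. exact: (@ordge_xv R 2 ord_max). Qed.
Lemma ordx : ordge 1 x. Proof. exact: (@ordge_xv R 3 ord0). Qed.
Lemma ordy : ordge 1 y. Proof. exact: (@ordge_xv R 3 (lift ord0 ord0)). Qed.
Lemma ordz : ordge 1 z. Proof. exact: (@ordge_xv R 3 ord_max). Qed.

Lemma mono_mk2 i j : mono (mk2 i j) = X ^+ i * Y ^+ j :> mps R 2.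
Proof. by rewrite mono_prod !big_ord_recl big_ord0 !ffunE /= mulr1. Qed.

Lemma mono_mk3 i j k : mono (mk3 i j k) = x ^+ i * y ^+ j * z ^+ k :> mps R 3.
Proof. by rewrite mono_prod !big_ord_recl big_ord0 !ffunE /= mulr1 mulrA. Qed.

Lemma coef_xyz a b c i j k :
  (x ^+ a * y ^+ b * z ^+ c) (mk3 i j k) = ([&& i == a, j == b & k == c])%:R.
Proof. by rewrite -mono_mk3 /mono mk3_eq. Qed.

Lemma bin_symm i j l : (i + j = l)%N -> 'C(l, j) = 'C(l, i).
Proof. by move=> <-; rewrite -bin_sub ?leq_addl // addnK. Qed.

Lemma coef_addl l m i j k :
  ((x + y) ^+ l * z ^+ m) (mk3 i j k) =
  if (i + j == l)%N && (k == m) then 'C(l, i)%:R else 0.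
Proof.
rewrite exprDn mulr_suml sumE.
under eq_bigr => s _ do rewrite mulrnAl natmulE coef_xyz.
case: ifP => [/andP[/eqP e /eqP ->]|h].
  have hj : (j < l.+1)%N by lia.
  rewrite (bigD1 (Ordinal hj)) //= !eqxx andbT.
  have -> : (l - j = i)%N by lia.
  rewrite eqxx big1 ?addr0 => [|s ns].
    by rewrite (bin_symm e).
  have -> : (j == s) = false by apply: contraNF ns => /eqP e'; apply/eqP/val_inj.
  by rewrite andbF mul0rn.
rewrite big1 // => s _; have hs := ltn_ord s.
case: and3P => [[/eqP e1 /eqP e2 /eqP e3]|]; last by rewrite mul0rn.
by move: h; rewrite e3 eqxx andbT; lia.
Qed.

Lemma coef_addr l m i j k :
  (x ^+ l * (y + z) ^+ m) (mk3 i j k) =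
  if (i == l) && (j + k == m)%N then 'C(m, j)%:R else 0.
Proof.
rewrite exprDn mulr_sumr sumE.
under eq_bigr => s _ do rewrite mulrnAr natmulE mulrA coef_xyz.
case: ifP => [/andP[/eqP -> /eqP e]|h].
  have hk : (k < m.+1)%N by lia.
  rewrite (bigD1 (Ordinal hk)) //= !eqxx /=.
  have -> : (m - k = j)%N by lia.
  rewrite eqxx big1 ?addr0 => [|s ns].
    by rewrite (bin_symm e).
  have -> : (k == s) = false by apply: contraNF ns => /eqP e'; apply/eqP/val_inj.
  by rewrite !andbF mul0rn.
rewrite big1 // => s _; have hs := ltn_ord s.
case: and3P => [[/eqP e1 /eqP e2 /eqP e3]|]; last by rewrite mul0rn.
by move: h; rewrite e1 eqxx /=; lia.
Qed.

Definition binform n (b : nat -> R) : mps R 2 := \sum_(i < n.+1) b i *: mono (mk2 i (n - i)).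

Lemma binformE n b m : binform n b m = if (mdeg m == n) then b (m ord0) else 0.
Proof.
rewrite /binform sumE [m]mk2E mdeg_mk2 !ffunE /=; set i := m _; set j := m _.
under eq_bigr do rewrite scaleE /mono mk2_eq.
case: eqP => [e|ne].
  have hi : (i < n.+1)%N by lia.
  rewrite (bigD1 (Ordinal hi)) //= eqxx.
  have -> : (j == n - i)%N by lia.
  rewrite mulr1 big1 ?addr0 // => s ns.
  have -> : (i == s) = false by apply: contraNF ns => /eqP e'; apply/eqP/val_inj.
  by rewrite mulr0.
rewrite big1 // => s _; have hs := ltn_ord s.
by case: andP => [[/eqP e1 /eqP e2]|]; [lia | rewrite mulr0].
Qed.

Lemma ordge_binform n b : ordge n (binform n b).
Proof. by move=> m hm; rewrite binformE ltn_eqF. Qed.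

Lemma eqd_binform n (f : mps R 2) : ordge n f -> eqd n f (binform n (fun i => f (mk2 i (n - i)))).
Proof.
move=> h m; rewrite leq_eqVlt binformE => /predU1P[e|lt]; last by rewrite h // ltn_eqF.
rewrite e eqxx [in LHS](mk2E m); congr (f (mk2 _ _)).
by move: e; rewrite {1}(mk2E m) mdeg_mk2; lia.
Qed.

Lemma eq_binform n b b' : (forall i, (i <= n)%N -> b i = b' i) -> binform n b = binform n b'.
Proof. by move=> h; apply: eq_bigr => i _; rewrite h // -ltnS. Qed.

Lemma binformD n b b' : binform n (fun i => b i + b' i) = binform n b + binform n b'.
Proof. by rewrite /binform -big_split; apply: eq_bigr => i _; rewrite scalerDl. Qed.

Lemma binformZ n e b : binform n (fun i => e * b i) = e *: binform n b.
Proof. by rewrite /binform scaler_sumr; apply: eq_bigr => i _; rewrite scalerA. Qed.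

Lemma XY_div (f : mps R 2) : (forall i, f (mk2 0 i) = 0) -> (forall i, f (mk2 i 0) = 0) ->
  exists K, f = X * Y * K.
Proof.
move=> h0 h1; pose a0 : 'I_2 := ord0; pose a1 : 'I_2 := ord_max.
have z0 : zero_at a0 f = 0.
  apply: psP => m; rewrite /zero_at; case: posnP => // e.
  by rewrite [m]mk2E e h0.
have z1 : zero_at a1 f = 0.
  apply: psP => m; rewrite /zero_at; case: posnP => // e.
  by rewrite [m]mk2E e h1.
have e0 := zero_at_div z0; set G := shift_at a0 f in e0.
have zG : zero_at a1 G = 0.
  apply: (@regular_xv R 2 a0); rewrite -[RHS]z1 {1}e0 zero_atM.
  by rewrite (@zero_at_xv R 2 a1 a0).
by exists (shift_at a1 G); rewrite {1}e0 {1}(zero_at_div zG) mulrA.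
Qed.

Lemma pcomp_swap (f : mps R 2) m :
  pcomp R 2 2 f (pairf Y X) m = f (mk2 (m ord_max) (m ord0)).
Proof.
have hp i : ordge 1 (pairf Y X i) by apply: ordge_pairf; [exact: ordY | exact: ordX].
pose Psi (g : mps R 2) : mps R 2 := fun m => g (mk2 (m ord_max) (m ord0)).
rewrite -[RHS]/(Psi f m); congr (_ m); move: f; apply: lin_ext; first exact: cont_pcomp.
  split=> // N f g h u hu; apply: h.
  by rewrite mdeg_mk2 addnC -mdeg_mk2 -mk2E.
move=> a; rewrite pcomp_mono // /subst_monom !big_ord_recl big_ord0 /= mulr1.
have -> : lift ord0 ord0 = ord_max :> 'I_2 by apply: val_inj.
rewrite mulrC -mono_mk2; apply: psP => u; rewrite /Psi /mono.
by rewrite [in LHS](mk2E u) [in RHS](mk2E a) !mk2_eq andbC.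
Qed.

(** The coboundary for the additive group law: it linearizes the associativity defect. *)
Definition cobound (H : mps R 2) : mps R 3 :=
  pcomp R 2 3 H (pairf x y) + pcomp R 2 3 H (pairf (x + y) z)
  - pcomp R 2 3 H (pairf y z) - pcomp R 2 3 H (pairf x (y + z)).

Lemma ord_pairs i : [/\ ordge 1 (pairf x y i), ordge 1 (pairf (x + y) z i),
  ordge 1 (pairf y z i) & ordge 1 (pairf x (y + z) i)].
Proof.
have := (ordx, ordy, ordz) => -[[hx hy] hz].
by split; apply: ordge_pairf => //; apply: ordgeD.
Qed.

Lemma eqd_cobound n H H' : eqd n H H' -> eqd n (cobound H) (cobound H').
Proof.
move=> h; apply: eqdB; [apply: eqdB; [apply: eqdD |] |];
  by apply: pcomp_eqdl => // i; case: (ord_pairs i).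
Qed.

Lemma coboundZ e H : cobound (e *: H) = e *: cobound H.
Proof.
have [h1 h2 h3 h4] : [/\ forall i, ordge 1 (pairf x y i), forall i, ordge 1 (pairf (x + y) z i),
  forall i, ordge 1 (pairf y z i) & forall i, ordge 1 (pairf x (y + z) i)].
  by split=> i; case: (ord_pairs i).
by rewrite /cobound !pcompZ // !scalerBr scalerDr.
Qed.

Lemma pcomp_mk2 n (g h : mps R n) i j : ordge 1 g -> ordge 1 h ->
  pcomp R 2 n (mono (mk2 i j)) (pairf g h) = g ^+ i * h ^+ j.
Proof.
move=> hg hh; rewrite pcomp_mono => [|k]; last exact: ordge_pairf.
by rewrite /subst_monom !big_ord_recl big_ord0 /= !ffunE mulr1.
Qed.

(** With i, j, k positive only the two middle expressions H(x + y, z) and H(x, y + z) contribute, by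
    the binomial formula. This produces exactly the relation in [cocycle]. *)
Lemma coef_cobound n H i j k : ordge n H -> (0 < i)%N -> (0 < j)%N -> (0 < k)%N -> (i + j + k = n)%N ->
  cobound H (mk3 i j k) = H (mk2 (i + j) (n - (i + j))) *+ 'C(i + j, i)
                    - H (mk2 i (n - i)) *+ 'C(j + k, j).
Proof.
move=> hH i0 j0 k0 e; have := (ordx, ordy, ordz) => -[[hx hy] hz].
have hxy := ordgeD hx hy; have hyz := ordgeD hy hz.
have hm : (mdeg (mk3 i j k) <= n)%N by rewrite mdeg_mk3 e.
rewrite (eqd_cobound (eqd_binform hH) hm) /cobound.
have E (g h : mps R 3) : ordge 1 g -> ordge 1 h ->
  pcomp R 2 3 (binform n (fun i => H (mk2 i (n - i)))) (pairf g h) (mk3 i j k)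
  = \sum_(l < n.+1) H (mk2 l (n - l)) * (g ^+ l * h ^+ (n - l)) (mk3 i j k).
  move=> hg hh; have hp s := ordge_pairf s hg hh.
  rewrite /binform pcomp_sum // sumE; apply: eq_bigr => l _.
  by rewrite pcompZ // pcomp_mk2.
rewrite !subE addpE !E //.
have kn : (k == 0)%N = false by rewrite gtn_eqF.
have in0 : (i == 0)%N = false by rewrite gtn_eqF.
rewrite [X in X + _ - _ - _]big1 => [|l _]; last first.
  by rewrite -[x ^+ l * _]mulr1 -(expr0 z) coef_xyz kn !andbF mulr0.
rewrite add0r [X in _ - X - _]big1 => [|l _]; last first.
  by rewrite -[y ^+ l * _]mul1r -(expr0 x) mulrA coef_xyz in0 mulr0.
rewrite subr0; congr (_ - _).
  have hi : (i + j < n.+1)%N by lia.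
  rewrite (bigD1 (Ordinal hi)) //= coef_addl eqxx.
  have -> : (k == n - (i + j))%N by lia.
  rewrite mulr_natr big1 ?addr0 // => s ns; rewrite coef_addl.
  have -> : (i + j == s)%N = false by apply: contraNF ns => /eqP e'; apply/eqP/val_inj.
  by rewrite mulr0.
have hi : (i < n.+1)%N by lia.
rewrite (bigD1 (Ordinal hi)) //= coef_addr eqxx.
have -> : (j + k == n - i)%N by lia.
have -> : (n - i = j + k)%N by lia.
rewrite mulr_natr big1 ?addr0 // => s ns; rewrite coef_addr.
have -> : (i == s)%N = false by apply: contraNF ns => /eqP e'; apply/eqP/val_inj.
by rewrite mulr0.
Qed.

Lemma binform_binom n (c : nat -> nat) d : (0 < n)%N ->
  c 0%N = 0%N -> c n = 0%N -> (forall i, (0 < i < n)%N -> (d * c i)%N = 'C(n, i)) ->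
  d%:R *: binform n (fun i => (c i)%:R) = (X + Y) ^+ n - X ^+ n - Y ^+ n.
Proof.
move=> n0 c0 cn dc; rewrite -binformZ.
have -> : (X + Y) ^+ n = binform n (fun i => 'C(n, i)%:R).
  rewrite addrC exprDn; apply: eq_bigr => i _.
  by rewrite mono_mk2 scaler_nat mulrC.
have pickh (k : nat) : (k <= n)%N -> X ^+ k * Y ^+ (n - k) = binform n (fun i => (i == k)%:R).
  move=> hk; rewrite -mono_mk2 /binform (bigD1 (Ordinal (hk : (k < n.+1)%N))) //= eqxx scale1r.
  by rewrite big1 ?addr0 // => i; rewrite -val_eqE /= => /negbTE ->; rewrite scale0r.
have -> : X ^+ n = binform n (fun i => (i == n)%:R) by rewrite -pickh // subnn mulr1.
have -> : Y ^+ n = binform n (fun i => (i == 0%N)%:R) by rewrite -pickh // subn0 mul1r.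
apply: psP => m; rewrite !subE !binformE; case: eqP => [e|_]; last by rewrite !subr0.
have hi : (m ord0 <= n)%N by rewrite -e leq_mdeg.
rewrite -natrM; have [->|i0] := posnP (m ord0).
  by rewrite c0 muln0 bin0 ltn_eqF // subr0 subrr.
move: hi; rewrite leq_eqVlt => /predU1P[->|hi].
  rewrite cn muln0 binn eqxx.
  by rewrite subrr subr0.
by rewrite dc ?i0 // ltn_eqF // !subr0.
Qed.

End TwoThree.

#[local] Hint Resolve ordX ordY ordx ordy ordz : core.

Section Buds.
Variable R : comNzRingType.
Local Notation X := (xv R 2 0).
Local Notation Y := (xv R 2 1).
Local Notation x := (xv R 3 0).
Local Notation y := (xv R 3 1).
Local Notation z := (xv R 3 2).
Local Notation t := (xv R 1 0).
Local Notation hx := (ordx R).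
Local Notation hy := (ordy R).
Local Notation hz := (ordz R).
Implicit Types F G B : mps R 2.

(** During the lifting the unit axiom and commutativity are kept exactly, while associativity holds
    only up to a degree; hence the axioms are treated separately. *)
Definition unital_form F := exists K, F = X + Y + X * Y * K.
Definition comm_coef F := forall i j, F (mk2 i j) = F (mk2 j i).
Definition assoc_lhs F := fgl_add R 3 F (fgl_add R 3 F x y) z.
Definition assoc_rhs F := fgl_add R 3 F x (fgl_add R 3 F y z).

Lemma ordge_form F : unital_form F -> ordge 1 F.
Proof.
case=> K ->; apply: ordgeD; first by apply: ordgeD.
by do 2!apply: ordgeMl; exact: ordX.
Qed.

Lemma form_tail F : unital_form F -> exists2 k : mps R 2, ordge 2 k &
  forall n (g h : mps R n), ordge 1 g -> ordge 1 h ->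
    fgl_add R n F g h = g + h + pcomp R 2 n k (pairf g h).
Proof.
case=> K e; exists (X * Y * K).
  by apply: ordgeMl; apply: (ordgeM (d := 1) (e := 1)).
move=> n g h hg hh; have hp i := ordge_pairf i hg hh.
rewrite fgl_addE {1}e !(pcompD hp).
by rewrite (pcomp_xv hp ord0) (pcomp_xv hp ord_max).
Qed.

Lemma ordge_form_add F n (g h : mps R n) : unital_form F -> ordge 1 g -> ordge 1 h ->
  ordge 1 (fgl_add R n F g h).
Proof. by case=> K e; apply: ordge_fgl_add e n g h. Qed.

Lemma fgl_add_eqd F n d (g h g' h' : mps R n) : unital_form F ->
  ordge 1 g -> ordge 1 h -> ordge 1 g' -> ordge 1 h' ->
  eqd d g g' -> eqd d h h' -> eqd d (fgl_add R n F g h) (fgl_add R n F g' h').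
Proof.
move=> hF o1 o2 o3 o4 e1 e2; rewrite (_ : d = (d + 1).-1); last by rewrite addn1.
apply: pcomp_eqd; first exact: ordge_form.
- by move=> i; apply: ordge_pairf.
- by move=> i; apply: ordge_pairf.
by move=> i; case: ifP.
Qed.

Lemma fgl_add_eqd1 F n (g h : mps R n) : unital_form F -> ordge 1 g -> ordge 1 h ->
  eqd 1 (fgl_add R n F g h) (g + h).
Proof.
move=> /form_tail[k hk e] hg hh; rewrite e //; apply/eqd_ordge.
rewrite addrAC subrr add0r; apply: ordge_pcomp => // i; exact: ordge_pairf.
Qed.

Lemma assoc_lhs_eqd F G d : unital_form F -> unital_form G -> eqd d F G -> eqd d (assoc_lhs F) (assoc_lhs G).
Proof.
move=> hF hG e; have hf := ordge_form_add hF hx hy; have hg := ordge_form_add hG hx hy.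
apply: eqd_trans (_ : eqd d (fgl_add R 3 F (fgl_add R 3 G x y) z) _).
  apply: fgl_add_eqd => //.
  by apply: pcomp_eqdl => // i; apply: ordge_pairf.
by apply: pcomp_eqdl => // i; apply: ordge_pairf => //.
Qed.

Lemma assoc_rhs_eqd F G d : unital_form F -> unital_form G -> eqd d F G -> eqd d (assoc_rhs F) (assoc_rhs G).
Proof.
move=> hF hG e; have hf := ordge_form_add hF hy hz; have hg := ordge_form_add hG hy hz.
apply: eqd_trans (_ : eqd d (fgl_add R 3 F x (fgl_add R 3 G y z)) _).
  apply: fgl_add_eqd => //.
  by apply: pcomp_eqdl => // i; apply: ordge_pairf.
by apply: pcomp_eqdl => // i; apply: ordge_pairf => //.
Qed.

Lemma pcomp_eqd1 n (B : mps R 2) m (g h g' h' : mps R m) : ordge n B ->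
  ordge 1 g -> ordge 1 h -> ordge 1 g' -> ordge 1 h' -> eqd 1 g g' -> eqd 1 h h' ->
  eqd n (pcomp R 2 m B (pairf g h)) (pcomp R 2 m B (pairf g' h')).
Proof.
move=> hB o1 o2 o3 o4 e1 e2; rewrite -[n]/((1 + n).-1).
by apply: pcomp_eqd => // i; rewrite /pairf; case: ifP.
Qed.

(** In degree N + 1 the inner occurrence of [B] passes only through the linear part of [G], and the
    outer one sees its arguments only up to degree 1, where [G] is addition. *)
Lemma assoc_perturb G B N : (0 < N)%N -> unital_form G -> unital_form (G + B) -> ordge N.+1 B ->
  eqd N.+1 (assoc_lhs (G + B) - assoc_rhs (G + B)) (assoc_lhs G - assoc_rhs G + cobound B).
Proof.
move=> N0 hG hF hB; set F := G + B.
have addF n (g h : mps R n) : ordge 1 g -> ordge 1 h ->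
    fgl_add R n F g h = fgl_add R n G g h + pcomp R 2 n B (pairf g h).
  by move=> o1 o2; rewrite !fgl_addE pcompD // => i; apply: ordge_pairf.
have [k hk addG] := form_tail hG.
have oxy := ordge_form_add hG hx hy; have oyz := ordge_form_add hG hy hz.
have [o1 o2 o3 o4] : [/\ forall i, ordge 1 (pairf x y i), forall i, ordge 1 (pairf (x + y) z i),
  forall i, ordge 1 (pairf y z i) & forall i, ordge 1 (pairf x (y + z) i)].
  by split=> i; case: (ord_pairs R i).
have bxy : ordge N.+1 (pcomp R 2 3 B (pairf x y)) by apply: ordge_pcomp.
have byz : ordge N.+1 (pcomp R 2 3 B (pairf y z)) by apply: ordge_pcomp.
have ord1 (b : mps R 3) : ordge N.+1 b -> ordge 1 b by apply: ordge_le.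
(* The part of [G] beyond the linear one has order 2, so shifting an argument by a series of order N
   + 1 changes it in degrees above N + 1 only. *)
have key (u b v : mps R 3) : ordge 1 u -> ordge N.+1 b -> ordge 1 v ->
    eqd N.+1 (fgl_add R 3 G (u + b) v) (fgl_add R 3 G u v + b) /\
    eqd N.+1 (fgl_add R 3 G v (u + b)) (fgl_add R 3 G v u + b).
  move=> hu hb hv; have hub : ordge 1 (u + b) by apply: ordgeD => //; apply: ord1.
  have eub : eqd N (u + b) u by apply/eqd_ordge; rewrite addrAC subrr add0r.
  have hN : (N + 2).-1 = N.+1 by rewrite addn2.
  rewrite !addG // [_ + _ + b]addrAC [v + u + _ + b]addrAC.
  split; apply: eqdD; rewrite ?addrA ?[u + b + v]addrAC // -hN;
    by apply: pcomp_eqd => // i; rewrite /pairf; case: ifP.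
rewrite /assoc_lhs /assoc_rhs ![fgl_add R 3 F x y]addF ?[fgl_add R 3 F y z]addF //.
have hu := ordgeD oxy (ord1 _ bxy); have hv := ordgeD oyz (ord1 _ byz).
rewrite addF //.
rewrite addF //.
have e1 : eqd 1 (fgl_add R 3 G x y + pcomp R 2 3 B (pairf x y)) (x + y).
  rewrite -[x + y]addr0; apply: eqdD; first exact: fgl_add_eqd1.
  by apply/eqd_ordge; rewrite subr0; apply: ordge_le bxy.
have e2 : eqd 1 (fgl_add R 3 G y z + pcomp R 2 3 B (pairf y z)) (y + z).
  rewrite -[y + z]addr0; apply: eqdD; first exact: fgl_add_eqd1.
  by apply/eqd_ordge; rewrite subr0; apply: ordge_le byz.
have [k1 _] := key _ _ _ oxy bxy hz.
have [_ k2] := key _ _ _ oyz byz hx.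
apply: eqd_trans (_ : eqd _ ((assoc_lhs G + pcomp R 2 3 B (pairf x y) + pcomp R 2 3 B (pairf (x + y) z))
   - (assoc_rhs G + pcomp R 2 3 B (pairf y z) + pcomp R 2 3 B (pairf x (y + z)))) _).
  apply: eqdB; apply: eqdD => //; apply: pcomp_eqd1 => //.
  - exact: ordgeD.
  - exact: ordgeD.
rewrite -/(assoc_lhs G) -/(assoc_rhs G) /cobound; apply: eqd_refl'.
ring.
Qed.

Implicit Type l : mps R 1.

Definition at1 l n (g : mps R n) : mps R n := pcomp R 1 n l (fun=> g).
(** Measures how far [l] is from a homomorphism to the additive group. *)
Definition log_defect l F := at1 l F - at1 l X - at1 l Y.

Lemma at1_zero l n : ordge 1 l -> at1 l (0 : mps R n) = 0.
Proof.
move=> hl; apply: psP => m; rewrite /at1 pcompE big1 // => a _.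
have [e0|pos] := posnP (mdeg (low a)); first by rewrite hl ?mul0r // e0.
have h0 : forall i : 'I_1, (low a) i = mdeg (low a).
  by move=> i; rewrite /mdeg big_ord1 [i]ord1.
by rewrite /subst_monom big_ord1 h0; case: (mdeg (low a)) pos => // k _; rewrite exprS mul0r mulr0.
Qed.

Lemma pcomp_at1 l k n (g : mps R k) (s : 'I_k -> mps R n) : ordge 1 g -> (forall i, ordge 1 (s i)) ->
  pcomp R k n (at1 l g) s = at1 l (pcomp R k n g s).
Proof. by move=> hg hs; rewrite /at1 pcompA. Qed.

Lemma log_defectE l F n (g h : mps R n) : ordge 1 F -> ordge 1 g -> ordge 1 h ->
  at1 l (fgl_add R n F g h) = at1 l g + at1 l h + pcomp R 2 n (log_defect l F) (pairf g h).
Proof.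
move=> hF hg hh; have hp i := ordge_pairf i hg hh.
have -> : pcomp R 2 n (log_defect l F) (pairf g h) = at1 l (fgl_add R n F g h) - at1 l g - at1 l h.
  rewrite /log_defect !(pcompB hp) !pcomp_at1 //.
  by rewrite (pcomp_xv hp ord0) (pcomp_xv hp ord_max).
by ring.
Qed.

(** The nonlinear part of [l] has order 2 and gains one degree of precision over [g] and [h]. *)
Lemma at1_diff l n d (g h : mps R n) : ordge 1 l -> ordge 1 g -> ordge 1 h -> eqd d g h ->
  eqd d.+1 (at1 l g - at1 l h) (l (munit 0) *: (g - h)).
Proof.
move=> hl hg hh e; set c := l _.
have h2 : ordge 2 (l - c *: t).
  move=> m; rewrite ltnS leq_eqVlt ltnS leqn0 mdeg_eq0 => /orP[/eqP e1|/eqP ->].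
    have [i ->] := mdeg1P e1; rewrite [i]ord1 subE scaleE xv_mono /mono eqxx mulr1.
    exact: subrr.
  rewrite subE scaleE hl ?mdeg0 // xv_mono /mono.
  case: eqP => [e1|]; last by rewrite mulr0 subr0.
  by have := mdeg_unit (ord0 : 'I_1); rewrite -e1 mdeg0.
have E (u : mps R n) : ordge 1 u -> at1 l u = c *: u + at1 (l - c *: t) u.
  by move=> hu; rewrite /at1 pcompB // pcompZ // xv0_subst // addrC subrK.
rewrite !E // scalerBr opprD addrACA -[X in eqd _ _ X]addr0.
apply: eqdD => //.
have h3 : eqd d.+1 (at1 (l - c *: t) g) (at1 (l - c *: t) h).
  by rewrite -[d.+1]/(d.+2.-1) -addn2; apply: pcomp_eqd.
by move=> m hm; rewrite subE h3 // subrr.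
Qed.

(** Apply [l] to both bracketings: to first order the values differ by l'(0) times the associator.
    Expanding each bracketing by the defect, the values of [l] at x, y, z cancel and the coboundary
    of the defect remains. *)
Lemma log_assoc_defect l F N : unital_form F -> ordge 1 l ->
  eqd N (assoc_lhs F) (assoc_rhs F) -> ordge N.+1 (log_defect l F) ->
  eqd N.+1 (l (munit 0) *: (assoc_lhs F - assoc_rhs F)) (cobound (log_defect l F)).
Proof.
move=> hF hl hA hE; have oF := ordge_form hF.
have oxy := ordge_form_add hF hx hy; have oyz := ordge_form_add hF hy hz.
have oL : ordge 1 (assoc_lhs F) by apply: ordge_form_add => //.
have oR : ordge 1 (assoc_rhs F) by apply: ordge_form_add => //.
apply: eqd_trans (eqd_sym (at1_diff hl oL oR hA)) _.
rewrite /assoc_lhs /assoc_rhs !log_defectE //.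
set E := log_defect l F in hE *.
apply: eqd_trans (_ : eqd _ ((at1 l x + at1 l y + pcomp R 2 3 E (pairf x y) + at1 l z + pcomp R 2 3 E (pairf (x + y) z))
   - (at1 l x + (at1 l y + at1 l z + pcomp R 2 3 E (pairf y z)) + pcomp R 2 3 E (pairf x (y + z)))) _).
  apply: eqdB; apply: eqdD => //; apply: pcomp_eqd1 => //.
  - exact: ordgeD.
  - exact: fgl_add_eqd1.
  - exact: ordgeD.
  - exact: fgl_add_eqd1.
rewrite /cobound; apply: eqd_refl'; ring.
Qed.

Section Step.
Variables (n d : nat) (c : nat -> nat).
Hypothesis n1 : (1 < n)%N.
Hypothesis d0 : (0 < d)%N.
Hypothesis c0 : c 0%N = 0%N.
Hypothesis cn : c n = 0%N.
Hypothesis dc : forall i, (0 < i < n)%N -> (d * c i)%N = 'C(n, i).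
Hypothesis torsion_free : forall k (a : R), (0 < k)%N -> a *+ k = 0 -> a = 0.

Definition Cpol : mps R 2 := binform n (fun i => (c i)%:R).

Lemma Cpol_binom : d%:R *: Cpol = (X + Y) ^+ n - X ^+ n - Y ^+ n.
Proof. by apply: binform_binom => //; apply: ltnW. Qed.

Lemma c_sym i : (i <= n)%N -> c i = c (n - i)%N.
Proof. by case: (cocycle_rat d0 c0 cn dc) => h _; apply: h. Qed.

Lemma binform_form F (b : nat -> R) : b 0%N = 0 -> b n = 0 -> unital_form F -> unital_form (F - binform n b).
Proof.
move=> b0 bn [K e].
have [K' e'] : exists K', binform n b = X * Y * K'.
  by apply: XY_div => i; rewrite binformE mdeg_mk2 ?addn0 ?add0n !ffunE /= ?b0; case: eqP => [e'|] //; rewrite e'.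
by exists (K - K'); rewrite e e'; ring.
Qed.

Lemma binform_comm F (b : nat -> R) : (forall i, (i <= n)%N -> b i = b (n - i)%N) ->
  comm_coef F -> comm_coef (F - binform n b).
Proof.
move=> bs h i j; rewrite !subE h !binformE !mdeg_mk2 [(j + i)%N]addnC !ffunE /=.
case: eqP => [e|//]; congr (_ - _); rewrite (bs i); first by rewrite -e addKn.
by rewrite -e leq_addr.
Qed.

Lemma eqd_binform0 F b N : n = N.+1 -> eqd N (F - binform n b) F.
Proof.
move=> e; apply/eqd_ordge; rewrite addrAC subrr add0r -e.
by apply: ordgeN; apply: ordge_binform.
Qed.

(** [d] times this form is (X + Y)^n - X^n - Y^n, whose coboundary vanishes identically; [d] is
    cancelled since there is no torsion. *)
Lemma cobound_Cpol : cobound Cpol = 0.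
Proof.
have h : d%:R *: cobound Cpol = 0.
  rewrite -coboundZ Cpol_binom /cobound.
  have E (g h : mps R 3) : ordge 1 g -> ordge 1 h ->
    pcomp R 2 3 ((X + Y) ^+ n - X ^+ n - Y ^+ n) (pairf g h) = (g + h) ^+ n - g ^+ n - h ^+ n.
    move=> hg hh; have hp i := ordge_pairf i hg hh.
    rewrite !(pcompB hp) !(pcompX hp) (pcompD hp).
    by rewrite (pcomp_xv hp ord0) (pcomp_xv hp ord_max).
  rewrite !E //; try exact: ordgeD.
  rewrite [x + (y + z)]addrA.
  by move: ((x + y + z) ^+ n) ((x + y) ^+ n) ((y + z) ^+ n) (x ^+ n) (y ^+ n) (z ^+ n) => *; ring.
apply: psP => m; apply: (torsion_free d0).
by rewrite -mulr_natl -scaleE h.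
Qed.

(** In degree n, [M] times the associator is the coboundary of a multiple of [Cpol], which is 0. *)
Lemma assoc_step F l N M (e : R) : n = N.+1 -> unital_form F -> ordge 1 l ->
  (0 < M)%N -> l (munit 0) = M%:R -> eqd N (assoc_lhs F) (assoc_rhs F) ->
  eqd n (log_defect l F) (e *: Cpol) -> eqd n (assoc_lhs F) (assoc_rhs F).
Proof.
move=> en hF hl M0 lM hA hE.
have oE : ordge N.+1 (log_defect l F).
  move=> m; rewrite -en => hm; rewrite hE 1?ltnW // scaleE.
  by rewrite /Cpol ordge_binform // mulr0.
move=> m hm; apply/eqP; rewrite -subr_eq0 -subE; apply/eqP/(torsion_free M0).
have := log_assoc_defect hF hl hA oE; rewrite lM -en => /(_ m hm).
rewrite scaleE mulr_natl => ->.
by rewrite (eqd_cobound hE hm) coboundZ cobound_Cpol scaler0.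
Qed.

End Step.
End Buds.

(** * Lifting formal group laws *)

Section Lift.
Variables (T L : comNzRingType) (phi : {rmorphism T -> L}).
Hypothesis torsion_free : forall k (a : T), (0 < k)%N -> a *+ k = 0 -> a = 0.
Hypothesis phi_surj : forall b, exists a, phi a = b.
Variable FL : mps L 2.
Hypothesis FL_fgl : is_fgl L FL.

(* N-buds over T lifting FL. The integral multiple l = M x + ... of a logarithm that is carried along replaces
   the passage to T ⊗ Q. *)
Definition bud N (s : mps T 2 * mps T 1 * nat) :=
  let: (F, l, M) := s in
  [/\ unital_form F, comm_coef F, eqd N (assoc_lhs F) (assoc_rhs F), eqd N (mapps phi F) FL &
      [/\ (0 < M)%N, ordge 1 l, l (munit 0) = M%:R & ordge N.+1 (log_defect l F)]].

Lemma FL_form : unital_form FL. Proof. exact: fgl_form. Qed.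

Lemma FL_comm : comm_coef FL.
Proof.
case: FL_fgl => _ _ h _ i j; rewrite -h.
by rewrite [LHS](pcomp_swap FL) !ffunE.
Qed.

Lemma FL_assoc : assoc_lhs FL = assoc_rhs FL.
Proof. by case: FL_fgl => _ _ _ h; apply: psP. Qed.

Lemma form_coef (R : comNzRingType) (K : mps R 2) m :
  (xv R 2 0 + xv R 2 1 + xv R 2 0 * xv R 2 1 * K) m =
    (m == mk2 1 0)%:R + (m == mk2 0 1)%:R + if mle (mk2 1 1) m then K (msub m (mk2 1 1)) else 0.
Proof.
rewrite -mono_mulE mono_mk2 !expr1 !addpE; congr (_ + _ + _).
by rewrite -[xv R 2 1]expr1 -[_ ^+ 1]mul1r -(expr0 (xv R 2 0)) -mono_mk2.
Qed.

Lemma form_XY0 (R : comNzRingType) (F : mps R 2) i : unital_form F ->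
  F (mk2 0 i) = (i == 1%N)%:R /\ F (mk2 i 0) = (i == 1%N)%:R.
Proof.
case=> K ->; rewrite !form_coef !mk2_eq /= andbF !andbT eq_sym.
have -> : mle (mk2 1 1) (mk2 0 i) = false by apply/mleP => /(_ ord0); rewrite !ffunE.
have -> : mle (mk2 1 1) (mk2 i 0) = false by apply/mleP => /(_ ord_max); rewrite !ffunE.
by rewrite !addr0 add0r.
Qed.

Lemma pcomp_comm_coef (R : comNzRingType) (F : mps R 2) : comm_coef F ->
  pcomp R 2 2 F (pairf (xv R 2 1) (xv R 2 0)) = F.
Proof. by move=> h; apply: psP => m; rewrite pcomp_swap h -mk2E. Qed.

Lemma mapps_form F : unital_form F -> unital_form (mapps phi F).
Proof.
case=> K ->; exists (mapps phi K).
by rewrite !mappsD !mappsM !xv_mono !mapps_mono.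
Qed.

Lemma mapps_xv n k : mapps phi (xv T n k) = xv L n k.
Proof. exact: mapps_mono. Qed.

Lemma mapps_assoc_lhs F : mapps phi (assoc_lhs F) = assoc_lhs (mapps phi F).
Proof. by rewrite /assoc_lhs !mapps_fgl_add !mapps_xv. Qed.
Lemma mapps_assoc_rhs F : mapps phi (assoc_rhs F) = assoc_rhs (mapps phi F).
Proof. by rewrite /assoc_rhs !mapps_fgl_add !mapps_xv. Qed.

Lemma eqd_mapps n N (f g : mps T n) : eqd N f g -> eqd N (mapps phi f) (mapps phi g).
Proof. by move=> h m hm; rewrite /mapps h. Qed.

Lemma mapps_binform n b : mapps phi (binform n b) = binform n (fun i => phi (b i)).
Proof.
by apply: psP => m; rewrite /mapps !binformE; case: ifP; rewrite ?rmorph0.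
Qed.

Lemma log_sym (l : mps T 1) (F : mps T 2) : comm_coef F -> unital_form F -> comm_coef (log_defect l F).
Proof.
move=> hF hf i j.
have e : pcomp T 2 2 (log_defect l F) (pairf (xv T 2 1) (xv T 2 0)) = log_defect l F.
  have hp k := ordge_pairf k (ordY T) (ordX T).
  rewrite /log_defect !(pcompB hp) !(pcomp_at1 _ _ hp) //; last exact: ordge_form.
  rewrite pcomp_comm_coef // (pcomp_xv hp ord0) (pcomp_xv hp ord_max) /pairf /=.
  by rewrite addrAC.
by rewrite -[in RHS]e pcomp_swap !ffunE.
Qed.

Lemma log_bound (l : mps T 1) (F : mps T 2) i : unital_form F -> ordge 1 l -> log_defect l F (mk2 0 i) = 0.
Proof.
move=> hF hl.
have z : zero_at (ord0 : 'I_2) (log_defect l F) = 0.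
  have hp := @ordge_sub0 T 2 ord0; have oF := ordge_form hF.
  rewrite zero_atE /log_defect !(pcompB hp) !(pcomp_at1 _ _ hp) //.
  rewrite -!zero_atE (@zero_at_xv T 2 ord0 ord0) (@zero_at_xv T 2 ord0 ord_max) /= at1_zero // subr0.
  case: hF => K ->; rewrite !zero_atD !zero_atM (@zero_at_xv T 2 ord0 ord0) (@zero_at_xv T 2 ord0 ord_max) /=.
  by rewrite !mul0r addr0 add0r subrr.
have := congr1 (fun f : mps T 2 => f (mk2 0 i)) z.
by rewrite /zero_at ffunE.
Qed.

Lemma log_change (l : mps T 1) (F : mps T 2) n b : (0 < n)%N -> unital_form F -> unital_form (F - binform n b) -> ordge 1 l ->
  eqd n (log_defect l (F - binform n b)) (log_defect l F - l (munit 0) *: binform n b).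
Proof.
case: n => // n _ hF hF' hl; have oF := ordge_form hF; have oF' := ordge_form hF'.
have h := at1_diff hl oF' oF (eqd_binform0 F b (erefl n.+1)).
have -> : log_defect l (F - binform n.+1 b) =
  log_defect l F + (at1 l (F - binform n.+1 b) - at1 l F) by rewrite /log_defect; ring.
apply: eqdD => //; apply: eqd_trans h _; apply: eqd_refl'.
by rewrite addrAC subrr add0r scalerN.
Qed.

(** Three corrections in degree n = N + 1: one makes the law associative, one makes it lift [FL],
    and one extends the integral logarithm. *)
Lemma bud_step N s : (0 < N)%N -> bud N s -> exists2 s', bud N.+1 s' & eqd N s'.1.1 s.1.1.
Proof.
case: s => [[F l] M] N0 [hF hc hA hphi [M0 hl lM hE]]; set n := N.+1.
have n1 : (1 < n)%N by rewrite ltnS.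
have [d [c [[d0 c0 cn dc] cmp]]] := cocycle_comparison n1.
have csym := c_sym d0 c0 cn dc.
set E := log_defect l F in hE.
have Esym := log_sym l hc hF; rewrite -/E in Esym.
have E0 j : E (mk2 0 j) = 0 by rewrite /E log_bound.
pose g i := E (mk2 i (n - i)).
(* The coboundary of [E] in degree n is [M] times the associator, so [g] is a cocycle modulo [M].
   The comparison lemma will give g = e c + M b. *)
have IM : cocycle (divides (M%:R : T)) n g.
  have [i0 iD iM] := ideal_div (M%:R : T).
  split.
  - by rewrite /g E0.
  - by rewrite /g subnn Esym E0.
  - by move=> i hi; rewrite /g Esym subKn // subrr.
  - move=> i j k i0' j0 k0 e; rewrite /g -(coef_cobound hE) //.
    have hm : (mdeg (mk3 i j k) <= n)%N by rewrite mdeg_mk3 e.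
    rewrite -(log_assoc_defect hF hl hA hE hm) scaleE lM.
    by exists ((assoc_lhs F - assoc_rhs F) (mk3 i j k)).
have [e he] : exists e : T, forall i, (i <= n)%N -> divides (M%:R) (g i - e *+ c i).
  apply: (cmp T (divides (M%:R))) => //; first by case: (ideal_div (M%:R : T)).
  by move=> u v; apply: dividesB.
have [b hb] : exists b : nat -> T, forall i, (i <= n)%N -> g i - e *+ c i = M%:R * b i.
  exists (fun i => if pselect (i <= n)%N is left h then proj1_sig (cid (he i h)) else 0).
  by move=> i hi; case: pselect => // h; case: cid.
have cancM (u v : T) : M%:R * u = M%:R * v -> u = v.
  move=> /eqP; rewrite -subr_eq0 -mulrBr mulr_natl => /eqP /(torsion_free M0) /eqP.
  by rewrite subr_eq0 => /eqP.
have b0 : b 0%N = 0.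
  by apply: cancM; rewrite -hb // c0 mulr0n /g E0 subr0 mulr0.
have bn : b n = 0.
  by apply: cancM; rewrite -hb // cn mulr0n /g subnn Esym E0 subr0 mulr0.
have bsym i : (i <= n)%N -> b i = b (n - i)%N.
  move=> hi; apply: cancM; rewrite -!hb ?leq_subr // -csym //; congr (_ - _).
  by rewrite /g Esym subKn.
(* Subtracting the form [b] changes the defect by -M b and leaves e times [Cpol], so associativity
   extends to degree n. *)
pose F1 := F - binform n b.
have f1 : unital_form F1 by apply: binform_form.
have k1 : comm_coef F1 by apply: binform_comm.
have d1 : eqd N F1 F := eqd_binform0 F b (erefl n).
have E1 : eqd n (log_defect l F1) (e *: Cpol T n c).
  apply: eqd_trans (log_change _ hF f1 hl) _ => //; rewrite lM -/E.
  have oE : ordge n E by [].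
  apply: eqd_trans (_ : eqd n (binform n g - M%:R *: binform n b) _).
    by apply: eqdB; [exact: eqd_binform | exact: eqd_refl].
  apply: eqd_refl'; rewrite /Cpol -!binformZ; apply/eqP; rewrite subr_eq -binformD; apply/eqP.
  by apply: eq_binform => i hi; rewrite -hb // mulr_natr addrC subrK.
have A0 : eqd N (assoc_lhs F1) (assoc_rhs F1).
  apply: eqd_trans (assoc_lhs_eqd f1 hF d1) _; apply: eqd_trans hA _.
  by apply: eqd_sym; apply: assoc_rhs_eqd.
have A1 : eqd n (assoc_lhs F1) (assoc_rhs F1).
  exact: (assoc_step n1 d0 c0 cn dc torsion_free (erefl n) f1 hl M0 lM A0 E1).
(* Both laws are associative up to degree n and agree below it, so their difference is a cocycle
   over [L], that is, a multiple of [c] by some [eL]. *)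
pose B := mapps phi F1 - FL.
have fB : mapps phi F1 = FL + B by rewrite addrC subrK.
have oB : ordge n B.
  apply: (proj1 (eqd_ordge N (mapps phi F1) FL)); apply: (eqd_trans _ hphi).
  exact: eqd_mapps.
have f1' := mapps_form f1.
have dB : eqd n (cobound B) 0.
  have := assoc_perturb N0 FL_form _ oB; rewrite -fB => /(_ f1').
  rewrite FL_assoc subrr add0r => h; apply: eqd_trans (eqd_sym h) _.
  rewrite -mapps_assoc_lhs -mapps_assoc_rhs -mappsB => m hm.
  by rewrite /mapps subE A1 // subrr rmorph0.
pose bL i := B (mk2 i (n - i)).
have bLsym i j : B (mk2 i j) = B (mk2 j i).
  by rewrite /B !subE /mapps k1 FL_comm.
have bL0 j : B (mk2 0 j) = 0.
  rewrite /B subE (proj1 (form_XY0 _ f1')) (proj1 (form_XY0 _ FL_form)).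
  exact: subrr.
have [eL heL] : exists eL : L, forall i, (i <= n)%N -> bL i - eL *+ c i = 0.
  apply: (cmp L (fun x => x = 0)) => // [u v -> ->|]; first exact: subrr.
  split.
  - exact: bL0.
  - by rewrite /bL subnn bLsym bL0.
  - by move=> i hi; rewrite /bL bLsym subKn // subrr.
  - move=> i j k i0 j0 k0 ek; rewrite /bL -(coef_cobound oB) // dB //.
    by rewrite mdeg_mk3 ek.
(* A multiple of [c] over [T] that maps to the discrepancy. Subtracting it keeps the defect a
   multiple of [Cpol], hence also associativity. *)
have [e' he'] := phi_surj eL.
pose b' i := e' * (c i)%:R.
have b'0 : b' 0%N = 0 by rewrite /b' c0 mulr0.
have b'n : b' n = 0 by rewrite /b' cn mulr0.
have b'sym i : (i <= n)%N -> b' i = b' (n - i)%N by move=> hi; rewrite /b' -csym.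
pose F2 := F1 - binform n b'.
have f2 : unital_form F2 by apply: binform_form.
have k2 : comm_coef F2 by apply: binform_comm.
have d2 : eqd N F2 F1 := eqd_binform0 F1 b' (erefl n).
have E2 : eqd n (log_defect l F2) ((e - M%:R * e') *: Cpol T n c).
  apply: eqd_trans (log_change _ f1 f2 hl) _ => //.
  rewrite lM binformZ scalerBl -scalerA; exact: eqdB.
have A20 : eqd N (assoc_lhs F2) (assoc_rhs F2).
  apply: eqd_trans (assoc_lhs_eqd f2 f1 d2) _; apply: eqd_trans A0 _.
  by apply: eqd_sym; apply: assoc_rhs_eqd.
have A2 := assoc_step n1 d0 c0 cn dc torsion_free (erefl n) f2 hl M0 lM A20 E2.
set e2 := e - M%:R * e' in E2.
(* As d [Cpol] = (X + Y)^n - X^n - Y^n, the term in x^n cancels the defect once [l] is multiplied by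
   [d]; this is why [M] becomes [d * M]. *)
pose l' : mps T 1 := d%:R *: l - e2 *: xv T 1 0 ^+ n.
have ot : ordge 1 (xv T 1 0) := @ordge_xv T 1 ord0.
exists (F2, l', (d * M)%N); last by apply: eqd_trans d2 d1.
split=> //.
  have -> : mapps phi F2 = FL + (B - binform n (fun i => phi (b' i))).
    by rewrite /F2 mappsB mapps_binform -/F1 fB -addrA.
  rewrite -[X in eqd _ _ X]addr0; apply: eqdD => //.
  apply: eqd_trans (_ : eqd n (binform n bL - binform n (fun i => phi (b' i))) _).
    by apply: eqdB; [exact: eqd_binform | exact: eqd_refl].
  apply: eqd_refl'; apply/eqP; rewrite subr_eq0; apply/eqP.
  apply: eq_binform => i hi; apply/eqP; rewrite -subr_eq0 -(heL i hi).
  by rewrite rmorphM rmorph_nat he' mulr_natr.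
have otn : ordge n (xv T 1 0 ^+ n) by apply: ordgeX.
split; first by rewrite muln_gt0 d0 M0.
- by apply: ordgeB; apply: ordgeZ => //; apply: ordge_le otn.
- rewrite /l' subE !scaleE lM otn ?mulr0 ?subr0 ?natrM //.
  by rewrite -[0%N]/(val (ord0 : 'I_1)) mdeg_unit.
apply/eqd_ordge0.
have at1l' (u : mps T 2) : ordge 1 u -> at1 l' u = d%:R *: at1 l u - e2 *: u ^+ n.
  move=> hu; have hp (i : 'I_1) : ordge 1 ((fun=> u) i) by [].
  by rewrite /at1 (pcompB hp) !(pcompZ hp) (pcompX hp) (pcomp_xv hp ord0).
have oF2 := ordge_form f2.
have -> : log_defect l' F2 = d%:R *: log_defect l F2
   - e2 *: (F2 ^+ n - xv T 2 0 ^+ n - xv T 2 1 ^+ n).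
  rewrite /log_defect !at1l' //.
  by rewrite !scalerBr; ring.
have F2n : eqd n (F2 ^+ n) ((xv T 2 0 + xv T 2 1) ^+ n).
  have oXY := ordgeD (ordX T) (ordY T).
  have h1 : eqd 1 F2 (xv T 2 0 + xv T 2 1).
    by have := fgl_add_eqd1 f2 (ordX T) (ordY T); rewrite fgl_add_xv.
  have hat u : ordge 1 u -> u ^+ n = at1 (xv T 1 0 ^+ n) u :> mps T 2.
    move=> hu; have hp (i : 'I_1) : ordge 1 ((fun=> u) i) by [].
    by rewrite /at1 (pcompX hp) (pcomp_xv hp ord0).
  rewrite !hat // -[X in eqd X]/((1 + n).-1); exact: pcomp_eqd.
apply: eqd_trans (_ : eqd n (d%:R *: (e2 *: Cpol T n c)
   - e2 *: ((xv T 2 0 + xv T 2 1) ^+ n - xv T 2 0 ^+ n - xv T 2 1 ^+ n)) _).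
  apply: eqdB; first exact: eqdZ.
  by apply: eqdZ; apply: eqdB => //; apply: eqdB.
apply: eqd_refl'; rewrite -(Cpol_binom T n1 c0 cn dc) !scalerA mulrC; exact: subrr.
Qed.

End Lift.

Section Lazard.
Variables (T L : comNzRingType) (phi : {rmorphism T -> L}).
Hypothesis torsion_free : forall k (a : T), (0 < k)%N -> a *+ k = 0 -> a = 0.
Hypothesis phi_surj : forall b, exists a, phi a = b.
Variables (FL : mps L 2) (a : T).
Hypothesis FL_fgl : is_fgl L FL.
Hypothesis phi_a : phi a = FL (mk2 1 1).
Local Notation X := (xv T 2 0).
Local Notation Y := (xv T 2 1).

Definition pconst n (c : T) : mps T n := c *: (1 : mps T n).

Arguments pconst n c : clear implicits.

(** The multiplicative law is associative on the nose and has the prescribed coefficient [a].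
    Starting in degree 2 keeps that coefficient, since the later steps change higher degrees
    only. *)
Definition bud2_fgl : mps T 2 := X + Y + X * Y * pconst 2 a.
(** Twice the logarithm x - a x^2 / 2 + ... of the multiplicative law, truncated after degree 2. *)
Definition bud2_log : mps T 1 := pconst 1 2%:R * xv T 1 0 - pconst 1 a * xv T 1 0 ^+ 2.

Lemma pcomp_const k n c (s : 'I_k -> mps T n) : (forall i, ordge 1 (s i)) ->
  pcomp T k n (pconst k c) s = pconst n c.
Proof. by move=> hs; rewrite /pconst pcompZ // pcomp1. Qed.

Lemma bud2_fgl_addE n (g h : mps T n) : ordge 1 g -> ordge 1 h ->
  fgl_add T n bud2_fgl g h = g + h + g * h * pconst n a.
Proof.
move=> hg hh; rewrite (fgl_addK (erefl bud2_fgl)) // /fgl_tail pcomp_const // => i.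
exact: ordge_pairf.
Qed.

Lemma XYK11 (R : comNzRingType) (K : mps R 2) :
  (xv R 2 0 + xv R 2 1 + xv R 2 0 * xv R 2 1 * K) (mk2 1 1) = K mzero.
Proof.
rewrite form_coef !mk2_eq /= !add0r; case: mleP => [_|[//]].
by congr K; apply/ffunP => i; rewrite !ffunE; case: ifP.
Qed.

Lemma bud2_spec : bud phi FL 2 (bud2_fgl, bud2_log, 2%N).
Proof.
have hf : unital_form bud2_fgl by exists (pconst 2 a).
have [hX hY] := (ordX T, ordY T); have [[hx hy] hz] := (ordx T, ordy T, ordz T).
have oF := ordge_form hf.
split=> //.
- have e : fgl_add T 2 bud2_fgl Y X = bud2_fgl :> mps T 2 by rewrite bud2_fgl_addE // /bud2_fgl; ring.
  by move=> i j; rewrite -{1}e [LHS](pcomp_swap bud2_fgl) !ffunE.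
- have hxy := ordge_form_add hf hx hy; have hyz := ordge_form_add hf hy hz.
  apply: eqd_refl'; rewrite /assoc_lhs /assoc_rhs bud2_fgl_addE // [RHS]bud2_fgl_addE // !bud2_fgl_addE //.
  by ring.
- have [K eK] := fgl_form FL_fgl.
  have k0 : K mzero = phi a by rewrite phi_a eK XYK11.
  have -> : mapps phi bud2_fgl = xv L 2 0 + xv L 2 1 + xv L 2 0 * xv L 2 1 * (phi a *: (1 : mps L 2)).
    by rewrite /bud2_fgl /pconst !mappsD !mappsM mappsZ mapps1 !xv_mono !mapps_mono.
  rewrite eK; apply: eqdD => //; apply/eqd_ordge; rewrite -mulrBr.
  apply: (ordgeM (d := 2) (e := 1)).
    by apply: (ordgeM (d := 1) (e := 1)).
  by apply/ordge1P; rewrite subE scaleE oneE eqxx mulr1 k0 subrr.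
have ot : ordge 1 (xv T 1 0) := @ordge_xv T 1 ord0.
have ot2 : ordge 2 (xv T 1 0 ^+ 2) by apply: ordgeX.
have ol : ordge 1 bud2_log by apply: ordgeB; apply: ordgeMr => //; apply: ordge_le ot2.
split=> //.
  rewrite /bud2_log subE /pconst !scale_mull !mul1r !scaleE.
  have -> : (xv T 1 0 ^+ 2) (munit 0) = 0.
    by apply: ot2; rewrite -[0%N]/(val (ord0 : 'I_1)) mdeg_unit.
  by rewrite xv_mono /mono eqxx mulr0 subr0 mulr1.
have at1l (u : mps T 2) : ordge 1 u -> at1 bud2_log u = pconst 2 2%:R * u - pconst 2 a * u ^+ 2.
  move=> hu; have hp (i : 'I_1) : ordge 1 ((fun=> u) i) by [].
  by rewrite /at1 /bud2_log (pcompB hp) !(pcompM hp) !pcomp_const // (pcomp_xv hp ord0).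
have two : pconst 2 2%:R = 2%:R by rewrite /pconst scaler_nat.
set A := pconst 2 a in at1l *.
have -> : log_defect bud2_log bud2_fgl = (X * Y) * ((X + Y) * (- 2%:R * A ^+ 2) + X * (- Y * A ^+ 3)).
  rewrite /log_defect !at1l // two /bud2_fgl -/A; ring.
apply: (ordgeM (d := 2) (e := 1)); first exact: (ordgeM (d := 1) (e := 1)).
by apply: ordgeD; apply: ordgeMl => //; apply: ordgeD.
Qed.

Lemma bud_seq : exists s : nat -> mps T 2 * mps T 1 * nat,
  [/\ s 0%N = (bud2_fgl, bud2_log, 2%N), forall N, bud phi FL N.+2 (s N) &
      forall N, eqd N.+2 (s N.+1).1.1 (s N).1.1].
Proof.
pose st N := {s : mps T 2 * mps T 1 * nat | bud phi FL N.+2 s}.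
have step N (s : st N) : {s' : st N.+1 | eqd N.+2 (sval s').1.1 (sval s).1.1}.
  apply: cid; have [s' h1 h2] := bud_step torsion_free phi_surj FL_fgl (ltn0Sn _) (svalP s).
  by exists (exist _ s' h1).
pose fix sq N : st N := if N is N'.+1 then sval (step N' (sq N')) else exist _ _ bud2_spec.
exists (fun N => sval (sq N)); split=> // N; first exact: svalP.
by rewrite /=; case: (step N (sq N)).
Qed.

Lemma lift_fgl : exists FT : mps T 2,
  [/\ is_fgl T FT, mapps phi FT = FL & FT (mk2 1 1) = a].
Proof.
have [s [s0 hs hss]] := bud_seq.
pose f N := (s N).1.1.
have chain N k : eqd N.+2 (f (N + k)%N) (f N).
  elim: k => [|k IH]; first by rewrite addn0.
  rewrite addnS; apply: (eqd_trans _ IH); apply: eqd_le (hss _).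
  by rewrite !ltnS leq_addr.
(* The limit: a coefficient of degree d is read off at stage d, which is already correct up to
   degree d + 2. *)
pose FT : mps T 2 := fun m => f (mdeg m) m.
have eFT N : eqd N.+2 FT (f N).
  move=> m hm; rewrite /FT; case/orP: (leq_total (mdeg m) N) => h.
    by rewrite -(subnKC h); apply/esym/chain/(leq_trans (leqnSn _)).
  by rewrite -(subnKC h) chain.
have fb N : [/\ unital_form (f N), comm_coef (f N), eqd N.+2 (assoc_lhs (f N)) (assoc_rhs (f N)) &
                eqd N.+2 (mapps phi (f N)) FL].
  by have := hs N; rewrite /bud /f; case: (s N) => [[F l] M] [].
have le2 N : (N <= N.+2)%N by rewrite (leq_trans (leqnSn _)).
have eFTf i j : FT (mk2 i j) = f (i + j)%N (mk2 i j) by rewrite /FT mdeg_mk2.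
have fFT : unital_form FT.
  have hXY : unital_form (X + Y) by exists 0; rewrite mulr0 addr0.
  suff [K hK] : exists K, FT - (X + Y) = X * Y * K by exists K; rewrite -hK addrC subrK.
  apply: XY_div => i; rewrite subE eFTf.
    have [h _ _ _] := fb (0 + i)%N.
    by rewrite (proj1 (form_XY0 i h)) (proj1 (form_XY0 i hXY)) subrr.
  have [h _ _ _] := fb (i + 0)%N.
  by rewrite (proj2 (form_XY0 i h)) (proj2 (form_XY0 i hXY)) subrr.
have cFT : comm_coef FT.
  by move=> i j; rewrite !eFTf [(j + i)%N]addnC; have [_ h _ _] := fb (i + j)%N.
have [K eK] := fFT.
have ot : ordge 1 (xv T 1 0) := @ordge_xv T 1 ord0.
exists FT; split.
- split=> m.
  + by rewrite (fgl_addg0 eK ot).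
  + by rewrite (fgl_add0g eK ot).
  + by rewrite [LHS](congr1 (fun g => g m) (pcomp_comm_coef cFT)).
  + suff e : assoc_lhs FT = assoc_rhs FT by exact: (congr1 (fun g : mps T 3 => g m) e).
    apply: eqdP => N; have [h1 _ h3 _] := fb N.
    apply: eqd_le (le2 N) _; apply: eqd_trans (assoc_lhs_eqd fFT h1 (eFT N)) _.
    by apply: eqd_trans h3 _; apply: eqd_sym; apply: assoc_rhs_eqd.
- apply: eqdP => N; have [_ _ _ h4] := fb N.
  by apply: eqd_le (le2 N) _; apply: (eqd_trans _ h4); apply: eqd_mapps.
rewrite (eFT 0%N); last by rewrite mdeg_mk2.
by rewrite /f s0 /= [LHS]XYK11 /pconst scaleE oneE eqxx mulr1.
Qed.

End Lazard.

(** * The Lazard ring as a retract of a polynomial ring *)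

Section LazardRing.
Import finmap monalg.
Variables (L : comNzRingType) (F : mps L 2).
Hypothesis hL : lazard_univ L F.

(** The polynomial ring over the integers with one variable for each element of [L], which makes the
    evaluation surjective without any choice of generators. *)
Local Notation T := ({malg int[{cmonom L}]} : comNzRingType).

Definition mon_eval (m : {cmonom L}) : L := \prod_(i <- finsupp m) i ^+ m i.

Lemma mon_evalE (m : {cmonom L}) (d : {fset L}) : fsubset (finsupp m) d ->
  mon_eval m = \prod_(i <- d) i ^+ m i.
Proof.
move=> le; rewrite /mon_eval (big_fset_incl _ le) //.
by move=> i _; rewrite -cmE_neq0 negbK => /eqP ->.
Qed.

Lemma mon_eval_morph : mmorphism mon_eval.
Proof.
split=> [m1 m2|]; last by rewrite /mon_eval mdom1 big_seq_fset0.
rewrite {1}/mon_eval mdomD (mon_evalE (fsubsetUl _ (finsupp m2))).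
rewrite (mon_evalE (fsubsetUr (finsupp m1) _)) -big_split /=.
by apply: eq_bigr => i _; rewrite cmM exprD.
Qed.

HB.instance Definition _ := isMultiplicative.Build _ L mon_eval mon_eval_morph.

Definition free_eval : {rmorphism T -> L} := (mmap (intr : int -> L) mon_eval : {rmorphism _ -> _}).

Definition free_var (b : L) : T := << (ucm b) >>.

Lemma free_eval_var b : free_eval (free_var b) = b.
Proof.
rewrite /free_eval /= mmapU mul1r /mon_eval mdomU big_seq_fset1 cmUU.
exact: expr1.
Qed.

Lemma free_torsion_free k (a : T) : (0 < k)%N -> a *+ k = 0 -> a = 0.
Proof.
move=> k0 h; apply/malgP => m; rewrite mcoeff0.
have := congr1 (mcoeff m) h; rewrite mcoeffMn mcoeff0 => /eqP.
by rewrite Num.Theory.mulrn_eq0 gtn_eqF //= => /eqP.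
Qed.

(** Multiplication by a variable shifts monomials injectively, so each coefficient of [u] is one of
    [w *+ 2]. *)
Lemma free_var_mod2 b (u w : T) : free_var b * u = w *+ 2 -> exists v, u = v *+ 2.
Proof.
move=> h.
have hinj m m' : (mmul (ucm b) m == mmul (ucm b) m') = (m == m').
  apply/eqP/eqP => [e|-> //]; apply/eqP/cmP => i.
  by have := congr1 (fun x : {cmonom L} => x i) e; rewrite !cmM => /addnI.
have hc m : u@_m = w@_(mmul (ucm b) m) *+ 2.
  rewrite -mcoeffMn -h malgM_def fgmulUg raddf_sum /= [in LHS](monalgE u) raddf_sum /=.
  by apply: eq_bigr => k _; rewrite !mcoeffU mul1r hinj.
exists (\sum_(k <- msupp u) << w@_(mmul (ucm b) k) *g k >>).
rewrite [LHS]monalgE -sumrMnl; apply: eq_bigr => k _.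
by rewrite hc monalgUMn.
Qed.

(* By universality L is a retract of the free ring T: the lift of F gives L -> T, and T -> L undoes it. *)
Lemma lazard_regular :
  (forall k (a : L), (0 < k)%N -> a *+ k = 0 -> a = 0) /\
  (forall u w : L, F (mk2 1 1) * u = w *+ 2 -> exists v, u = v *+ 2).
Proof.
have [hF univ] := hL.
have surj b : exists a, free_eval a = b by exists (free_var b); apply: free_eval_var.
(* The coefficient (1, 1) of the lift is chosen to be the variable of a_11, to which [free_var_mod2]
   applies. *)
have [FT [hFT eFT eFT11]] := lift_fgl (@free_torsion_free) surj hF (free_eval_var (F (mk2 1 1))).
have [s [hs _]] := univ T FT hFT.
have [i [_ hi]] := univ L F hF.
(* The composite L -> T -> L and the identity both carry F to F, so they agree by the uniqueness in
   the universal property. *)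
have retr x : free_eval (s x) = x.
  have h1 := hi [the {rmorphism L -> L} of free_eval \o s] _ x.
  have h2 := hi [the {rmorphism L -> L} of idfun] _ x.
  rewrite -[RHS]/(idfun x) h2 // -h1 //= => m.
  by rewrite hs -[RHS](congr1 (fun g : mps L 2 => g m) eFT).
split=> [k a k0 ha|u w h].
  rewrite -[a]retr (@free_torsion_free k (s a)) ?rmorph0 //.
  by rewrite -rmorphMn ha rmorph0.
have [v hv] : exists v, s u = v *+ 2.
  apply: (@free_var_mod2 (F (mk2 1 1)) (s u) (s w)).
  by rewrite -eFT11 -hs -rmorphM h rmorphMn.
by exists (free_eval v); rewrite -[u]retr hv rmorphMn.
Qed.

End LazardRing.

(** * The formal group law in n variables *)

Section Adic.
Variables (R : comNzRingType) (n : nat).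
Local Notation S := (mps R n).

(* Successive approximation: the quotient is the sum of the x^k * M_k. *)
Lemma adic_divides (x v : S) (G M : nat -> S) : ordge 1 x ->
  (forall k, G k = v * M k + x * G k.+1) -> divides v (G 0%N).
Proof.
move=> hx hG; pose K N := \sum_(k < N.+1) x ^+ k * M k.
have hK N : G 0%N = v * K N + x ^+ N.+1 * G N.+1.
  elim: N => [|N IH]; first by rewrite /K big_ord1 expr0 mul1r expr1 -hG.
  rewrite IH /K [in RHS]big_ord_recr /= [G N.+1 in LHS]hG [x ^+ N.+2]exprSr.
  ring.
have hKK N m : (mdeg m <= N)%N -> K N m = K (mdeg m) m.
  move=> h; rewrite -(subnKC h); elim: (N - mdeg m)%N => [|j IH]; first by rewrite addn0.
  rewrite addnS /K big_ord_recr /= addpE -/(K (mdeg m + j)%N) IH.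
  rewrite [X in _ + X](ordgeMl (d := (mdeg m + j).+1)) ?addr0 ?ltnS ?leq_addr //.
  exact: ordgeX.
exists (fun m => K (mdeg m) m); apply: eqdP => N.
apply: eqd_trans (_ : eqd N (v * K N) _).
  move=> m hm; rewrite (hK N) addpE [X in _ + X](ordgeMl (d := N.+1)) ?addr0 //.
  exact: ordgeX.
by apply: eqdM => // m hm; rewrite hKK.
Qed.

Lemma unit_series (u : S) : u mzero = 1 -> exists v, u * v = 1.
Proof.
move=> hu; have hx : ordge 1 (1 - u) by apply/ordge1P; rewrite subE oneE eqxx hu subrr.
(* The geometric series in 1 - u: at every stage 1 = u * 1 + (1 - u) * 1. *)
have [k|v hv] := @adic_divides (1 - u) u (fun=> 1) (fun=> 1) hx; last by exists v.
ring.
Qed.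

Lemma regular_lin (g : S) (i : 'I_n) : g mzero = 0 ->
  (forall j : 'I_n, (j < i)%N -> g (munit j) = 0) -> regular (g (munit i)) -> regular g.
Proof. by move=> h0 hj hr; apply: lead_regular (lead_linear h0 hj) hr. Qed.

End Adic.

Section UnitDiv.
Variable R : comNzRingType.

Lemma divides_unit (p u v x : R) : u * v = 1 -> divides p x -> divides (p * u) x.
Proof. by move=> e [q ->]; exists (v * q); rewrite -mulrA [u * _]mulrA e mul1r. Qed.

Lemma divides_unitV (p u x : R) : divides (p * u) x -> divides p x.
Proof. by move=> [q ->]; exists (u * q); rewrite mulrA. Qed.

Lemma reg_mod_unit (p u v y : R) : u * v = 1 -> reg_mod p y -> reg_mod (p * u) y.
Proof. by move=> e h x /divides_unitV /h; apply: divides_unit e. Qed.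

End UnitDiv.

Section Substitution.
Variables (R : comNzRingType) (n : nat).
Local Notation S := (mps R n).
Local Notation X := (xv R n).
Implicit Types (a b : 'I_n).

Definition diag a b : 'I_n -> S := fun i => if i == a then X b else X i.

Lemma ordge_diag a b i : ordge 1 (diag a b i).
Proof. by rewrite /diag; case: ifP => _; apply: ordge_xv. Qed.

(** The change of coordinates x_a -> x_a + x_b turns the diagonal into x_a = 0, where division by
    x_a is explicit; x_a -> x_a - x_b undoes it. *)
Lemma diag_divides a b (f : S) : a != b -> pcomp R n n f (diag a b) = 0 -> divides (X a - X b) f.
Proof.
move=> ab h0.
pose tp i : S := if i == a then X a + X b else X i.
pose tm i : S := if i == a then X a - X b else X i.
have otp i : ordge 1 (tp i).
  by rewrite /tp; case: ifP => _; [apply: ordgeD; apply: ordge_xv | apply: ordge_xv].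
have otm i : ordge 1 (tm i).
  by rewrite /tm; case: ifP => _; [apply: ordgeB; apply: ordge_xv | apply: ordge_xv].
set f' := pcomp R n n f tp.
have ff' : f = pcomp R n n f' tm.
  rewrite /f' pcompA // -[LHS]pcomp_id; apply: eq_pcomp => i.
  rewrite /tp; case: eqP => [->|/eqP ne]; last by rewrite pcomp_xv // /tm (negbTE ne).
  by rewrite pcompD // !pcomp_xv // /tm eqxx eq_sym (negbTE ab) subrK.
have z : zero_at a f' = 0.
  rewrite zero_atE /f' pcompA //; last exact: ordge_sub0.
  rewrite -[RHS]h0; apply: eq_pcomp => i; have hs := @ordge_sub0 R n a.
  rewrite /tp /diag; case: ifP => ia; last by rewrite pcomp_xv // /sub0 ia.
  by rewrite pcompD // !pcomp_xv // /sub0 eqxx eq_sym (negbTE ab) add0r.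
exists (pcomp R n n (shift_at a f') tm).
by rewrite {1}ff' {1}(zero_at_div z) pcompM // pcomp_xv // /tm eqxx.
Qed.

(** Divisibility by x_a - x_b is vanishing on the diagonal, where [y] can be cancelled. *)
Lemma reg_mod_diag a b (y : S) : a != b -> regular (pcomp R n n y (diag a b)) ->
  reg_mod (X a - X b) y.
Proof.
move=> ab hr x [q e]; apply: diag_divides => //; apply: hr.
have hd := @ordge_diag a b.
rewrite -pcompM // e pcompM // pcompB // !pcomp_xv // /diag eqxx eq_sym (negbTE ab).
by rewrite subrr mul0r.
Qed.

Lemma xv_lin a b : X a (munit b) = (b == a)%:R.
Proof.
rewrite xv_mono /mono; congr (_%:R); congr nat_of_bool; apply/eqP/eqP => [|-> //].
by move/ffunP/(_ b); rewrite !ffunE eqxx val_eqE; case: eqP.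
Qed.

End Substitution.

Section GroupLaw.
Variables (R : comNzRingType) (F : mps R 2) (ib : mps R 1).
Hypothesis hF : is_fgl R F.
Hypothesis hib : is_formal_inverse R F ib.
Local Notation "g ⊕ h" := (fgl_add R _ F g h) (at level 50, left associativity).
Local Notation bar := (fgl_bar R _ ib).

Let fF : unital_form F. Proof. exact: fgl_form. Qed.

Lemma ordge_ib : ordge 1 ib. Proof. by apply/ordge1P; case: hib. Qed.

Lemma ordge_bar n (g : mps R n) : ordge 1 g -> ordge 1 (bar g).
Proof. by move=> hg; apply: ordge_pcomp => //; apply: ordge_ib. Qed.

Lemma ordge_add n (g h : mps R n) : ordge 1 g -> ordge 1 h -> ordge 1 (g ⊕ h).
Proof. exact: ordge_form_add. Qed.

Lemma pcomp_bar k n (g : mps R k) (s : 'I_k -> mps R n) : ordge 1 g -> (forall i, ordge 1 (s i)) ->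
  pcomp R k n (bar g) s = bar (pcomp R k n g s).
Proof. by move=> hg hs; rewrite /fgl_bar pcompA. Qed.

Lemma fgl_g0 n (g : mps R n) : ordge 1 g -> g ⊕ 0 = g.
Proof. by case: fF => K e hg; apply: (fgl_addg0 e). Qed.

Lemma fgl_0g n (g : mps R n) : ordge 1 g -> 0 ⊕ g = g.
Proof. by case: fF => K e hg; apply: (fgl_add0g e). Qed.

Lemma fgl_addC n (g h : mps R n) : ordge 1 g -> ordge 1 h -> g ⊕ h = h ⊕ g.
Proof.
move=> hg hh; have hp i := ordge_pairf i hg hh.
have := congr1 (fun f => pcomp R 2 n f (pairf g h)) (pcomp_comm_coef (FL_comm hF)).
rewrite -[pcomp R 2 2 _ _]/(xv R 2 1 ⊕ xv R 2 0).
by rewrite pcomp_fgl_add // ?(pcomp_xv hp ord0) ?(pcomp_xv hp ord_max) => ->.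
Qed.

Lemma fgl_addA n (g h k : mps R n) : ordge 1 g -> ordge 1 h -> ordge 1 k ->
  g ⊕ h ⊕ k = g ⊕ (h ⊕ k).
Proof.
move=> hg hh hk; pose s (i : 'I_3) := if val i == 0%N then g else if val i == 1%N then h else k.
have hs i : ordge 1 (s i) by rewrite /s; case: ifP => // _; case: ifP.
have := congr1 (fun f => pcomp R 3 n f s) (FL_assoc hF).
have [[ox oy] oz] := (ordx R, ordy R, ordz R).
rewrite /assoc_lhs /assoc_rhs !pcomp_fgl_add //; try exact: ordge_add.
by rewrite (pcomp_xv hs ord0) (pcomp_xv hs (lift ord0 ord0)) (pcomp_xv hs ord_max).
Qed.

Lemma fgl_addN n (g : mps R n) : ordge 1 g -> g ⊕ bar g = 0.
Proof.
move=> hg; have hs (i : 'I_1) : ordge 1 ((fun=> g) i) by [].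
have ot : ordge 1 (xv R 1 0) := @ordge_xv R 1 ord0.
have e : xv R 1 0 ⊕ ib = 0 by apply: psP; case: hib.
have := congr1 (fun f => pcomp R 1 n f (fun=> g)) e.
by rewrite pcomp_fgl_add ?pcomp0 ?xv0_subst //; apply: ordge_ib.
Qed.

Lemma fgl_barK n (g : mps R n) : ordge 1 g -> bar (bar g) = g.
Proof.
move=> hg; have o1 := ordge_bar hg; have o2 := ordge_bar o1.
by rewrite -[LHS]fgl_0g // -(fgl_addN hg) fgl_addA // fgl_addN // fgl_g0.
Qed.

Lemma add_lin n (g h : mps R n) (i : 'I_n) : ordge 1 g -> ordge 1 h ->
  (g ⊕ h) (munit i) = g (munit i) + h (munit i).
Proof. by case: fF => K e; apply: (fgl_add_lin e). Qed.

Lemma bar_lin n (g : mps R n) (i : 'I_n) : ordge 1 g -> bar g (munit i) = - g (munit i).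
Proof.
move=> hg; apply/eqP; rewrite -addr_eq0 addrC -add_lin ?fgl_addN //; exact: ordge_bar.
Qed.

Lemma add_mod n (g h : mps R n) : ordge 1 g -> ordge 1 h -> divides h (g ⊕ h - g).
Proof.
case: fF => K e hg hh; exists (1 + g * fgl_tail K g h).
by rewrite (fgl_addK e) //; ring.
Qed.

End GroupLaw.

(** * Hall-Littlewood sums *)

Lemma card_ltn n k : (k <= n)%N -> #|[pred i : 'I_n | (i < k)%N]| = k.
Proof. by move=> h; rewrite -sum1_card -(big_ord_widen n (fun=> 1%N) h) sum1_card card_ord. Qed.

Lemma card_ltn_set n k : (k <= n)%N -> #|[set i : 'I_n | (i < k)%N]| = k.
Proof. by rewrite cardsE; apply: card_ltn. Qed.

Section HallLittlewood.
Variables (R : comNzRingType) (F : mps R 2) (ib : mps R 1) (n : nat).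
Hypothesis hF : is_fgl R F.
Hypothesis hib : is_formal_inverse R F ib.
Hypothesis torsion_free : forall k (a : R), (0 < k)%N -> a *+ k = 0 -> a = 0.
Local Notation S := (mps R n).
Local Notation X := (xv R n).
Local Notation "g ⊕ h" := (fgl_add R _ F g h) (at level 50, left associativity).
Local Notation bar := (fgl_bar R _ ib).
Implicit Types (a b i j : 'I_n) (w : 'S_n).

Definition Yf a b : S := X a ⊕ bar (X b).
Definition Zf a b : S := X a ⊕ X b.

Lemma ordge_Y a b : ordge 1 (Yf a b).
Proof. by apply: (ordge_add hF); [exact: ordge_xv | apply: (ordge_bar hib); exact: ordge_xv]. Qed.
Lemma ordge_Z a b : ordge 1 (Zf a b).
Proof. by apply: (ordge_add hF); exact: ordge_xv. Qed.

Lemma pcomp_Y m (s : 'I_n -> mps R m) a b : (forall i, ordge 1 (s i)) ->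
  pcomp R n m (Yf a b) s = s a ⊕ bar (s b).
Proof.
move=> hs; have o := @ordge_xv R n; have ob := ordge_bar hib (o b).
by rewrite pcomp_fgl_add // pcomp_bar // !pcomp_xv.
Qed.

Lemma pcomp_Z m (s : 'I_n -> mps R m) a b : (forall i, ordge 1 (s i)) ->
  pcomp R n m (Zf a b) s = s a ⊕ s b.
Proof. by move=> hs; have o := @ordge_xv R n; rewrite pcomp_fgl_add // !pcomp_xv. Qed.

Lemma Y_lin a b i : Yf a b (munit i) = (i == a)%:R - (i == b)%:R.
Proof.
have o := @ordge_xv R n; have ob := ordge_bar hib (o b).
by rewrite /Yf (add_lin hF) // (bar_lin hF hib) // !xv_lin.
Qed.

Lemma Z_lin a b i : Zf a b (munit i) = (i == a)%:R + (i == b)%:R.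
Proof. by have o := @ordge_xv R n; rewrite /Zf (add_lin hF) // !xv_lin. Qed.

(** Of two variables the one with the smaller index comes first in the order. It leads x_a ⊕ x_b as
    well as x_a ⊕ bar x_b, in the latter with coefficient [osign]. *)
Definition omin a b := if (a <= b)%N then a else b.
Definition osign a b : R := if (a <= b)%N then 1 else -1.

Lemma lt_ominl a b i : (i < omin a b)%N -> (i == a) = false /\ (i == b) = false.
Proof.
rewrite /omin => h; split; apply/eqP => e; move: h; rewrite e; case: (leqP a b) => h;
  by rewrite ?ltnn ?ltnNge ?h // ltnW.
Qed.

Lemma omin_cases a b : a != b ->
  ((omin a b == a) = (a <= b)%N) /\ ((omin a b == b) = ~~ (a <= b)%N).
Proof.
by move=> ne; rewrite /omin; case: leqP => _; rewrite eqxx ?[b == a]eq_sym (negbTE ne).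
Qed.

Lemma lead_Y a b : a != b -> lead (Yf a b) (munit (omin a b)) (osign a b).
Proof.
move=> ne; have e : Yf a b (munit (omin a b)) = osign a b.
  rewrite Y_lin /osign; have [-> ->] := omin_cases ne.
  by case: (a <= b)%N; rewrite ?subr0 ?sub0r.
rewrite -e; apply: lead_linear; first by apply/ordge1P/ordge_Y.
by move=> j /lt_ominl[ja jb]; rewrite Y_lin ja jb subrr.
Qed.

Lemma lead_Z a b : a != b -> lead (Zf a b) (munit (omin a b)) 1.
Proof.
move=> ne; have e : Zf a b (munit (omin a b)) = 1.
  rewrite Z_lin; have [-> ->] := omin_cases ne.
  by case: (a <= b)%N; rewrite ?addr0 ?add0r.
rewrite -[X in lead _ _ X]e; apply: lead_linear; first by apply/ordge1P/ordge_Z.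
by move=> j /lt_ominl[ja jb]; rewrite Z_lin ja jb addr0.
Qed.

Lemma lead_ZZ a : lead (Zf a a) (munit a) 2%:R.
Proof.
have e : Zf a a (munit a) = 2%:R by rewrite Z_lin eqxx -natrD.
rewrite -e; apply: lead_linear; first by apply/ordge1P/ordge_Z.
by move=> j hj; rewrite Z_lin -val_eqE /= ltn_eqF // addr0.
Qed.

Lemma regular_sign a b : regular (osign a b).
Proof. by rewrite /osign; case: ifP => _; [exact: regular1 | exact: regularN1]. Qed.

Lemma regular_nat k : (0 < k)%N -> regular (k%:R : R).
Proof. by move=> k0 y; rewrite mulr_natl; apply: torsion_free. Qed.

Lemma regular_Y a b : a != b -> regular (Yf a b).
Proof. by move=> ne; apply: lead_regular (lead_Y ne) (@regular_sign _ _). Qed.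

Lemma regular_ZZ a : regular (Zf a a).
Proof. by apply: lead_regular (lead_ZZ a) _; apply: regular_nat. Qed.

Lemma ps_torsion_free m k (f : mps R m) : (0 < k)%N -> f *+ k = 0 -> f = 0.
Proof.
move=> k0 h; apply: psP => x; apply: (torsion_free k0).
by rewrite -natmulE h.
Qed.

(** x_a ⊕ bar x_b vanishes on the diagonal, and comparing the coefficients of x_a gives the quotient
    the constant term 1. *)
Lemma Y_unit a b : a != b -> exists u v : S, Yf a b = (X a - X b) * u /\ u * v = 1.
Proof.
move=> ne; have hd := @ordge_diag R n a b.
have [u eu] : divides (X a - X b) (Yf a b).
  apply: diag_divides => //; rewrite pcomp_Y // /diag eqxx eq_sym (negbTE ne).
  by rewrite fgl_addN //; apply: ordge_xv.
have [v hv] : exists v, u * v = 1; last by exists u, v.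
apply: unit_series; have := congr1 (fun f : S => f (munit a)) eu.
rewrite Y_lin eqxx (negbTE ne) subr0 mulrBl subE !xv_mono !mono_mulE.
have -> : mle (munit a) (munit a : mon n) by apply/mleP.
have -> : mle (munit b) (munit a : mon n) = false.
  by apply/mleP => /(_ b); rewrite !ffunE eqxx val_eqE eq_sym (negbTE ne).
rewrite subr0 => e; rewrite -[RHS]/(true%:R) e; congr u; apply/ffunP => i; by rewrite !ffunE subnn.
Qed.

Lemma regular_XX a b : a != b -> regular (X a - X b).
Proof.
move=> ne; have [u [v [e _]]] := Y_unit ne.
by move=> y h; apply: (regular_Y ne); rewrite e mulrAC h mul0r.
Qed.

Lemma actE w (f : S) : act R n w f = pcomp R n n f (fun i => X (w i)).
Proof.
have o i : ordge 1 (X (w i)) by apply: ordge_xv.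
move: f; apply: lin_ext; last 1 first.
- move=> m; rewrite pcomp_mono // /subst_monom; apply: psP => x.
  have -> : \prod_i X (w i) ^+ m i = mono [ffun i => m ((w^-1)%g i)].
    rewrite mono_prod [RHS](reindex_inj (@perm_inj _ w)).
    by apply: eq_bigr => i _; rewrite ffunE permK.
  rewrite /act /mono; congr (_%:R); congr nat_of_bool; apply/eqP/eqP => [<-|->].
    by apply/ffunP => i; rewrite !ffunE permKV.
  by apply/ffunP => i; rewrite !ffunE permK.
- split=> // N f g h m hm; apply: h; apply: leq_trans hm; rewrite /mdeg.
  rewrite [X in (_ <= X)%N](reindex_inj (@perm_inj _ w)).
  by apply: leq_sum => i _; rewrite ffunE.
- exact: cont_pcomp.
Qed.

Lemma act_mul w w' (f : S) : act R n w (act R n w' f) = act R n (w' * w)%g f.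
Proof.
apply: psP => m; rewrite /act; congr f; apply/ffunP => i.
by rewrite !ffunE permM.
Qed.

(* After multiplication by Delta the ordered pair (a, b) contributes its numerator x_a ⊕ x_b if x_a ⊕ bar x_b is
   one of the denominators in the summand of w, and the factor x_a ⊕ bar x_b of Delta otherwise. *)
Definition phi r w a b : S :=
  if (((w^-1)%g a < r) && ((w^-1)%g a < (w^-1)%g b))%N then Zf a b else Yf a b.

Section Term.
(** The bracket enters through its behaviour under substitution, which is common to [x]^k and
    [[x]]^k; P and Q are treated together. *)
Variable br : S -> nat -> S.
Hypothesis br_comp : forall (g : S) (s : 'I_n -> S) k, ordge 1 g -> (forall i, ordge 1 (s i)) ->
  pcomp R n n (br g k) s = br (pcomp R n n g s) k.
Variable l : seq nat.
Hypothesis hl : (size l <= n)%N.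
Local Notation r := (size l).

Definition lead_part w : S := \prod_(i < n | (i < r)%N) br (X (w i)) (nth 0%N l i).
Definition term w : S := lead_part w * \prod_(a < n) \prod_(b < n | b != a) phi r w a b.

Lemma HL_DeltaE : HL_Delta R F ib n = \prod_(a < n) \prod_(b < n | b != a) Yf a b.
Proof.
rewrite /HL_Delta; apply: eq_bigr => a _.
by apply: eq_bigl => b; rewrite eq_sym.
Qed.

Lemma HL_termE w :
  act R n w (pmul R n (lead_mon R n br l) (pmul R n (HL_num R F n l) (HL_cofactor R F ib n l))) = term w.
Proof.
have o i : ordge 1 (X (w i)) by apply: ordge_xv.
rewrite actE [pmul _ _ _ _]pmulE pcompM // /term; congr (_ * _).
  rewrite /lead_mon [X in pcomp _ _ _ X](big_ord_widen n (fun k => br (X k) (nth 0%N l k))) //.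
  rewrite pcomp_prod //; apply: eq_bigr => i _.
  by have oi := @ordge_xv R n i; rewrite br_comp // pcomp_xv.
rewrite pmulE pcompM //.
have -> : pcomp R n n (HL_num R F n l) (fun i => X (w i)) =
  \prod_(a < n) \prod_(b < n | (b != a) && ((a < r) && (a < b))%N) Zf (w a) (w b).
  rewrite /HL_num (big_ord_widen n (fun k => \big[pmul R n/pone R n]_(j < n | (k < j)%N)
     fgl_add R n F (X k) (X j))) //.
  rewrite pcomp_prod // big_mkcond; apply: eq_bigr => a _.
  case: ifP => ar; last by rewrite big_pred0 // => b; rewrite andbF.
  rewrite pcomp_prod //; apply: eq_big => [b|b _]; last exact: pcomp_Z.
  by case: (ltngtP a b) => h; rewrite ?andbF // andbT -val_eqE /= gtn_eqF.
have -> : pcomp R n n (HL_cofactor R F ib n l) (fun i => X (w i)) =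
  \prod_(a < n) \prod_(b < n | (b != a) && ~~ ((a < r) && (a < b))%N) Yf (w a) (w b).
  rewrite /HL_cofactor pcomp_prod //; apply: eq_bigr => a _.
  rewrite pcomp_prod //; apply: eq_big => [b|b _]; last exact: pcomp_Y.
  by rewrite eq_sym.
rewrite -big_split /= [RHS](reindex_inj (@perm_inj _ w)) /=; apply: eq_bigr => a _.
rewrite [RHS](reindex_inj (@perm_inj _ w)) /= [RHS](bigID (fun b => ((a < r) && (a < b))%N)) /=.
congr (_ * _); apply: eq_big => [b|b /andP[_ hb]]; rewrite ?(inj_eq perm_inj) //.
  by rewrite /phi !permK hb.
by rewrite /phi !permK (negbTE hb).
Qed.

Lemma HL_defE (f : S) : HL_def R F ib n br l f <->
  (f * HL_Delta R F ib n) *+ (n - r)`! = \sum_w term w.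
Proof.
have e m : (\big[padd R n/pzero R n]_(w : 'S_n)
   act R n w (pmul R n (lead_mon R n br l) (pmul R n (HL_num R F n l) (HL_cofactor R F ib n l)))) m
   = (\sum_w term w) m.
  by congr (_ m); apply: eq_bigr => w _; exact: HL_termE.
split=> [h|h m].
  by apply: psP => m; rewrite natmulE -mulr_natl -pmulE h e.
by rewrite mulr_natl -natmulE pmulE h e.
Qed.

Lemma sym_sum w : act R n w (\sum_w term w) = \sum_w term w.
Proof.
set g := pmul R n (lead_mon R n br l) (pmul R n (HL_num R F n l) (HL_cofactor R F ib n l)).
have e w' : term w' = act R n w' g by rewrite HL_termE.
rewrite actE pcomp_sum => [|i]; last exact: ordge_xv.
rewrite [RHS](reindex_inj (@mulIg _ w)) /=; apply: eq_bigr => w' _.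
by rewrite !e -actE act_mul.
Qed.

(** The summand depends only on which variables occupy the first r places: [phi] compares a place
    below r with another one, and permuting the places from r on does not change the outcome. *)
Lemma term_coset (h w : 'S_n) : (forall i, (i < r)%N -> h i = i) -> term (h * w)%g = term w.
Proof.
move=> hh.
have hV i : (i < r)%N -> (h^-1)%g i = i by move=> hi; rewrite -{1}(hh i hi) permK.
have hVr i : ((h^-1)%g i < r)%N = (i < r)%N.
  apply/idP/idP => [hi|hi]; last by rewrite hV.
  by rewrite -(permKV h i) hh.
rewrite /term; congr (_ * _).
  by apply: eq_bigr => i hi; rewrite permM hh.
apply: eq_bigr => a _; apply: eq_bigr => b _; rewrite /phi invMg !permM.
set i := (w^-1)%g a; set j := (w^-1)%g b; rewrite hVr.
have [hi|] := ltnP i r; rewrite ?andFb // hV //=.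
have [hj|hj] := ltnP j r; first by rewrite hV.
have hj' : (r <= (h^-1)%g j)%N by rewrite leqNgt hVr -leqNgt.
by rewrite !(leq_trans hi).
Qed.

Definition stab : {set 'S_n} := Sym [set i : 'I_n | (r <= i)%N].

Lemma mem_stab (h : 'S_n) : (h \in stab) = [forall i : 'I_n, (i < r)%N ==> (h i == i)].
Proof.
rewrite inE /perm_on; apply/subsetP/forallP => [hs i|hs i].
  apply/implyP => hi; apply/negPn/negP => ne.
  by have := hs i; rewrite !inE leqNgt hi => /(_ ne).
by rewrite !inE; apply: contraR; rewrite -ltnNge => hi; have := hs i; rewrite hi.
Qed.

Lemma card_stab : #|stab| = (n - r)`!.
Proof.
rewrite card_Sym; congr (_`!).
have := cardsC [set i : 'I_n | (i < r)%N]; rewrite card_ord.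
have -> : #|[set i : 'I_n | (i < r)%N]| = r.
  by rewrite cardsE card_ltn.
have -> : ~: [set i : 'I_n | (i < r)%N] = [set i : 'I_n | (r <= i)%N].
  by apply/setP => i; rewrite !inE -leqNgt.
by move/(congr1 (subn^~ r)); rewrite addKn.
Qed.

(** [J] consists of one representative for each coset of the stabilizer, which has (n - r)!
    elements. *)
Lemma coset_sum : exists J : {set 'S_n}, \sum_w term w = (\sum_(w in J) term w) *+ (n - r)`!.
Proof.
pose G := Sym_group [set i : 'I_n | (r <= i)%N].
pose p w := repr (G :* w)%g.
have pG w : p w \in (G :* w)%g by apply: (mem_repr w); apply: rcoset_refl.
exists [set j | p j == j]; rewrite (partition_big p xpredT) //= -sumrMnl.
rewrite [RHS]big_mkcond; apply: eq_bigr => j _; rewrite inE.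
have hp w : p w = j -> (G :* w = G :* j)%g.
  by move=> <-; apply/esym/rcoset_eqP; exact: pG.
case: eqP => [pj|npj]; last first.
  rewrite big_pred0 // => w; apply/negP => /eqP e; apply: npj.
  by rewrite -[RHS]e /p (hp w e).
have hw w : (p w == j) = (w \in (G :* j)%g).
  apply/eqP/idP => [/hp <-|/rcoset_eqP e]; first exact: rcoset_refl.
  by rewrite /p e.
rewrite (eq_bigl _ _ hw) -card_stab -(card_rcoset G j) -sumr_const.
apply: eq_bigr => w /rcosetP[h hh ->]; apply: term_coset => i hi.
have : h \in stab by [].
by rewrite mem_stab => /forallP/(_ i); rewrite hi => /eqP.
Qed.

Lemma prod_pairs (G : 'I_n -> 'I_n -> S) :
  \prod_(a < n) \prod_(b < n | b != a) G a b =
  \prod_(p : 'I_n * 'I_n | (p.1 < p.2)%N) (G p.1 p.2 * G p.2 p.1).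
Proof.
rewrite pair_big_dep /= big_split /=.
rewrite (bigID (fun p : 'I_n * 'I_n => (p.1 < p.2)%N)) /=; congr (_ * _).
  apply: eq_bigl => p; case: ltngtP => h; rewrite ?andbF // andbT.
  by rewrite -val_eqE /= gtn_eqF.
rewrite (reindex_inj (h := fun p : 'I_n * 'I_n => (p.2, p.1))) /=; last by move=> [? ?] [? ?] [-> ->].
apply: eq_bigl => p; case: ltngtP => h; rewrite ?andbF ?andbT //.
  by rewrite -val_eqE /= ltn_eqF.
by rewrite (val_inj h) eqxx.
Qed.

Lemma Y_div a b : a != b -> divides (X a - X b) (Yf a b) /\ divides (X a - X b) (Yf b a).
Proof.
move=> ne; have [u [_ [e _]]] := Y_unit ne.
have nba : b != a by rewrite eq_sym.
have [v [_ [e' _]]] := Y_unit nba.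
by split; [exists u | exists (- v); rewrite e'; ring].
Qed.

(** The two orders of the pair cannot both be in the denominator of one summand, so one of x_a ⊕ bar
    x_b and x_b ⊕ bar x_a is a factor. *)
Lemma term_div a b w : a != b -> divides (X a - X b) (term w).
Proof.
move=> ne; apply: divides_mulr.
have [h1 h2] := Y_div ne.
have hphi i j : i != j -> divides (X a - X b) (phi r w i j) ->
    divides (X a - X b) (\prod_(a < n) \prod_(b < n | b != a) phi r w a b).
  move=> nij h; rewrite (bigD1 i) //= (bigD1 j) 1?eq_sym //=.
  by do 2!apply: divides_mull.
have [hc|hc] := boolP (((w^-1)%g a < r) && ((w^-1)%g a < (w^-1)%g b))%N.
  apply: (hphi b a); first by rewrite eq_sym.
  rewrite /phi; case: ifP => // /andP[_ hba].
  by case/andP: hc => _ hab; move: (ltn_trans hab hba); rewrite ltnn.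
by apply: (hphi a b) => //; rewrite /phi (negbTE hc).
Qed.

(* The sum is divisible by D = x_a - x_b, and the quotient is antisymmetric under (a b): so D divides it again. *)
Lemma sum_div a b : a != b -> divides (Yf a b * Yf b a) (\sum_w term w).
Proof.
move=> ne; set N := \sum_w term w; set D := X a - X b.
have [A eA] : divides D N.
  by apply: ideal_sum => [|w _]; [exact: ideal_div | exact: term_div].
pose t := tperm a b.
have o i : ordge 1 (X (t i)) by apply: ordge_xv.
have eD : act R n t D = - D.
  by rewrite actE pcompB // !pcomp_xv // tpermL tpermR opprB.
have eN : N = - D * act R n t A.
  by rewrite -[LHS](sym_sum t) -/N eA -eD !actE pcompM.
have asym : act R n t A = - A.
  apply: (regularI (regular_XX ne)); apply/eqP; rewrite -/D -subr_eq0; apply/eqP.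
  transitivity (- (- D * act R n t A) + D * A); first ring.
  by rewrite -eN -eA addNr.
have hd := @ordge_diag R n a b.
have [B eB] : divides D A.
  (* On the diagonal the transposition acts trivially, so antisymmetry gives twice the value of A
     equal to 0. *)
  apply: diag_divides => //; apply: (@ps_torsion_free n 2) => //.
  rewrite mulr2n -[X in _ + X]opprK -pcompN // -asym actE pcompA // addrC.
  apply/eqP; rewrite addrC subr_eq0; apply/eqP; apply: eq_pcomp => i.
  rewrite pcomp_xv // /diag /t; case: tpermP => [->|->|/eqP ia /eqP ib'].
  - by rewrite eqxx eq_sym (negbTE ne).
  - by rewrite eqxx eq_sym (negbTE ne).
  - by [].
have [u [u' [e1 k1]]] := Y_unit ne.
have nba : b != a by rewrite eq_sym.
have [v [v' [e2 k2]]] := Y_unit nba.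
exists (- (u' * v' * B)); rewrite eA eB e1 e2 -/D.
have -> : X b - X a = - D by rewrite opprB.
transitivity (D * D * (u * u') * (v * v') * B); last ring.
by rewrite k1 k2; ring.
Qed.

(** Up to a unit the first product is (x_a - x_b)^2. Setting x_a = x_b leaves the indices of any
    other pair distinct, so the second product stays regular. *)
Lemma reg_mod_pairs (p q : 'I_n * 'I_n) : (p.1 < p.2)%N -> (q.1 < q.2)%N -> p != q ->
  reg_mod (Yf p.1 p.2 * Yf p.2 p.1) (Yf q.1 q.2 * Yf q.2 q.1).
Proof.
case: p q => [a b] [c d] /= hab hcd npq.
have ne : a != b by rewrite -val_eqE ltn_eqF.
have [u [u' [e1 k1]]] := Y_unit ne.
have nba : b != a by rewrite eq_sym.
have [v [v' [e2 k2]]] := Y_unit nba.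
have -> : Yf a b * Yf b a = (X a - X b) * (X a - X b) * (- (u * v)) by rewrite e1 e2; ring.
apply: (@reg_mod_unit _ _ _ (- (u' * v'))).
  by transitivity ((u * u') * (v * v')); [ring | rewrite k1 k2 mulr1].
suff H : reg_mod (X a - X b) (Yf c d * Yf d c).
  by apply: reg_mod_mul => //; apply: regular_XX.
apply: reg_mod_diag => //; have hd := @ordge_diag R n a b.
pose s i := if i == a then b else i.
have es i : diag R a b i = X (s i) by rewrite /diag /s; case: ifP.
have ns : s c != s d.
  rewrite /s; case: (eqVneq c a) => [ca|ca]; case: (eqVneq d a) => [da|da].
  - by move: hcd; rewrite ca da ltnn.
  - by apply: contraNneq npq => bd; rewrite ca bd.
  - by apply: contraTneq hcd => ->; rewrite da -leqNgt ltnW.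
  - by rewrite -val_eqE ltn_eqF.
by rewrite pcompM // !pcomp_Y // !es; apply: regularM; apply: regular_Y; rewrite // eq_sym.
Qed.

Lemma Delta_divides : divides (HL_Delta R F ib n) (\sum_w term w).
Proof.
rewrite HL_DeltaE prod_pairs -big_filter; apply: divides_prod.
- by rewrite filter_uniq // index_enum_uniq.
- move=> p; rewrite mem_filter => /andP[hp _]; apply: sum_div.
  by rewrite -val_eqE ltn_eqF.
move=> p q; rewrite !mem_filter => /andP[hp _] /andP[hq _] npq.
exact: reg_mod_pairs.
Qed.

Definition delta2 : mon n :=
  \big[@madd n/mzero]_(a < n) \big[@madd n/mzero]_(b < n | b != a) munit (omin a b).
Definition delta_sign : R := \prod_(a < n) \prod_(b < n | b != a) osign a b.

Lemma lead_Delta : lead (HL_Delta R F ib n) delta2 delta_sign.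
Proof.
rewrite HL_DeltaE; apply: lead_prod => a _; apply: lead_prod => b ne.
by apply: lead_Y; rewrite eq_sym.
Qed.

Lemma regular_delta_sign : regular delta_sign.
Proof. by do 2!(apply: regular_prod => ? _); apply: regular_sign. Qed.

Lemma regular_Delta : regular (HL_Delta R F ib n).
Proof. exact: lead_regular lead_Delta regular_delta_sign. Qed.

Lemma unit_delta_sign : delta_sign * delta_sign = 1.
Proof.
rewrite /delta_sign -big_split big1 //= => a _; rewrite -big_split big1 //= => b _.
by rewrite /osign; case: ifP => _; rewrite ?mulr1 // mulrN1 opprK.
Qed.

(** After Delta the factorial is divided out: it divides the product with Delta, and Delta has
    leading coefficient 1 or -1, so it divides the quotient coefficientwise. *)
Lemma HL_exists : exists f, HL_def R F ib n br l f.
Proof.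
have [f' ef] := Delta_divides; have [J eJ] := coset_sum.
have [g eg] : exists g, f' = ((n - r)`!)%:R *: g.
  apply: dvd_ideal; apply: (reg_coef_ideal (ideal_div _) (p := HL_Delta R F ib n) (m := delta2)).
  - by move=> x hx; case: lead_Delta => _ ->; case: (ideal_div ((n - r)`!%:R : R)).
  - move=> c; case: lead_Delta => -> _ /(divides_mulr delta_sign).
    by rewrite mulrA unit_delta_sign mul1r.
  - move=> x; rewrite -ef eJ natmulE; exists ((\sum_(w in J) term w) x); by rewrite mulr_natl.
exists g; apply/HL_defE; rewrite ef eg scale_mulr mulrC.
by rewrite scaler_nat.
Qed.

Lemma HL_coset f : HL_def R F ib n br l f ->
  exists J : {set 'S_n}, f * HL_Delta R F ib n = \sum_(w in J) term w.
Proof.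
move/HL_defE => e; have [J eJ] := coset_sum; exists J; rewrite eJ in e.
apply/eqP; rewrite -subr_eq0; apply/eqP; apply: (@ps_torsion_free n (n - r)`!) => //.
  exact: fact_gt0.
by rewrite mulrnBl e subrr.
Qed.

Lemma HL_symmetric f : HL_def R F ib n br l f -> symmetric R n f.
Proof.
move/HL_defE => e w m; suff -> : act R n w f = f by [].
have o i : ordge 1 (X (w i)) by apply: ordge_xv.
have eD : act R n w (HL_Delta R F ib n) = HL_Delta R F ib n.
  rewrite HL_DeltaE actE pcomp_prod // [RHS](reindex_inj (@perm_inj _ w)).
  apply: eq_bigr => a _; rewrite pcomp_prod // [RHS](reindex_inj (@perm_inj _ w)).
  by apply: eq_big => [b|b _]; [rewrite (inj_eq perm_inj) | exact: pcomp_Y].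
apply: (regularI regular_Delta); apply/eqP; rewrite -subr_eq0 -mulrBr mulrBr; apply/eqP.
apply: (@ps_torsion_free n (n - r)`!); first exact: fact_gt0.
rewrite mulrnBl -{1}eD [X in _ - X *+ _]mulrC e -[X in _ - X](sym_sum w) -e.
by rewrite !actE pcompMn // pcompM // [X in X *+ _ - _]mulrC subrr.
Qed.

(** * Leading terms of the Hall-Littlewood sums *)

Section StrictPartitions.
Hypothesis l_strict : strict_part n l.

Lemma strict_gt0 k : (0 < nth 0 l k)%N = (k < r)%N.
Proof.
have [hk|hk] := ltnP k r; last by rewrite nth_default.
by case/and3P: l_strict => _ _ /allP; apply; apply: mem_nth.
Qed.

Lemma strict_ltn k k' : (k < k')%N -> (k < r)%N -> (nth 0 l k' < nth 0 l k)%N.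
Proof.
move=> kk' kr; have [k'r|k'r] := ltnP k' r; last by rewrite (nth_default _ k'r) strict_gt0.
case/and3P: l_strict => _ hs _.
have tr : transitive (fun a b : nat => (b < a)%N) by move=> ? ? ? h1 h2; apply: ltn_trans h2 h1.
exact: (sorted_ltn_nth tr 0%N hs).
Qed.

Lemma strict_leq k k' : (k <= k')%N -> (nth 0 l k' <= nth 0 l k)%N.
Proof.
rewrite leq_eqVlt => /predU1P[-> //|kk'].
have [kr|kr] := ltnP k r; first exact/ltnW/strict_ltn.
by rewrite nth_default // (leq_trans kr) // ltnW.
Qed.

Lemma strict_inj k k' : nth 0%N l k = nth 0%N l k' -> (k < r)%N -> k = k'.
Proof.
move=> e kr; have k'r : (k' < r)%N by rewrite -strict_gt0 -e strict_gt0.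
by case: (ltngtP k k') => // h; [have := strict_ltn h kr | have := strict_ltn h k'r]; rewrite e ltnn.
Qed.

Definition part_mon : mon n := [ffun i : 'I_n => nth 0%N l i].
Definition perm_mon w : mon n := [ffun i : 'I_n => nth 0%N l ((w^-1)%g i)].

Lemma mdeg_perm_mon w : mdeg (perm_mon w) = mdeg part_mon.
Proof.
rewrite /mdeg [RHS](reindex_inj (@perm_inj _ (w^-1)%g)) /=.
by apply: eq_bigr => i _; rewrite !ffunE.
Qed.

Lemma perm_mon_stab w : w \in stab -> perm_mon w = part_mon.
Proof.
rewrite mem_stab => /forallP hs; apply/ffunP => i; rewrite !ffunE.
have hw j : (j < r)%N -> w j = j by move=> hj; apply/eqP; have := hs j; rewrite hj.
have [hi|hi] := ltnP i r; first by rewrite -[i in LHS]hw // permK.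
rewrite !nth_default // leqNgt; apply/negP => hi'.
by move: hi; rewrite -(permKV w i) hw // leqNgt hi'.
Qed.

(** The decreasing arrangement is lexicographically largest, hence first in the order; as the parts
    are distinct, it is attained only on the stabilizer. *)
Lemma perm_mon_lt w : w \notin stab -> mlt part_mon (perm_mon w).
Proof.
move=> ws; case/or3P: (mlt_total part_mon (perm_mon w)) => [/eqP e|//|h].
  case/negP: ws; rewrite mem_stab; apply/forallP => i; apply/implyP => hi.
  have /ffunP/(_ i) := e; rewrite !ffunE => e'.
  have /val_inj {1}-> := strict_inj e' hi.
  by rewrite permKV.
case/mltP: h => [|[_ [i []]]]; first by rewrite mdeg_perm_mon ltnn.
rewrite !ffunE; set k := (w^-1)%g i => lt hj.
have kr : (k < r)%N by rewrite -strict_gt0 (leq_trans _ lt).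
have ki : (k < i)%N by rewrite ltnNge; apply/negP => /strict_leq; rewrite leqNgt lt.
have := hj k ki; rewrite !ffunE => e.
have /val_inj/perm_inj e' := strict_inj (esym e) kr.
by move: ki; rewrite {1}e' ltnn.
Qed.

(** To be 1 for P and 2 for Q, the leading coefficient of x_i ⊕ x_i. *)
Variable c0 : R.
Hypothesis br_lead : forall i k, (0 < k)%N ->
  lead (br (X i) k) [ffun j => if j == i then k else 0%N] c0.

Lemma big_maddE (J : Type) (s : seq J) (P : pred J) (G : J -> mon n) x :
  (\big[@madd n/mzero]_(i <- s | P i) G i) x = (\sum_(i <- s | P i) G i x)%N.
Proof. by elim/big_rec2: _ => [|i u v _ <-]; rewrite ffunE. Qed.

Lemma lead_lead_part w : lead (lead_part w) (perm_mon w) (c0 ^+ r).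
Proof.
have -> : c0 ^+ r = \prod_(i < n | (i < r)%N) c0.
  rewrite prodr_const; congr (_ ^+ _).
  exact/esym/card_ltn.
have -> : perm_mon w = \big[@madd n/mzero]_(i < n | (i < r)%N)
     [ffun j => if j == w i then nth 0%N l i else 0%N].
  apply/ffunP => j; rewrite big_maddE ffunE.
  have [hj|hj] := ltnP ((w^-1)%g j) r.
    rewrite (bigD1 ((w^-1)%g j)) //= ffunE permKV eqxx big1 ?addn0 // => i /andP[_ ne].
    by rewrite ffunE; case: eqP => // e; case/eqP: ne; rewrite e permK.
  rewrite nth_default // big1 // => i hi; rewrite ffunE; case: eqP => // e.
  by move: hj; rewrite e permK leqNgt hi.
by apply: lead_prod => i hi; apply: br_lead; rewrite strict_gt0.
Qed.

Definition phi_sign w : R := \prod_(a < n) \prod_(b < n | b != a)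
  if (((w^-1)%g a < r) && ((w^-1)%g a < (w^-1)%g b))%N then 1 else osign a b.

Lemma lead_term w : lead (term w) (madd (perm_mon w) delta2) (c0 ^+ r * phi_sign w).
Proof.
apply: lead_mul; first exact: lead_lead_part.
apply: lead_prod => a _; apply: lead_prod => b ne.
by rewrite /phi; case: ifP => _; [apply: lead_Z | apply: lead_Y]; rewrite // eq_sym.
Qed.

Lemma phi_sign_stab w : w \in stab -> phi_sign w = delta_sign.
Proof.
rewrite mem_stab => /forallP hs; apply: eq_bigr => a _; apply: eq_bigr => b ne.
case: ifP => // /andP[ha hab].
have hw j : (j < r)%N -> w j = j by move=> hj; apply/eqP; have := hs j; rewrite hj.
have ea : (w^-1)%g a = a by rewrite -[in RHS](permKV w a) hw.
rewrite ea in ha hab; rewrite /osign.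
have [//|hba] := leqP a b.
have eb : (w^-1)%g b = b by rewrite -{1}(hw b (ltn_trans hba ha)) permK.
by move: hab; rewrite eb ltnNge (ltnW hba).
Qed.

Lemma lead_above (f : S) m m' c : mlt m m' -> lead f m' c -> lead f m 0.
Proof. by move=> h [_ hf]; split=> [|x hx]; apply: hf => //; apply: mlt_trans h. Qed.

Lemma lead_sum J (s : seq J) (P : pred J) (G : J -> S) (m : mon n) (c : J -> R) :
  (forall k, P k -> lead (G k) m (c k)) ->
  lead (\sum_(k <- s | P k) G k) m (\sum_(k <- s | P k) c k).
Proof.
move=> h; elim/big_rec2: _ => [|i u v Pi [e1 e2]]; first by split.
by have [e3 e4] := h i Pi; split=> [|x hx]; rewrite addpE ?e1 ?e3 // e4 ?e2 ?addr0.
Qed.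

(** The stabilizer contributes (n - r)! equal leading terms and all other summands start later; then
    the factorial and the leading term of Delta are cancelled. *)
Lemma HL_lead f : HL_def R F ib n br l f -> lead f part_mon (c0 ^+ r).
Proof.
move/HL_defE => e; set k := (n - r)`! in e.
have k0 : (0 < k)%N by apply: fact_gt0.
have h : lead (\sum_w term w) (madd part_mon delta2) ((c0 ^+ r *+ k) * delta_sign).
  have -> : (c0 ^+ r *+ k) * delta_sign =
     \sum_(w : 'S_n) if w \in stab then c0 ^+ r * delta_sign else 0.
    by rewrite -big_mkcond sumr_const card_stab mulrnAl.
  apply: lead_sum => w _; case: ifP => hw.
    by rewrite -(perm_mon_stab hw) -(phi_sign_stab hw); apply: lead_term.
  apply: lead_above (lead_term w); rewrite ![madd _ delta2]maddC mlt_add2l.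
  by apply: perm_mon_lt; rewrite hw.
rewrite -e -mulrnAl in h.
have [e1 e2] := lead_cancel lead_Delta regular_delta_sign h.
split=> [|x hx].
  apply/eqP; rewrite -subr_eq0; apply/eqP/(torsion_free k0).
  by rewrite mulrnBl -natmulE e1 subrr.
by apply: (torsion_free k0); rewrite -natmulE e2.
Qed.

End StrictPartitions.

(** Separates the pairs that avoid the special variables in [K] from those that involve them; the
    latter are going to cancel against Delta. *)
Lemma prod_split (K : pred 'I_n) (G : 'I_n -> 'I_n -> S) :
  \prod_(a < n) \prod_(b < n | b != a) G a b =
  (\prod_(a < n | ~~ K a) \prod_(b < n | (b != a) && ~~ K b) G a b) *
  ((\prod_(a < n | ~~ K a) \prod_(b < n | K b) G a b) *
   (\prod_(a < n | K a) \prod_(b < n | b != a) G a b)).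
Proof.
rewrite (bigID K) /= mulrC mulrA; congr (_ * _); rewrite -big_split /=.
apply: eq_bigr => a Ka; rewrite (bigID K) /= mulrC; congr (_ * _).
apply: eq_bigl => b; case: (boolP (K b)) => Kb; rewrite ?andbF // andbT.
by apply: contraNneq Ka => <-.
Qed.

Section ZeroIndependent.
Variable p : 'I_n.

Lemma zero_at_Y a b : a != p -> b != p -> zero_at p (Yf a b) = Yf a b.
Proof.
move=> ap bp; rewrite zero_atE pcomp_Y; last exact: ordge_sub0.
by rewrite /sub0 (negbTE ap) (negbTE bp).
Qed.

Lemma zero_at_Z a b : a != p -> b != p -> zero_at p (Zf a b) = Zf a b.
Proof.
move=> ap bp; rewrite zero_atE pcomp_Z; last exact: ordge_sub0.
by rewrite /sub0 (negbTE ap) (negbTE bp).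
Qed.

Lemma zero_at_phi w a b : a != p -> b != p -> zero_at p (phi r w a b) = phi r w a b.
Proof. by move=> ap bp; rewrite /phi; case: ifP => _; [apply: zero_at_Z | apply: zero_at_Y]. Qed.

Lemma zero_at_br a k : a != p -> zero_at p (br (X a) k) = br (X a) k.
Proof.
move=> ap; have hs := @ordge_sub0 R n p; have o := @ordge_xv R n a.
by rewrite zero_atE br_comp // pcomp_xv // /sub0 (negbTE ap).
Qed.

Lemma zero_at_lead w : (forall i, (i < r)%N -> w i != p) ->
  zero_at p (lead_part w) = lead_part w.
Proof.
by move=> h; rewrite zero_at_prod; apply: eq_bigr => i hi; apply/zero_at_br/h.
Qed.

(** [zero_at p h = h] says that [h] does not involve x_p, and this descends to quotients by regular
    series. *)
Lemma zero_at_cancel (A h B : S) : regular A -> zero_at p A = A -> zero_at p B = B ->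
  h * A = B -> zero_at p h = h.
Proof.
move=> rA zA zB e; apply: (regularI rA).
by rewrite -{1}zA -zero_atM [A * h]mulrC e zB.
Qed.

End ZeroIndependent.

(** * Supersymmetry of the Hall-Littlewood sums *)

Section Supersymmetry.
Variables (p0 p1 : 'I_n).
Hypotheses (e0 : val p0 = 0%N) (e1 : val p1 = 1%N).
Local Notation s := (susy_subst R ib n).
Local Notation sg f := (pcomp R n n f s).
Let K := [pred a : 'I_n | (a == p0) || (a == p1)].

Let p10 : p1 != p0. Proof. by rewrite -val_eqE /= e0 e1. Qed.

Let s0 : s p0 = X p0. Proof. by rewrite /susy_subst e0 /= -e0. Qed.
Let s1 : s p1 = bar (X p0). Proof. by rewrite /susy_subst e1 /= -e0. Qed.
Let sK a : ~~ K a -> s a = X a.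
Proof.
rewrite /K /= negb_or => /andP[_ ne]; rewrite /susy_subst.
by have -> : (val a == 1%N) = false by rewrite -e1 val_eqE (negbTE ne).
Qed.

Lemma ordge_susy i : ordge 1 (s i).
Proof.
rewrite /susy_subst; case: ifP => _; last exact: ordge_xv.
by apply: (ordge_bar hib); have := @ordge_xv R n p0; rewrite -[nat_of_ord p0]/(val p0) e0.
Qed.

Let bars1 : bar (s p1) = X p0.
Proof. by rewrite s1 (fgl_barK hF) //; apply: ordge_xv. Qed.

Lemma susy_Z01 : sg (Zf p0 p1) = 0 /\ sg (Zf p1 p0) = 0.
Proof.
have o := ordge_susy; rewrite !pcomp_Z // [s p1 ⊕ _](fgl_addC hF) // s0 s1.
by rewrite (fgl_addN hib) //; apply: ordge_xv.
Qed.

(** After the substitution the two special variables are inverse to each other, so each numerator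
    involving one is the denominator involving the other. *)
Lemma susy_ZY a : sg (Zf a p0) = sg (Yf a p1) /\ sg (Zf a p1) = sg (Yf a p0).
Proof. by have o := ordge_susy; rewrite !pcomp_Z // !pcomp_Y // bars1 s0 s1. Qed.

Lemma susy_phi w a b : ~~ K a -> ~~ K b -> sg (phi r w a b) = phi r w a b.
Proof.
move=> ka kb; have o := ordge_susy.
by rewrite /phi; case: ifP => _; rewrite ?pcomp_Y ?pcomp_Z // !sK.
Qed.

Lemma susy_lin a i : s a (munit i) = if a == p1 then - (i == p0)%:R else (i == a)%:R.
Proof.
case: (eqVneq a p1) => [->|ne]; first by rewrite s1 (bar_lin hF hib) ?xv_lin //; apply: ordge_xv.
rewrite /susy_subst; have -> : (val a == 1%N) = false by rewrite -e1 val_eqE (negbTE ne).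
exact: xv_lin.
Qed.

(** If a or b is special, the coefficient of x_p0 is 1, -1, 2 or -2, all regular; otherwise the
    series is unchanged. *)
Lemma regular_susy_Y a b : a != b -> regular (sg (Yf a b)).
Proof.
move=> ne; have o := ordge_susy; rewrite pcomp_Y //.
have ob := ordge_bar hib (o b).
have h0 : (s a ⊕ bar (s b)) mzero = 0 by apply/ordge1P/(ordge_add hF).
have hl' i : (s a ⊕ bar (s b)) (munit i) = s a (munit i) - s b (munit i).
  by rewrite (add_lin hF) // (bar_lin hF hib).
have lt0 (j : 'I_n) : (j < p0)%N -> (s a ⊕ bar (s b)) (munit j) = 0 by rewrite e0.
have r1 := @regular1 R; have rN1 := @regularN1 R.
have f10 := negbTE p10; have f01 : (p0 == p1) = false by rewrite eq_sym.
have [ka|ka] := boolP (K a); have [kb|kb] := boolP (K b).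
- apply: (regular_lin (i := p0)) => //; rewrite hl' !susy_lin.
  case/orP: ka ne => /eqP ->; case/orP: kb => /eqP ->; rewrite ?f01 ?f10 ?eqxx // => _.
    by rewrite opprK -natrD; apply: regular_nat.
  by rewrite -opprD -natrD; apply: regularN; apply: regular_nat.
- move: kb; rewrite /K /= negb_or => /andP[kb0 kb1].
  apply: (regular_lin (i := p0)) => //; rewrite hl' !susy_lin (negbTE kb1).
  rewrite [p0 == b]eq_sym (negbTE kb0) subr0.
  by case/orP: ka => /eqP ->; rewrite ?f01 ?eqxx.
- move: ka; rewrite /K /= negb_or => /andP[ka0 ka1].
  apply: (regular_lin (i := p0)) => //; rewrite hl' !susy_lin (negbTE ka1).
  rewrite [p0 == a]eq_sym (negbTE ka0) sub0r.
  by case/orP: kb => /eqP ->; rewrite ?f01 ?eqxx ?opprK.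
- move: ka kb => ka kb; have := regular_Y ne.
  by rewrite /Yf -(sK ka) -(sK kb).
Qed.

Lemma HL_supersym f : HL_def R F ib n br l f -> forall m : mon n, (0 < m p0)%N -> sg f m = 0.
Proof.
move=> hf; have [J eJ] := HL_coset hf; have o := ordge_susy.
(* The images of the factors of Delta that involve a special variable. Every surviving summand
   contains this product and it can be cancelled. *)
pose E := (\prod_(a < n | ~~ K a) \prod_(b < n | K b) sg (Yf a b)) *
          (\prod_(a < n | K a) \prod_(b < n | b != a) sg (Yf a b)).
pose D := \prod_(a < n | ~~ K a) \prod_(b < n | (b != a) && ~~ K b) Yf a b.
pose C w := lead_part w * \prod_(a < n | ~~ K a) \prod_(b < n | (b != a) && ~~ K b) phi r w a b.
have nK a : ~~ K a -> a != p0 by rewrite /K /= negb_or => /andP[].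
have rE : regular E.
  apply: regularM; apply: regular_prod => a ka; apply: regular_prod => b kb.
    by apply: regular_susy_Y; apply: contraNneq ka => ->.
  by apply: regular_susy_Y; rewrite eq_sym.
have rD : regular D.
  apply: regular_prod => a ka; apply: regular_prod => b /andP[ne _].
  by apply: regular_Y; rewrite eq_sym.
have zD : zero_at p0 D = D.
  rewrite /D zero_at_prod; apply: eq_bigr => a ka; rewrite zero_at_prod.
  by apply: eq_bigr => b /andP[_ kb]; apply: zero_at_Y; apply: nK.
have eD : sg (HL_Delta R F ib n) = D * E.
  rewrite HL_DeltaE pcomp_prod //; under eq_bigr do rewrite pcomp_prod //.
  rewrite (prod_split K); congr (_ * _); apply: eq_bigr => a ka.
  by apply: eq_bigr => b /andP[_ kb]; rewrite pcomp_Y // !sK.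
(* Neither special variable is among the first r places. *)
pose good w := ((r <= (w^-1)%g p0) && (r <= (w^-1)%g p1))%N.
have goodK w a : good w -> K a -> (r <= (w^-1)%g a)%N.
  by case/andP=> g0 g1 /orP[] /eqP ->.
have termB w : good w -> sg (term w) = C w * E.
  move=> gw; rewrite /term pcompM // /C -mulrA; congr (_ * _).
    rewrite /lead_part pcomp_prod //; apply: eq_bigr => i hi.
    have ki : ~~ K (w i).
      by apply/negP => /(goodK w _ gw); rewrite permK leqNgt hi.
    by have oi := @ordge_xv R n (w i); rewrite br_comp // pcomp_xv // sK.
  rewrite pcomp_prod //; under eq_bigr do rewrite pcomp_prod //.
  rewrite (prod_split K); congr (_ * (_ * _)).
  - apply: eq_bigr => a ka; apply: eq_bigr => b /andP[_ kb]; exact: susy_phi.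
  - apply: eq_bigr => a ka.
    have two (G : 'I_n -> S) : \prod_(b < n | K b) G b = G p0 * G p1.
      rewrite (bigD1 p0) ?inE ?eqxx //=; congr (_ * _); apply: big_pred1 => b /=.
      by case: (eqVneq b p0) => [->|]; rewrite ?andbF ?andbT //= eq_sym (negbTE p10).
    have hphi b : K b -> phi r w a b = if ((w^-1)%g a < r)%N then Zf a b else Yf a b.
      move=> kb; rewrite /phi; case: ltnP => //= ha.
      by rewrite (leq_trans ha (goodK w b gw kb)).
    rewrite !two !hphi ?inE ?eqxx ?orbT //; case: ifP => // _.
    by have [-> ->] := susy_ZY a; rewrite mulrC.
  - apply: eq_bigr => a ka; apply: eq_bigr => b _; congr (pcomp _ _ _ _ _).
    by rewrite /phi ltnNge (goodK w a gw ka).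
(* If a special variable is among the first r places, the pair of the two contributes the numerator
   x_p0 ⊕ x_p1, which becomes 0. *)
have termA w : ~~ good w -> sg (term w) = 0.
  move=> ng; rewrite /term pcompM //.
  have kill a b : b != a -> sg (phi r w a b) = 0 ->
    sg (\prod_(a < n) \prod_(b < n | b != a) phi r w a b) = 0.
    move=> ne z; rewrite (bigD1 a) //= pcompM // (bigD1 b) //= pcompM // z.
    by rewrite !mul0r.
  have [z01 z10] := susy_Z01; rewrite negb_and -!ltnNge in ng.
  set q0 := (w^-1)%g p0 in ng; set q1 := (w^-1)%g p1 in ng.
  case: (ltngtP q0 q1) => [h|h|h].
  - rewrite (kill p0 p1) ?mulr0 // /phi -/q0 -/q1 h andbT.
    by case/orP: ng => [->|/(ltn_trans h) ->].
  - rewrite (kill p1 p0) ?mulr0 // 1?eq_sym // /phi -/q0 -/q1 h andbT.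
    by case/orP: ng => [/(ltn_trans h) ->|->].
  - by case/eqP: p10; apply: (@perm_inj _ (w^-1)%g); apply: val_inj; exact: esym h.
have zC w : good w -> zero_at p0 (C w) = C w.
  move=> gw; rewrite /C zero_atM zero_at_lead => [|i hi]; last first.
    apply: nK; apply/negP => /(goodK w _ gw); rewrite permK leqNgt hi //.
  congr (_ * _); rewrite zero_at_prod; apply: eq_bigr => a ka; rewrite zero_at_prod.
  by apply: eq_bigr => b /andP[_ kb]; apply: zero_at_phi; apply: nK.
(* After cancelling [E] nothing on the right, and no factor of [D], involves x_p0: so neither does
   the image of [f]. *)
have e : sg f * D = \sum_(w in J | good w) C w.
  apply: (regularI rE); rewrite mulrC -mulrA -eD -pcompM // eJ pcomp_sum //.
  rewrite mulrC mulr_suml (bigID good) /= [X in _ + X]big1 ?addr0 => [|w /andP[_ /termA]] //.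
  by apply: eq_bigr => w /andP[_ /termB].
have z : zero_at p0 (sg f) = sg f.
  apply: (zero_at_cancel rD zD _ e); rewrite zero_at_sum.
  by apply: eq_bigr => w /andP[_ /zC].
by move=> m hm; rewrite -z /zero_at hm.
Qed.

End Supersymmetry.

(** * Divisibility by x ⊕ x *)

Section Divisibility.
Variable p0 : 'I_n.
Local Notation D2 := (Zf p0 p0).
Hypothesis br_div : forall k, (0 < k)%N -> divides D2 (br (X p0) k).
Hypothesis l_strict : strict_part n l.

(** On the diagonal x_a = x_b the factor x_a ⊕ bar x_b is 0 and [D2] stays regular, so the cofactor
    of [D2] is itself divisible by x_a - x_b, which is then cancelled. *)
Lemma reg_mod_ZZ a b : a != b -> reg_mod D2 (Yf a b).
Proof.
move=> ne x [q eq]; have hd := @ordge_diag R n a b.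
have [u [v [eu uv]]] := Y_unit ne.
have [q' eq'] : divides (X a - X b) q.
  apply: diag_divides => //.
  have rz : regular (pcomp R n n D2 (diag R a b)).
    by rewrite pcomp_Z // /diag; case: ifP => _; apply: regular_ZZ.
  apply: rz; rewrite -pcompM // -eq pcompM // pcomp_Y // /diag eqxx [b == a]eq_sym (negbTE ne).
  by rewrite (fgl_addN hib) ?mul0r //; apply: ordge_xv.
exists (q' * v); have ex : u * x = D2 * q'.
  apply: (regularI (regular_XX ne)); rewrite mulrA -eu eq eq'; ring.
by rewrite mulrA -ex mulrAC uv mul1r.
Qed.

(** As bar x ⊕ (x ⊕ x) = x, the numerator is the denominator ⊕ [D2]: the two agree modulo [D2]. *)
Lemma ZY_mod a : divides D2 (Zf a p0 - Yf a p0).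
Proof.
have o := @ordge_xv R n; have ob := ordge_bar hib (o p0).
have e : bar (X p0) ⊕ D2 = X p0.
  rewrite /Zf -(fgl_addA hF) //.
  by rewrite [bar (X p0) ⊕ X p0](fgl_addC hF) // (fgl_addN hib) // (fgl_0g hF).
have -> : Zf a p0 = Yf a p0 ⊕ D2.
  by rewrite /Yf (fgl_addA hF) ?e //; exact: ordge_Z.
by apply: (add_mod hF); [exact: ordge_Y | exact: ordge_Z].
Qed.

Lemma prod_mod (J : finType) (P : pred J) (d : S) (G H : J -> S) :
  (forall k, P k -> divides d (G k - H k)) ->
  divides d (\prod_(k | P k) G k - \prod_(k | P k) H k).
Proof.
move=> h; elim/big_rec2: _ => [|i x y Pi hxy]; first by rewrite subrr; case: (ideal_div d).
have -> : G i * y - H i * x = (G i - H i) * y + H i * (y - x) by ring.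
by apply: dividesD; [apply/divides_mull/h | apply: divides_mulr].
Qed.

Lemma HL_div f : HL_def R F ib n br l f -> divides D2 (f - zero_at p0 f).
Proof.
move=> hf; have [J eJ] := HL_coset hf.
pose K := pred1 p0.
pose D := \prod_(a < n | ~~ K a) \prod_(b < n | (b != a) && ~~ K b) Yf a b.
pose E := (\prod_(a < n | ~~ K a) \prod_(b < n | K b) Yf a b) *
          (\prod_(a < n | K a) \prod_(b < n | b != a) Yf a b).
pose C w := lead_part w * \prod_(a < n | ~~ K a) \prod_(b < n | (b != a) && ~~ K b) phi r w a b.
(* If x_p0 is among the first r places, its bracket is divisible by [D2]; otherwise numerators and
   denominators involving x_p0 agree modulo [D2]. *)
pose good w := (r <= (w^-1)%g p0)%N.
have mE : reg_mod D2 E.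
  apply: reg_modM; apply: reg_mod_prod => a ka; apply: reg_mod_prod => b kb; apply: reg_mod_ZZ.
    by apply: contraNneq ka => ->.
  by rewrite eq_sym.
have mD : reg_mod D2 D.
  apply: reg_mod_prod => a ka; apply: reg_mod_prod => b /andP[ne _].
  by apply: reg_mod_ZZ; rewrite eq_sym.
have zD : zero_at p0 D = D.
  rewrite /D zero_at_prod; apply: eq_bigr => a ka; rewrite zero_at_prod.
  by apply: eq_bigr => b /andP[_ kb]; apply: zero_at_Y.
have eD : HL_Delta R F ib n = D * E by rewrite HL_DeltaE (prod_split K).
have termA w : ~~ good w -> divides D2 (term w).
  rewrite /good -ltnNge => hq; apply: divides_mull; rewrite /lead_part (bigD1 ((w^-1)%g p0)) //=.
  by apply: divides_mull; rewrite permKV; apply: br_div; rewrite strict_gt0.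
have termB w : good w -> divides D2 (term w - C w * E).
  move=> gw; rewrite /term /C (prod_split K).
  set A := \prod_(a < n | ~~ K a) \prod_(b < n | (b != a) && ~~ K b) _.
  rewrite -mulrA -mulrBr -mulrBr; do 2!apply: divides_mulr.
  have -> : \prod_(a < n | K a) \prod_(b < n | b != a) phi r w a b
          = \prod_(a < n | K a) \prod_(b < n | b != a) Yf a b.
    apply: eq_bigr => a /eqP ->; apply: eq_bigr => b _.
    by rewrite /phi ltnNge (gw : (r <= (w^-1)%g p0)%N).
  rewrite -mulrBl; apply: divides_mull; apply: prod_mod => a ka; apply: prod_mod => b /eqP ->.
  rewrite /phi; case: ifP => _; first exact: ZY_mod.
  by rewrite subrr; case: (ideal_div D2).
have zC w : good w -> zero_at p0 (C w) = C w.
  move=> gw; rewrite /C zero_atM zero_at_lead => [|i hi]; last first.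
    by apply/eqP => e; move: gw; rewrite /good -e permK leqNgt hi.
  congr (_ * _); rewrite zero_at_prod; apply: eq_bigr => a ka; rewrite zero_at_prod.
  by apply: eq_bigr => b /andP[_ kb]; apply: zero_at_phi.
set CC := \sum_(w in J | good w) C w.
have [q eq] : divides D2 (f * D - CC).
  apply: mE; rewrite mulrBr [E * (f * D)]mulrC -mulrA -eD eJ mulr_sumr (bigID good) /= addrAC -sumrB.
  apply: dividesD; apply: ideal_sum; try exact: ideal_div.
    by move=> w /andP[_ /termB]; rewrite mulrC.
  by move=> w /andP[_ /termA].
(* Since [D2] vanishes at x_p0 = 0, the congruence becomes an equality there. Subtracting it and
   cancelling [D] gives the claim. *)
have zq : zero_at p0 f * D = CC.
  have := congr1 (zero_at p0) eq; rewrite zero_atM zero_atB zero_atM zD.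
  have -> : zero_at p0 D2 = 0.
    rewrite zero_atE pcomp_Z; last exact: ordge_sub0.
    by rewrite /sub0 eqxx (fgl_g0 hF) //; apply: ordge_zero.
  have -> : zero_at p0 CC = CC.
    by rewrite /CC zero_at_sum; apply: eq_bigr => w /andP[_ /zC].
  by rewrite mul0r => /eqP; rewrite subr_eq0 => /eqP.
by apply: mD; rewrite mulrC mulrBl zq eq; apply: divides_mull; apply: divides_refl.
Qed.

End Divisibility.

End Term.
End HallLittlewood.

(** * Leading terms of supersymmetric series *)

Section LeadingSupersymmetric.
Variables (R : comNzRingType) (F : mps R 2) (ib : mps R 1) (n : nat).
Hypothesis hF : is_fgl R F.
Hypothesis hib : is_formal_inverse R F ib.
Local Notation S := (mps R n).
Local Notation X := (xv R n).
Implicit Types (i j k : 'I_n) (w : 'S_n) (a m : mon n).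
Variable f : S.
Hypothesis f_sym : symmetric R n f.

Definition mperm w (m : mon n) : mon n := [ffun i => m (w i)].

Lemma f_mperm w m : f (mperm w m) = f m.
Proof. exact: f_sym. Qed.

Lemma mdeg_mperm w m : mdeg (mperm w m) = mdeg m.
Proof.
by rewrite /mdeg [RHS](reindex_inj (@perm_inj _ w)); apply: eq_bigr => i _; rewrite ffunE.
Qed.

(** Otherwise exchanging the two exponents would give an earlier monomial with the same
    coefficient. *)
Lemma lead_decreasing m i j : lead f m (f m) -> f m != 0 -> (i < j)%N -> (m j <= m i)%N.
Proof.
move=> [_ hl] nz ij; rewrite leqNgt; apply/negP => lt.
case/eqP: nz; rewrite -(f_mperm (tperm i j)); apply: hl.
apply/mltP; right; rewrite mdeg_mperm; split=> //; exists i.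
rewrite !ffunE tpermL; split=> // k hk; rewrite ffunE tpermD //.
  by rewrite -val_eqE gtn_eqF.
by rewrite -val_eqE gtn_eqF // (ltn_trans hk).
Qed.

Variables (p0 p1 : 'I_n).
Hypotheses (e0 : val p0 = 0%N) (e1 : val p1 = 1%N).
Hypothesis f_susy : forall m : mon n, (0 < m p0)%N -> pcomp R n n f (susy_subst R ib n) m = 0.

Definition lin_susy i : S := if i == p1 then - X p0 else X i.

Lemma ordge_lin_susy i : ordge 1 (lin_susy i).
Proof. by rewrite /lin_susy; case: ifP => _; [apply: ordgeN|]; apply: ordge_xv. Qed.

Lemma susy_eqd1 i : eqd 1 (susy_subst R ib n i) (lin_susy i).
Proof.
rewrite /susy_subst /lin_susy.
have -> : (val i == 1%N) = (i == p1) by rewrite -e1.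
case: eqP => // _ m; have -> : X 0 = X p0 by rewrite -[nat_of_ord p0]/(val p0) e0.
have o := @ordge_xv R n p0; have ob := ordge_bar hib o.
rewrite leq_eqVlt ltnS leqn0 mdeg_eq0 => /orP[/eqP h|/eqP ->].
  by have [k ->] := mdeg1P h; rewrite (bar_lin hF hib).
by rewrite oppE o ?ob ?oppr0 // mdeg0.
Qed.

(** The exponent of the monomial to which the linearized substitution sends x^a, up to sign. *)
Definition merge (a : mon n) : mon n :=
  [ffun i => if i == p0 then (a p0 + a p1)%N else if i == p1 then 0%N else a i].

Lemma subst_monom_lin_susy a : subst_monom lin_susy a = (-1) ^+ a p1 *: mono (merge a).
Proof.
have p10 : p1 != p0 by rewrite -val_eqE /= e0 e1.
have -> : (-1) ^+ a p1 *: mono (merge a) = (-1) ^+ a p1 * mono (merge a) :> S.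
  by rewrite -signr_odd -[in RHS]signr_odd; case: odd; rewrite ?scale1r ?mul1r ?scaleN1r ?mulN1r.
rewrite /subst_monom (bigD1 p0) //= (bigD1 p1) //= /lin_susy eqxx eq_sym (negbTE p10).
rewrite mono_prod [\prod_(i < n) _](bigD1 p0) //= [\prod_(i < n | i != p0) X i ^+ _](bigD1 p1) //=.
rewrite !ffunE !eqxx (negbTE p10) expr0 mul1r [(- X p0) ^+ _]exprNn exprD.
rewrite (eq_bigr (fun i => X i ^+ merge a i)); first by ring.
by move=> i /andP[i0 i1]; rewrite ffunE (negbTE i0) (negbTE i1).
Qed.

(* In lowest degree the substitution is x_0 -> t, x_1 -> -t. Of the monomials that it sends to t^(2k) times a
   fixed monomial in the other variables, all but the one with exponents (k, k) precede the leading one. *)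
Lemma lead_distinct m i j : lead f m (f m) -> f m != 0 -> (i < j)%N -> (0 < m i)%N -> m i != m j.
Proof.
move=> [_ hl] nz ij mi; apply/eqP => eij; case/negP: nz; apply/eqP.
have p10 : p1 != p0 by rewrite -val_eqE /= e0 e1.
have nij : i != j by rewrite -val_eqE ltn_eqF.
(* By symmetry the exponents at i and j may be moved to the first two variables, where the
   substitution acts. *)
have [w [w0 w1]] : exists w : 'S_n, w p0 = i /\ w p1 = j.
  have xi : tperm p0 i p1 != i.
    by apply: contra p10 => /eqP h; rewrite -(inj_eq (@perm_inj _ (tperm p0 i))) tpermL h.
  exists (tperm p0 i * tperm (tperm p0 i p1) j)%g; rewrite !permM !tpermL.
  by split=> //; rewrite (tpermD xi) // eq_sym.
pose M0 := mperm w m; pose M := merge M0.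
have dM : mdeg M = mdeg m.
  rewrite -(mdeg_mperm w m) -/M0 /mdeg (bigD1 p0) //= (bigD1 p1) //= [RHS](bigD1 p0) //=.
  rewrite [in RHS](bigD1 p1) //= !ffunE !eqxx (negbTE p10) add0n addnA; congr (_ + _)%N.
  by apply: eq_bigr => k /andP[k0 k1]; rewrite ffunE (negbTE k0) (negbTE k1).
have M0p : (0 < M p0)%N by rewrite !ffunE eqxx w0 addn_gt0 mi.
have of_ : ordge (mdeg m) f by move=> x hx; apply: hl; apply/mltP; left.
have os k : ordge 1 (susy_subst R ib n k) by apply: (@ordge_susy _ _ _ _ hib p0 e0).
have h := f_susy M0p.
have e : eqd (mdeg m) (pcomp R n n f (susy_subst R ib n)) (pcomp R n n f lin_susy).
  rewrite -[mdeg m]/((1 + mdeg m).-1).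
  by apply: pcomp_eqd => //; [exact: ordge_lin_susy | exact: susy_eqd1].
rewrite e ?dM // in h.
have key (a : mon n) : merge a = M -> a != M0 -> f a = 0.
  move=> /ffunP ha ne; pose b := mperm (w^-1)%g a; have fb : f a = f b by rewrite f_mperm.
  have as_ : (a p0 + a p1 = m i + m j)%N by have := ha p0; rewrite !ffunE eqxx w0 w1.
  have ao k : k != p0 -> k != p1 -> a k = m (w k).
    by move=> k0 k1; have := ha k; rewrite !ffunE (negbTE k0) (negbTE k1).
  have bi : b i = a p0 by rewrite ffunE -w0 permK.
  have bj : b j = a p1 by rewrite ffunE -w1 permK.
  have bo k : k != i -> k != j -> b k = m k.
    move=> ki kj; rewrite ffunE ao ?permKV //.
      by apply: contraNneq ki => h'; rewrite -(permKV w k) h' w0.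
    by apply: contraNneq kj => h'; rewrite -(permKV w k) h' w1.
  have db : mdeg b = mdeg m.
    rewrite /mdeg (bigD1 i) //= (bigD1 j) 1?eq_sym //= [RHS](bigD1 i) //= [in RHS](bigD1 j) 1?eq_sym //=.
    rewrite !addnA bi bj as_; congr (_ + _)%N; apply: eq_bigr => k /andP[ki kj]; exact: bo.
  have lt_o k : (k < i)%N -> k != i /\ k != j.
    by move=> hk; rewrite -!val_eqE /= !ltn_eqF // (ltn_trans hk).
  rewrite fb; case: (ltngtP (m i) (b i)) => hbi.
  - apply: hl; apply/mltP; right; split=> //; exists i; split=> // k /lt_o[ki kj]; exact: bo.
  - rewrite -(f_mperm (tperm i j)); apply: hl; apply/mltP; right; rewrite mdeg_mperm.
    split=> //; exists i; rewrite ffunE tpermL bj; split; first by move: hbi as_; rewrite bi -eij; lia.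
    by move=> k /lt_o[ki kj]; rewrite ffunE tpermD 1?eq_sym // bo.
  - case/eqP: ne; apply/ffunP => k; rewrite ffunE.
    have [->|k0] := eqVneq k p0; first by rewrite w0 hbi bi.
    have [->|k1] := eqVneq k p1; last exact: ao.
    by rewrite w1; apply/eqP; rewrite -(eqn_add2l (m i)) -as_ hbi bi.
move: h; rewrite pcompE (bigD1 (box (mdeg M) M0)) //=.
have lM0 : low (box (mdeg M) M0) = M0.
  by apply: lowK => k; rewrite dM -(mdeg_mperm w m) leq_mdeg.
rewrite lM0 subst_monom_lin_susy scaleE /mono eqxx mulr1 big1 => [|b nb].
  rewrite addr0 => h; rewrite -(f_mperm w) -/M0.
  by rewrite -[f M0]mulr1 -(signrMK (M0 p1) 1) mulr1 mulrA h mul0r.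
rewrite subst_monom_lin_susy scaleE /mono; case: eqP => [hb|_]; last by rewrite !mulr0.
rewrite key ?mul0r //; apply: contra nb => /eqP h'; apply/eqP; apply: low_inj.
by rewrite lM0.
Qed.

End LeadingSupersymmetric.

Section PartMon.
Variable n : nat.
Implicit Types (m : mon n) (l : seq nat).

Lemma part_mon_inj l l' : strict_part n l -> strict_part n l' ->
  part_mon n l = part_mon n l' -> l = l'.
Proof.
move=> sl sl' e; have hs : (size l <= n)%N by case/and3P: sl.
have hs' : (size l' <= n)%N by case/and3P: sl'.
have en k : nth 0%N l k = nth 0%N l' k.
  have [hk|hk] := ltnP k n; first by have /ffunP/(_ (Ordinal hk)) := e; rewrite !ffunE.
  by rewrite !nth_default ?(leq_trans hs) ?(leq_trans hs').
have lt k : (k < size l)%N = (k < size l')%N by rewrite -(strict_gt0 sl) en (strict_gt0 sl').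
apply: (@eq_from_nth _ 0%N) => [|k _]; last exact: en.
by apply/eqP; rewrite eqn_leq leqNgt lt ltnn leqNgt -lt ltnn.
Qed.

(** Monotonicity makes the positive exponents an initial segment, whose length [q] is the length of
    the partition. *)
Lemma strict_mon m :
  (forall i j : 'I_n, (i < j)%N -> (m j <= m i)%N) ->
  (forall i j : 'I_n, (i < j)%N -> (0 < m i)%N -> m i != m j) ->
  exists2 l, strict_part n l & part_mon n l = m.
Proof.
move=> dec dis; pose q := #|[set i : 'I_n | (0 < m i)%N]|.
have hq (i : 'I_n) : (i < q)%N = (0 < m i)%N.
  have [mi|mi] := posnP (m i).
    apply/negbTE; rewrite -leqNgt -(card_ltn_set (ltnW (ltn_ord i))); apply: subset_leq_card.
    apply/subsetP => j; rewrite !inE => mj; rewrite ltnNge leq_eqVlt; apply/negP.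
    case/predU1P => [/val_inj e|/dec]; first by rewrite -e mi in mj.
    by rewrite mi leqn0 => /eqP e; rewrite e in mj.
  rewrite -[X in (X <= _)%N](card_ltn_set (ltn_ord i)); apply: subset_leq_card.
  apply/subsetP => j; rewrite !inE ltnS leq_eqVlt => /predU1P[/val_inj -> //|/dec].
  exact: leq_trans.
have qn : (q <= n)%N by rewrite -[X in (_ <= X)%N]card_ord max_card.
pose mm k := if insub k is Some i then m (i : 'I_n) else 0%N.
have mmE (i : 'I_n) : mm i = m i by rewrite /mm valK.
have en (i : 'I_n) : nth 0%N (mkseq mm q) i = m i.
  have [h|h] := ltnP i q; first by rewrite nth_mkseq.
  rewrite nth_default ?size_mkseq //; apply/eqP; rewrite eq_sym -leqn0 leqNgt -hq -leqNgt.
  exact: h.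
exists (mkseq mm q); last by apply/ffunP => i; rewrite ffunE.
apply/and3P; split; first by rewrite size_mkseq.
  apply/(sortedP 0%N) => k; rewrite size_mkseq => hk.
  have hk2 : (k.+1 < n)%N by apply: leq_trans hk qn.
  have hk1 : (k < n)%N by apply: ltnW.
  have /= -> := en (Ordinal hk1); have /= -> := en (Ordinal hk2).
  have h1 := dec (Ordinal hk1) (Ordinal hk2) (ltnSn _).
  have h2 := dis (Ordinal hk1) (Ordinal hk2) (ltnSn _).
  by rewrite ltn_neqAle h1 andbT eq_sym h2 // -hq ltnW.
apply/(all_nthP 0%N) => k; rewrite size_mkseq => hk.
have hk1 : (k < n)%N by apply: leq_trans hk qn.
by have /= -> := en (Ordinal hk1); rewrite -hq.
Qed.

End PartMon.

(** * Coprimality of the series x_i ⊕ x_i *)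

Section Doubling.
Variables (R : comNzRingType) (F : mps R 2) (n : nat).
Hypothesis hF : is_fgl R F.
Hypothesis torsion_free : forall k (a : R), (0 < k)%N -> a *+ k = 0 -> a = 0.
Hypothesis a11_mod2 : forall u w : R, F (mk2 1 1) * u = w *+ 2 -> exists v, u = v *+ 2.
Local Notation S := (mps R n).
Local Notation X := (xv R n).
Local Notation Z := (@Zf R F n).
Implicit Types (i j : 'I_n).

Lemma regular_two : regular (2%:R : R).
Proof. by move=> y; rewrite mulr_natl; apply: torsion_free. Qed.

Lemma double_factor : exists v : 'I_n -> S, exists k : 'I_n -> S, forall i,
  [/\ Z i i = X i * v i, v i = 2%:R + X i * k i, k i mzero = F (mk2 1 1) &
      forall j, j != i -> zero_at j (v i) = v i].
Proof.
have [K eK] := fgl_form hF; have o := @ordge_xv R n.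
pose k i := fgl_tail K (X i) (X i); pose v i : S := 2%:R + X i * k i.
exists v, k => i.
have e : Z i i = X i * v i.
  by rewrite /Zf (fgl_addK eK) // /v /k; ring.
split=> //.
  rewrite /k /fgl_tail pcomp_mzero => [|a]; last exact: ordge_pairf.
  by rewrite eK XYK11.
move=> j ne; apply: (regularI (@regular_xv R n i)); rewrite -[RHS]e.
have ne' : i != j by rewrite eq_sym.
rewrite -(zero_at_Z F ne' ne') e zero_atM zero_at_xv.
by rewrite (negbTE ne').
Qed.

Lemma reg_mod_xv i (y : S) : zero_at i y = y -> regular y -> reg_mod (X i) y.
Proof.
move=> zy ry x [q e]; have zx : zero_at i x = 0.
  apply: ry; rewrite -{1}zy -zero_atM e zero_atM zero_at_xv eqxx mul0r //.
by exists (shift_at i x); apply: zero_at_div.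
Qed.

Section Factor.
Variables v k : 'I_n -> S.
Hypothesis vk : forall i, [/\ Z i i = X i * v i, v i = 2%:R + X i * k i, k i mzero = F (mk2 1 1) &
      forall j, j != i -> zero_at j (v i) = v i].

Lemma lead_factor i : lead (v i) mzero 2%:R.
Proof.
have [_ -> _ _] := vk i; split=> [|x]; last by move/negP: (@mlt0 n x).
rewrite addpE natmulE oneE eqxx [X in _ + X](ordgeMl (d := 1)) ?mdeg0 ?addr0 //.
exact: ordge_xv.
Qed.

Lemma regular_factor i : regular (v i).
Proof. exact: lead_regular (lead_factor i) regular_two. Qed.

Lemma half_ps (g h : S) : 2%:R * g = 2%:R * h -> g = h.
Proof.
have t2 : regular (2%:R : S).
  move=> y; rewrite mulr_natl => e; apply: (@ps_torsion_free R torsion_free n 2) => //.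
exact: regularI.
Qed.

(* v_i = 2 + a11 x_i + ..., and a11 is regular modulo 2 *)
Lemma half_factor i (g h : S) : 2%:R * g = v i * h -> divides (v i) g.
Proof.
have [_ ev ek _] := vk i; move=> e.
(* From 2 g = (2 + x_i k_i) h. The leading coefficient a_11 of x_i k_i is regular modulo 2, so all
   coefficients of [h] are even. *)
have e2 : (X i * k i) * h = (2%:R : R) *: (g - h).
  rewrite scaler_nat; transitivity (v i * h - 2%:R * h); first by rewrite ev; ring.
  by rewrite -e; ring.
have lp : lead (X i * k i) (munit i) (F (mk2 1 1)).
  rewrite -[munit i]madd0 -[F _]mul1r; apply: lead_mul; first exact: lead_xv.
  by rewrite -ek; split=> [//|x]; move/negP: (@mlt0 n x).
have [|h' eh] := @dvd_ideal R n 2%:R h.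
  apply: (reg_coef_ideal (ideal_div _) (p := X i * k i) (m := munit i)).
  - by move=> x hx; case: lp => _ ->; case: (ideal_div (2%:R : R)).
  - move=> c; case: lp => -> _ [w ew]; have [|c' ->] := @a11_mod2 c w; first by rewrite ew mulr_natl.
    by exists c'; rewrite mulr_natl.
  - by move=> x; rewrite e2 scaleE; exists ((g - h) x).
exists h'; apply: half_ps; rewrite e eh scaler_nat -[h' *+ 2]mulr_natl; ring.
Qed.

(** Given v_j G = v_i H, setting x_j = 0 turns v_j into 2, and [half_factor] makes G divisible by
    v_i there. What remains of G is x_j times a series with the same property, so the quotients add
    up x_j-adically. *)
Lemma reg_mod_factor i j : i != j -> reg_mod (v i) (v j).
Proof.
move=> ne; have [_ evj _ _] := vk j; have [_ _ _ zi] := vk i.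
have zvi : zero_at j (v i) = v i by apply: zi; rewrite eq_sym.
have zvj : zero_at j (v j) = 2%:R.
  by rewrite evj zero_atD zero_atM zero_at_xv eqxx mul0r addr0 mulr2n zero_atD zero_at1.
pose st := {GH : S * S | v j * GH.1 = v i * GH.2}.
have step (s : st) : {s'M : st * S | (sval s).1 = v i * s'M.2 + X j * (sval s'M.1).1}.
  case: s => [[G H] /= e]; apply: cid.
  have [M eM] : divides (v i) (zero_at j G).
    by apply: (@half_factor i _ (zero_at j H)); rewrite -zvj -zero_atM e zero_atM zvi.
  have eG := shift_atE j G; rewrite eM in eG; set G1 := shift_at j G in eG.
  have e1 : X j * (v j * G1) = v i * (H - v j * M).
    rewrite mulrBr -e [in RHS]eG; ring.
  have zH : zero_at j (H - v j * M) = 0.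
    apply: (@regular_factor i); rewrite -{1}zvi -zero_atM -e1 zero_atM zero_at_xv eqxx.
    by rewrite mul0r.
  have e2 : v j * G1 = v i * shift_at j (H - v j * M).
    apply: (regularI (@regular_xv R n j)); rewrite e1 {1}(zero_at_div zH); ring.
  by exists (exist _ (G1, shift_at j (H - v j * M)) e2, M).
move=> G [H e]; pose fix sq (m : nat) : st :=
  if m is m'.+1 then (sval (step (sq m'))).1 else exist _ (G, H) e.
have := @adic_divides R n (X j) (v i) (fun m => (sval (sq m)).1) (fun m => (sval (step (sq m))).2).
apply; first exact: ordge_xv.
by move=> m; exact: (svalP (step (sq m))).
Qed.

Lemma zero_at_xv_ne i j : i != j -> zero_at j (X i) = X i.
Proof. by move=> ne; rewrite zero_at_xv (negbTE ne). Qed.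

Lemma reg_mod_double i j : i != j -> reg_mod (Z i i) (Z j j).
Proof.
move=> ne; have [-> _ _ zi] := vk i; have [-> _ _ zj] := vk j.
have ne' : j != i by rewrite eq_sym.
apply: reg_mod_mul; first exact: regular_xv.
  apply: reg_modM; apply: reg_mod_xv.
  - exact: zero_at_xv_ne.
  - exact: regular_xv.
  - exact: zj.
  - exact: regular_factor.
apply: reg_modM; last exact: reg_mod_factor.
move=> x [q e]; have zq : zero_at j q = 0.
  apply: (@regular_factor i); rewrite -{1}(zi _ ne') -zero_atM -e zero_atM zero_at_xv eqxx.
  by rewrite mul0r.
exists (shift_at j q); apply: (regularI (@regular_xv R n j)).
rewrite e {1}(zero_at_div zq); ring.
Qed.

End Factor.

(** The part of [g] made of the monomials that contain x_i. *)
Definition drop_zero i (g : S) : S := g - zero_at i g.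

Lemma drop_zeroE i g m : drop_zero i g m = if (0 < m i)%N then g m else 0.
Proof. by rewrite /drop_zero subE /zero_at; case: ifP; rewrite ?subr0 ?subrr. Qed.

Definition drops (s : seq 'I_n) (g : S) : S := foldr drop_zero g s.

Lemma dropsE s g m : drops s g m = if all (fun i => 0 < m i)%N s then g m else 0.
Proof.
elim: s => [|i s IH] //=; rewrite drop_zeroE IH.
by case: ifP => //= _; case: ifP.
Qed.

Lemma drops_divides i s g : i \notin s -> divides (Z i i) g -> divides (Z i i) (drops s g).
Proof.
elim: s => [|j s IH] //=; rewrite inE negb_or => /andP[ij /IH h /h [q ->]].
exists (q - zero_at j q); rewrite /drop_zero zero_atM (zero_at_Z F ij ij); ring.
Qed.

(** The restrictions commute, so any i may be taken first; the remaining ones preserve divisibility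
    by x_i ⊕ x_i, and coprimality combines the factors. *)
Lemma drops_double s (g : S) : uniq s -> (forall i, divides (Z i i) (drop_zero i g)) ->
  divides (\prod_(i <- s) Z i i) (drops s g).
Proof.
move=> us hg; have [v [k vk]] := double_factor.
apply: divides_prod => // [i hi|i j _ _]; last exact: (reg_mod_double vk).
have -> : drops s g = drops (rem i s) (drop_zero i g).
  apply: psP => m; rewrite !dropsE drop_zeroE (perm_all _ (perm_to_rem hi)) /=.
  by case: (0 < m i)%N => //=; case: all.
by apply: drops_divides; rewrite ?mem_rem_uniqF.
Qed.

(* Restricted to the monomials containing x_0 ... x_(r-1), the series is divisible by the product of the x_i ⊕ x_i. *)
Lemma lead_divides (ib : mps R 1) (f : S) r m c : (r <= n)%N ->
  (forall i, divides (Z i i) (drop_zero i f)) -> lead f m c ->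
  (forall i, (i < r)%N -> (0 < m i)%N) -> divides (2%:R ^+ r) c.
Proof.
move=> hr hf [fm fl] mpos; pose s := [seq i : 'I_n <- index_enum 'I_n | (i < r)%N].
have us : uniq s by rewrite filter_uniq // index_enum_uniq.
have [q eq] := drops_double us hf.
have hm : all (fun i => 0 < m i)%N s.
  by apply/allP => i; rewrite mem_filter => /andP[/mpos].
pose E : mon n := \big[@madd n/mzero]_(i <- s) munit i.
have lp : lead (\prod_(i <- s) Z i i) E (2%:R ^+ r).
  have -> : 2%:R ^+ r = \prod_(i <- s) 2%:R :> R.
    rewrite big_filter prodr_const; congr (_ ^+ _).
    exact/esym/card_ltn.
  by apply: lead_prod => i _; apply: lead_ZZ.
(* The product of the first r variables divides x^m, so [q] starts at the quotient monomial, and its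
   coefficient there times 2^r is [c]. *)
have le : mle E m.
  apply/mleP => i; rewrite /E big_maddE.
  have [hi|hi] := boolP (i \in s); last first.
    rewrite big_seq big1 // => j hj; rewrite ffunE val_eqE.
    by case: eqP => // e; rewrite e hj in hi.
  rewrite (bigD1_seq i) //= ffunE eqxx big1_seq => [|j /andP[ne _]].
    by rewrite addn0; have /allP := hm; apply.
  by rewrite ffunE val_eqE eq_sym (negbTE ne).
have r2 : regular (2%:R ^+ r : R).
  by elim: (r) => [|r' IH]; [exact: regular1 | rewrite exprS; apply: regularM => //; exact: regular_two].
rewrite -(msubK le) in fm fl hm; set m' := msub m E in fm fl hm.
have ql x : mlt x m' -> q x = 0.
  apply: (below_cancel lp r2) => y hy; rewrite mulrC -eq dropsE.
  by rewrite fl ?if_same // maddC.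
have lq : lead q m' (q m') by [].
have [e _] := lead_mul lp lq; exists (q m').
by rewrite -e -eq dropsE hm.
Qed.

End Doubling.

(** * Expansions *)

Section Expansion.
Variables (R : comNzRingType) (n : nat) (Gm : mps R n -> Prop) (P : seq nat -> mps R n).
Variable c0 : R.
Hypothesis c0_reg : regular c0.
Hypothesis P_lead : forall l, strict_part n l -> lead (P l) (part_mon n l) (c0 ^+ size l).
Hypothesis P_in : forall l, strict_part n l -> Gm (P l).
Hypothesis Gm_sub : forall f c l, Gm f -> strict_part n l -> Gm (f - c *: P l).
Hypothesis Gm_lead : forall f m, Gm f -> lead f m (f m) -> f m != 0 ->
  exists2 l, strict_part n l /\ part_mon n l = m & divides (c0 ^+ size l) (f m).

Definition prank l := rank (part_mon n l).

Lemma c0X_reg k : regular (c0 ^+ k).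
Proof. by elim: k => [|k IH]; [exact: regular1 | rewrite exprS; apply: regularM]. Qed.

Lemma prank_inj l l' : strict_part n l -> strict_part n l' -> prank l = prank l' -> l = l'.
Proof. by move=> s s' /rank_inj; apply: part_mon_inj. Qed.

Lemma P_below l m : strict_part n l -> (rank m < prank l)%N -> P l m = 0.
Proof. by move=> sl; rewrite rank_ltE; case: (P_lead sl) => _; apply. Qed.

(** The inverse of [prank], empty where the monomial of that rank is not a strict partition. *)
Definition part_at N : option (seq nat) :=
  if pselect (exists l, strict_part n l /\ prank l = N) is left h
  then Some (proj1_sig (cid h)) else None.

Lemma part_at_some N l : part_at N = Some l -> strict_part n l /\ prank l = N.
Proof. by rewrite /part_at; case: pselect => // h [<-]; case: cid. Qed.

Lemma part_at_prank l : strict_part n l -> part_at (prank l) = Some l.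
Proof.
move=> sl; case e : (part_at (prank l)) => [l'|].
  by have [sl' /prank_inj -> //] := part_at_some e.
by move: e; rewrite /part_at; case: pselect => // -[]; exists l.
Qed.

Definition quot (l : seq nat) (g : mps R n) : R :=
  if pselect (divides (c0 ^+ size l) (g (part_mon n l))) is left h then proj1_sig (cid h) else 0.

Lemma quotP l g : divides (c0 ^+ size l) (g (part_mon n l)) ->
  g (part_mon n l) = c0 ^+ size l * quot l g.
Proof. by rewrite /quot; case: pselect => // h _; case: cid. Qed.

Variable f : mps R n.
Hypothesis f_in : Gm f.

(** Elimination along the order: stage N has no monomial of rank below N left. Each coefficient is
    fixed at a single stage, so the infinite expansion is well defined. *)
Fixpoint remainder N : mps R n :=
  if N is N'.+1 then
    if part_at N' is Some l then remainder N' - quot l (remainder N') *: P l else remainder N'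
  else f.

Definition coef l := quot l (remainder (prank l)).

Lemma remainder_in N : Gm (remainder N).
Proof.
elim: N => [|N IH] //=; case e: (part_at N) => [l|] //.
by have [sl _] := part_at_some e; apply: Gm_sub.
Qed.

Lemma remainder0 N m : (rank m < N)%N -> remainder N m = 0.
Proof.
elim: N m => [|N IH] // m; rewrite ltnS leq_eqVlt => /predU1P[em|hm] /=; last first.
  case e: (part_at N) => [l|]; last exact: IH.
  have [sl el] := part_at_some e.
  by rewrite subE IH // scaleE P_below ?el // mulr0 subr0.
have lm : lead (remainder N) m (remainder N m).
  by split=> // x hx; apply: IH; rewrite -em rank_ltE.
(* If no strict partition has rank N, the coefficient there must already be 0, because a nonzero
   leading monomial is a strict partition. *)
case e: (part_at N) => [l|]; last first.
  apply/eqP; apply: contraPT (@erefl _ (part_at N)) => nz.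
  have [l [sl el] _] := Gm_lead (remainder_in N) lm nz.
  by rewrite -em -el -/(prank l) part_at_prank // in e.
have [sl el] := part_at_some e.
have pl : part_mon n l = m by apply: rank_inj; rewrite -/(prank l) el em.
have dv : divides (c0 ^+ size l) (remainder N (part_mon n l)).
  rewrite pl; have [->|nz] := eqVneq (remainder N m) 0; first by exists 0; rewrite mulr0.
  have [l' [sl' pl'] dv] := Gm_lead (remainder_in N) lm nz.
  by rewrite (part_mon_inj sl sl') // pl pl'.
have [e1 _] := P_lead sl.
by rewrite subE scaleE -pl e1 (quotP dv) mulrC subrr.
Qed.

Definition parts N : seq (seq nat) := pmap part_at (iota 0 N).

Lemma mem_parts N l : (l \in parts N) = strict_part n l && (prank l < N)%N.
Proof.
rewrite /parts mem_pmap; apply/mapP/andP => [[k]|[sl hl]].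
  by rewrite mem_iota => hk /esym/part_at_some[sl ->].
by exists (prank l); rewrite ?mem_iota // part_at_prank.
Qed.

Lemma parts_uniq N : uniq (parts N).
Proof.
rewrite /parts; elim: N => [|N IH] //; rewrite -addn1 iotaD pmap_cat cat_uniq IH /= add0n.
case e: (part_at N) => [l|] //=; rewrite orbF andbT.
have [sl el] := part_at_some e.
by rewrite -/(parts N) mem_parts el ltnn andbF.
Qed.

Lemma remainderE N : f = remainder N + \sum_(l <- parts N) coef l *: P l.
Proof.
elim: N => [|N IH]; first by rewrite /parts big_nil addr0.
rewrite {1}IH /parts -addn1 iotaD pmap_cat big_cat /= add0n -/(parts N) addn1 /=.
case e: (part_at N) => [l|]; rewrite /= ?big_nil ?addr0 //.
have [sl el] := part_at_some e.
rewrite big_cons big_nil /coef el addr0; move: (quot l (remainder N) *: P l) => t; ring.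
Qed.

Lemma expands_coef : expands R n P coef f.
Proof.
move=> m; exists (parts (rank m).+1); split.
- exact: parts_uniq.
- by apply/allP => l; rewrite mem_parts => /andP[].
- move=> l sl; rewrite mem_parts sl /= -leqNgt => h.
  by rewrite P_below // mulr0.
rewrite {1}(remainderE (rank m).+1) addpE remainder0 // add0r sumE.
by apply: eq_bigr.
Qed.

(** Compare coefficients at the leading monomial of [P l]: earlier partitions agree by induction,
    later ones do not contribute, and the leading coefficient is regular. *)
Lemma expands_unique c c' : expands R n P c f -> expands R n P c' f ->
  forall l, strict_part n l -> c' l = c l.
Proof.
move=> h h' l; move: {2}(prank l).+1 (ltnSn (prank l)) => N.
elim: N l => // N IH l; rewrite ltnS => hl sl.
have [s [us ss os es]] := h (part_mon n l).
have [s' [us' ss' os' es']] := h' (part_mon n l).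
(* A common finite support for the two expansions at this monomial. *)
pose u := undup (s ++ s'); set m := part_mon n l.
have su k : k \in u -> strict_part n k.
  by rewrite mem_undup mem_cat => /orP[/(allP ss)|/(allP ss')].
have ext (d : seq nat -> R) (t : seq (seq nat)) : uniq t -> {subset t <= u} ->
    (forall k, strict_part n k -> k \notin t -> d k * P k m = 0) ->
    \sum_(k <- t) d k * P k m = \sum_(k <- u) d k * P k m.
  move=> ut tu ot; rewrite [RHS](bigID (mem t)) /= [X in _ + X]big1_seq ?addr0; last first.
    by move=> k /andP[nk ku]; apply: ot => //; apply: su.
  rewrite -[RHS]big_filter; apply: perm_big; apply: uniq_perm => //.
    by rewrite filter_uniq // undup_uniq.
  move=> k; rewrite mem_filter; case kt: (k \in t) => //=.
  by rewrite tu.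
have e : \sum_(k <- u) (c' k - c k) * P k m = 0.
  under eq_bigr do rewrite mulrBl.
  rewrite sumrB -(ext c' s') // -?(ext c s) // -?es -?es' ?subrr //.
  - by move=> k ks; rewrite mem_undup mem_cat ks.
  - by move=> k ks; rewrite mem_undup mem_cat ks orbT.
have [pl _] := P_lead sl.
apply/eqP; rewrite -subr_eq0; apply/eqP/(c0X_reg (k := size l)); rewrite mulrC -pl -/m.
have [lu|lu] := boolP (l \in u); last first.
  move: lu; rewrite mem_undup mem_cat negb_or => /andP[ls ls'].
  by rewrite mulrBl os' // os // subrr.
rewrite -[RHS]e (bigD1_seq l) ?undup_uniq //= [X in _ = _ + X]big1_seq ?addr0 // => k /andP[nk ku].
have sk := su k ku; case: (ltngtP (prank k) (prank l)) => hk.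
- by rewrite (IH k) ?subrr ?mul0r // (leq_trans hk).
- by rewrite P_below ?mulr0.
- by case/eqP: nk; apply: prank_inj.
Qed.

End Expansion.

Lemma formal_basis_of_lead (R : comNzRingType) (n : nat) (Gm : mps R n -> Prop)
    (P : seq nat -> mps R n) (c0 : R) : regular c0 ->
  (forall l, strict_part n l -> lead (P l) (part_mon n l) (c0 ^+ size l)) ->
  (forall l, strict_part n l -> Gm (P l)) ->
  (forall f c l, Gm f -> strict_part n l -> Gm (f - c *: P l)) ->
  (forall f m, Gm f -> lead f m (f m) -> f m != 0 ->
    exists2 l, strict_part n l /\ part_mon n l = m & divides (c0 ^+ size l) (f m)) ->
  formal_basis R n Gm P.
Proof.
move=> h1 h2 h3 h4 h5; split=> // f hf; exists (coef P c0 f).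
have he := expands_coef h2 h4 h5 hf.
by split=> // c' hc'; apply: (expands_unique h1 h2 he hc').
Qed.

(** * The two bases over the Lazard ring *)

Section Main.
Variables (n : nat) (L : comNzRingType) (F : mps L 2) (ib : mps L 1).
Hypotheses (hn : (0 < n)%N) (hL : lazard_univ L F) (hib : is_formal_inverse L F ib).
Local Notation S := (mps L n).
Local Notation X := (xv L n).

Let hF : is_fgl L F. Proof. by case: hL. Qed.
Let tf : forall k (a : L), (0 < k)%N -> a *+ k = 0 -> a = 0.
Proof. by case: (lazard_regular hL). Qed.
Let a11 : forall u w : L, F (mk2 1 1) * u = w *+ 2 -> exists v, u = v *+ 2.
Proof. by case: (lazard_regular hL). Qed.
Let p0 : 'I_n := Ordinal hn.

Lemma brk1_comp (g : S) (s : 'I_n -> S) k : ordge 1 g -> (forall i, ordge 1 (s i)) ->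
  pcomp L n n (brk1 L n g k) s = brk1 L n (pcomp L n n g s) k.
Proof. by move=> hg hs; rewrite /brk1 !ppowE pcompX. Qed.

Lemma brk2E (g : S) k : brk2 L F n g k = if k is k'.+1 then fgl_add L n F g g * g ^+ k' else 1.
Proof. by case: k => // k; rewrite /= ppowE. Qed.

Lemma brk2_comp (g : S) (s : 'I_n -> S) k : ordge 1 g -> (forall i, ordge 1 (s i)) ->
  pcomp L n n (brk2 L F n g k) s = brk2 L F n (pcomp L n n g s) k.
Proof.
move=> hg hs; rewrite !brk2E; case: k => [|k]; first exact: pcomp1.
by rewrite pcompM // pcompX // pcomp_fgl_add.
Qed.

Lemma lead_xvX (i : 'I_n) k : lead (X i ^+ k) [ffun j => if j == i then k else 0%N] 1.
Proof.
elim: k => [|k IH].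
  have -> : [ffun j => if j == i then 0%N else 0%N] = mzero :> mon n.
    by apply/ffunP => j; rewrite !ffunE if_same.
  exact: lead1.
have -> : [ffun j => if j == i then k.+1 else 0%N] =
  madd (munit i) [ffun j => if j == i then k else 0%N].
  by apply/ffunP => j; rewrite !ffunE val_eqE; case: eqP.
by rewrite exprS -[1]mulr1; apply: lead_mul; first exact: lead_xv.
Qed.

Lemma brk1_lead (i : 'I_n) k : (0 < k)%N ->
  lead (brk1 L n (X i) k) [ffun j => if j == i then k else 0%N] 1.
Proof. by move=> _; rewrite /brk1 ppowE; apply: lead_xvX. Qed.

Lemma brk2_lead (i : 'I_n) k : (0 < k)%N ->
  lead (brk2 L F n (X i) k) [ffun j => if j == i then k else 0%N] 2%:R.
Proof.
case: k => // k _; rewrite brk2E.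
have -> : [ffun j => if j == i then k.+1 else 0%N] =
  madd (munit i) [ffun j => if j == i then k else 0%N].
  by apply/ffunP => j; rewrite !ffunE val_eqE; case: eqP.
by rewrite -[2%:R]mulr1; apply: lead_mul; [exact: lead_ZZ | exact: lead_xvX].
Qed.

Lemma brk2_div (i : 'I_n) k : (0 < k)%N -> divides (Zf F i i) (brk2 L F n (X i) k).
Proof. by case: k => // k _; rewrite brk2E; apply: divides_mull; apply: divides_refl. Qed.

Lemma act_sub w (f g : S) c m : act L n w (f - c *: g) m = act L n w f m - c * act L n w g m.
Proof. by []. Qed.

Lemma supersym_sub (f g : S) c : supersym L ib n f -> supersym L ib n g ->
  supersym L ib n (f - c *: g).
Proof.
move=> [sf tf'] [sg tg]; split=> [w m|n1 m i ei mi].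
  by rewrite act_sub sf sg.
have os k : ordge 1 (susy_subst L ib n k) by apply: (@ordge_susy _ _ _ _ hib p0).
by rewrite pcompB // pcompZ // subE scaleE (tf' n1 m i) // (tg n1 m i) // mulr0 subr0.
Qed.

Lemma GammaLplusE (f : S) : GammaLplus L F ib n f <->
  supersym L ib n f /\ divides (Zf F p0 p0) (f - zero_at p0 f).
Proof.
have e m : at_zero L n f m = zero_at p0 f m.
  rewrite /at_zero /zero_at; congr (if _ then _ else _).
  apply/existsP/idP => [[i /andP[/eqP ei mi]]|h]; last by exists p0.
  by rewrite (_ : p0 = i) //; apply: val_inj; rewrite ei.
split=> -[sf [g hg]]; split=> //; exists g.
  by apply: psP => m; rewrite subE -e hg.
by move=> m; rewrite e -subE hg.
Qed.

Lemma HL_in_Gamma br l f :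
  (forall (g : S) (s : 'I_n -> S) k, ordge 1 g -> (forall i, ordge 1 (s i)) ->
     pcomp L n n (br g k) s = br (pcomp L n n g s) k) ->
  strict_part n l -> HL_def L F ib n br l f -> supersym L ib n f.
Proof.
move=> hbr sl hf; have hl : (size l <= n)%N by case/and3P: sl.
split; first exact: (HL_symmetric hF hib tf hbr hl hf).
move=> n1 m i ei mi.
by apply: (HL_supersym hF hib tf hbr hl (p0 := i) (p1 := Ordinal n1) ei) => //.
Qed.

Lemma supersym_lead f m : supersym L ib n f -> lead f m (f m) -> f m != 0 ->
  exists2 l, strict_part n l & part_mon n l = m.
Proof.
move=> [sf tf'] lf nz; apply: strict_mon => i j hij.
  exact: (lead_decreasing sf lf nz hij).
(* Two distinct indices exist, so n > 1 and the supersymmetry condition is not vacuous. *)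
move=> mi; have n1 : (1 < n)%N by apply: leq_ltn_trans (ltn_ord j); apply: leq_ltn_trans hij.
apply: (lead_distinct hF hib sf (p0 := p0) (p1 := Ordinal n1) _ _ _ lf nz hij mi) => //.
by move=> x hx; apply: (tf' n1 x p0).
Qed.

(** The divisibility in Gamma_+ concerns the first variable; a transposition carries it to any
    other. *)
Lemma drop_all (f : S) : symmetric L n f -> divides (Zf F p0 p0) (f - zero_at p0 f) ->
  forall i, divides (Zf F i i) (drop_zero i f).
Proof.
move=> sf [q eq] i; exists (act L n (tperm p0 i) q).
have o j : ordge 1 (X (tperm p0 i j)) by apply: ordge_xv.
have -> : Zf F i i = act L n (tperm p0 i) (Zf F p0 p0) by rewrite actE pcomp_Z // tpermL.
rewrite !actE -pcompM // -eq -actE; apply: psP => m.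
rewrite drop_zeroE -[RHS]/((f - zero_at p0 f) [ffun k => m (tperm p0 i k)]).
rewrite subE /zero_at ffunE tpermL -/(act L n (tperm p0 i) f m) sf.
by case: ifP; rewrite ?subr0 ?subrr.
Qed.

Lemma main_existence l : strict_part n l ->
  (exists f, P_def L F ib n l f) /\ (exists f, Q_def L F ib n l f).
Proof.
move=> sl; have hl : (size l <= n)%N by case/and3P: sl.
split; first exact: (HL_exists hF hib tf brk1_comp hl).
exact: (HL_exists hF hib tf brk2_comp hl).
Qed.

Lemma main_P (P : seq nat -> S) : (forall l, strict_part n l -> P_def L F ib n l (P l)) ->
  formal_basis L n (GammaL L ib n) P.
Proof.
move=> hP; apply: (@formal_basis_of_lead L n _ P 1 (@regular1 L)) => [l sl|l sl|f c l hf sl|f m hf lf nz].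
- have hl : (size l <= n)%N by case/and3P: sl.
  exact: (HL_lead hF hib tf brk1_comp hl sl brk1_lead (hP l sl)).
- exact: HL_in_Gamma brk1_comp sl (hP l sl).
- by apply: supersym_sub => //; apply: HL_in_Gamma brk1_comp sl (hP l sl).
have [l sl el] := supersym_lead hf lf nz; exists l => //.
by exists (f m); rewrite expr1n mul1r.
Qed.

Lemma main_Q (Q : seq nat -> S) : (forall l, strict_part n l -> Q_def L F ib n l (Q l)) ->
  formal_basis L n (GammaLplus L F ib n) Q.
Proof.
move=> hQ.
have inG l : strict_part n l -> GammaLplus L F ib n (Q l).
  move=> sl; have hl : (size l <= n)%N by case/and3P: sl.
  apply/GammaLplusE; split; first exact: HL_in_Gamma brk2_comp sl (hQ l sl).
  exact: (HL_div hF hib tf brk2_comp hl (brk2_div p0) sl (hQ l sl)).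
apply: (@formal_basis_of_lead L n _ Q 2%:R) => [|l sl|l sl|f c l hf sl|f m hf lf nz].
- exact: regular_two.
- have hl : (size l <= n)%N by case/and3P: sl.
  exact: (HL_lead hF hib tf brk2_comp hl sl brk2_lead (hQ l sl)).
- exact: inG.
- move/GammaLplusE: hf => [sf df]; have /GammaLplusE[sq dq] := inG l sl.
  apply/GammaLplusE; split; first exact: supersym_sub.
  have -> : f - c *: Q l - zero_at p0 (f - c *: Q l) =
     (f - zero_at p0 f) - (c *: (Q l - zero_at p0 (Q l))).
    rewrite zero_atB; have [_ hz _] := cont_zero_at L p0; rewrite hz scalerBr; ring.
  apply: dividesB => //; rewrite -[_ - _]mul1r -scale_mull; exact: divides_mulr.
move/GammaLplusE: hf => [sf df]; have [l sl el] := supersym_lead sf lf nz; exists l => //.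
have hl : (size l <= n)%N by case/and3P: sl.
apply: (lead_divides hF tf a11 ib hl (drop_all (proj1 sf) df) lf) => i hi.
by rewrite -el ffunE (strict_gt0 sl).
Qed.

End Main.

(** The series are characterized by an equation with cleared denominators, so their existence is a
    separate claim; the basis property holds for every family of solutions. *)
Theorem mainTheorem3 (n : nat) (hn : (0 < n)%N)
  (L : comNzRingType) (F : mps L 2) (ib : mps L 1)
  (hL : lazard_univ L F) (hib : is_formal_inverse L F ib) :
  (forall l, strict_part n l ->
     (exists f, P_def L F ib n l f) /\ (exists f, Q_def L F ib n l f)) /\
  (forall P : seq nat -> mps L n,
     (forall l, strict_part n l -> P_def L F ib n l (P l)) ->
     formal_basis L n (GammaL L ib n) P) /\
  (forall Q : seq nat -> mps L n,
     (forall l, strict_part n l -> Q_def L F ib n l (Q l)) ->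
     formal_basis L n (GammaLplus L F ib n) Q).
Proof.
split; first by move=> l; apply: main_existence.
by split; [move=> P; apply: main_P | move=> Q; apply: main_Q].
Qed.
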